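(* For all real $\gamma\ge0$ and all real $p,q\ge\max\{2,\frac1\gamma\}$ there is a constant $C(p,q,\gamma)$ depending only on $p,q,\gamma$ such that the following holds. Let $m,n\ge2$ be integers, let $B=(B_{ij})$ be a deterministic real $m\times n$ matrix, let $G=(G_{ij})_{i\le m,j\le n}$ be a random matrix whose entries are i.i.d. standard Gaussian variables, and let $Z=(Z_{ij})_{i\le m,j\le n}$ be a random matrix, independent of $G$, which is log-concave and isotropic as a random vector in $\mathbb{R}^{mn}$. Let $X_{ij}=|Z_{ij}|^\gamma B_{ij}G_{ij}$. Then $$\mathbb{E}\|X\|_{p',q}\le C(p,q,\gamma)\Bigl[(\log m)^{\frac1q+\gamma}\max_{1\le i\le m}\|B_i\|_p+(\log n)^{\gamma}\max_{1\le j\le n}\|B^{(j)}\|_q+(\log m)^{1+\frac1q}\,\mathbb{E}\max_{1\le i\le m,\,1\le j\le n}|X_{ij}|\Bigr].$$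
   Context: A random vector $Z$ in $\mathbb{R}^d$ is log-concave if $\mathbb{P}(Z\in\lambda K+(1-\lambda)L)\ge\mathbb{P}(Z\in K)^{\lambda}\mathbb{P}(Z\in L)^{1-\lambda}$ for all nonempty compact $K,L\subset\mathbb{R}^d$ and $\lambda\in[0,1]$. It is isotropic if $\mathbb{E}Z=0$ and $\operatorname{Cov}Z=\mathrm{Id}$. For $x\in\mathbb{R}^d$, $\|x\|_r=(\sum_i|x_i|^r)^{1/r}$. $B_i\in\mathbb{R}^n$ denotes the $i$-th row and $B^{(j)}\in\mathbb{R}^m$ the $j$-th column of $B$. $p'$ is the Hölder conjugate of $p$, $\frac1p+\frac1{p'}=1$. $\|X\|_{p',q}=\sup\{\|Xt\|_q:\ t\in\mathbb{R}^n,\ \|t\|_{p'}\le1\}$ is the operator norm from $\ell_{p'}^n$ to $\ell_q^m$. For $\gamma=0$ one reads $\frac1\gamma=+\infty$. *)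

(* Defs.v *)
From HB Require Import structures.
From mathcomp Require Export all_boot all_order all_algebra.
From mathcomp Require Export all_classical all_reals all_analysis.

Set Implicit Arguments.
Unset Strict Implicit.
Unset Printing Implicit Defensive.

Export Order.TTheory GRing.Theory Num.Theory.
Export numFieldNormedType.Exports.

Local Open Scope classical_set_scope.
Local Open Scope ring_scope.

Section Norms.
Context {R : realType}.

Definition lr_norm (r : R) (k : nat) (x : 'cV[R]_k) : R :=
  (\sum_(i < k) `|x i ord0| `^ r) `^ r^-1.

(* The operator norm from l_a^n to l_b^m. For a, b >= 1 the set is nonempty
   and bounded, so that the real-valued [sup] is the actual supremum. *)
Definition lr_opnorm (a b : R) (m n : nat) (A : 'M[R]_(m, n)) : R :=
  sup [set lr_norm b (A *m t) | t in [set t : 'cV[R]_n | lr_norm a t <= 1]].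

End Norms.

Section Probability.
Context {d : measure_display} {T : measurableType d} {R : realType}.
Variable P : probability T R.
Local Open Scope ereal_scope.

Definition mutually_independent (I : finType) (X : I -> T -> R) : Prop :=
  forall (J : {set I}) (A : I -> set R), (forall i, measurable (A i)) ->
    P (\bigcap_(i in [set` J]) (X i @^-1` A i)) =
    \prod_(i in J) P (X i @^-1` A i).

(* [<<s open >>] is the Borel sigma-algebra. *)
Definition independent_rv (V W : topologicalType)
    (X : T -> V) (Y : T -> W) : Prop :=
  forall (A : set V) (B : set W), <<s open >> A -> <<s open >> B ->
    P (X @^-1` A `&` Y @^-1` B) = P (X @^-1` A) * P (Y @^-1` B).

(* At the endpoints lam = 0, 1 the convention is 0 `^ 0 = 1. *)
Definition log_concave (k : nat) (Z : T -> 'rV[R]_k) : Prop :=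
  forall (K L : set 'rV[R]_k) (lam : R),
    compact K -> compact L -> K !=set0 -> L !=set0 -> (0 <= lam <= 1)%R ->
    P (Z @^-1` K) `^ lam * P (Z @^-1` L) `^ (1 - lam) <=
    P (Z @^-1` [set (lam *: x + (1 - lam) *: y)%R | x in K & y in L]).

Definition isotropic (k : nat) (Z : T -> 'rV[R]_k) : Prop :=
  (forall i, 'E_P[fun w => Z w ord0 i] = 0) /\
  (forall i j, covariance P (fun w => Z w ord0 i) (fun w => Z w ord0 j) =
               ((1%:M : 'M[R]_k) i j)%:E).

Definition std_gaussian (X : {RV P >-> R}) : Prop :=
  forall A : set R, measurable A -> distribution P X A = normal_prob 0 1 A.

Definition random_mx (m n : nat) (Z : 'I_m -> 'I_n -> T -> R) (w : T) :
  'M[R]_(m, n) := \matrix_(i, j) Z i j w.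

End Probability.

(* Main.v *)
(* Conditionally on [Z] the matrix is a Gaussian one with fixed coefficients
   [a i j = |Z i j| ^ gamma * B i j], and after a further conditioning on the
   absolute values of its entries it is a Rademacher matrix.

   Rademacher matrices: by convexity the supremum over the unit ball of l_p' is at
   most a maximum over finitely many dyadic vectors [t], with
   [|t_j| = 2 ^ (- l_j (1 - 1/p))] and total mass [sum_j 2 ^ (- l_j) <= 3].  The
   levels of [t] are revealed one after the other.  The increments of a potential
   [sum_i beta_i |y_i| ^ q], where [y] is the partial product and the weights
   [beta_i], which stay in [1/2, 1], decrease a little at every step, have an
   exponential moment bounded by their drift.  A union bound over all prefixes of
   [t], with weights exponential in the size of their support, then costs only the
   logarithm of the number of columns.

   Gaussian matrices: columns with a large entry are at most polynomially many in
   [m], and the Rademacher bound applies to them with a factor [log m].  The other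
   columns have negligible norms, and the Rademacher bound is applied to the
   transposed matrix, which has [m] columns.

   Log-concavity enters only through Borell's lemma, applied to slabs, which gives
   exponential tails for the entries of [Z]. *)
Require Import Defs.
From mathcomp Require Import measurable_realfun ring lra zify.

Set Implicit Arguments.
Unset Strict Implicit.
Unset Printing Implicit Defensive.

Local Open Scope classical_set_scope.
Local Open Scope ring_scope.

(** * Rademacher matrices *)


(** The union bound is affordable because two scales match. A coordinate of level [l] has mass
    [2 ^ (- l)], which permits an exponential parameter of order [2 ^ l / r ^ q]; a prefix with [k]
    nonzero coordinates then costs [2 ^ (- l) * Lam * k], up to a factor [r ^ q]. Summed over the
    levels, the costs stay below twice the total mass times [Lam], so the number of levels does not
    appear. The obstacle is the first-order term [q * y ^ (q - 1) * z] of a step: it has mean zero,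
    but its square in the exponent is not covered by the drift. The decreasing weights exist to
    absorb it. The loss [(u + (b / r) ^ p) / 8] dominates the variance of the step divided by its
    mass, and it is summable along a row because the masses add up to at most 3 and the row has l_p
    norm at most [r]. Concave powers of random quantities are replaced by affine majorants before
    averaging, so that only integrals of nonnegative functions have to be added and compared. The
    Gaussian bound is free of the number of columns; [ln n] enters only through the maximal column
    norm of [|Z| ^ gamma * B]. *)

Section ScalarInequalities.
Context {R : realType}.
Implicit Types (p q r s u w x y z b : R).

(** Young's inequality [w * 1 <= w ^ r / r + (1 - 1 / r)], multiplied by [r]. *)
Lemma bernoulli_powR r w : 1 <= r -> 0 <= w -> 1 + r * (w - 1) <= w `^ r.
Proof.
rewrite le_eqVlt => /predU1P[<- w0|r1 w0]; first by rewrite powRr1//; lra.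
have r0 : 0 < r by lra.
have rV : 0 < 1 - r^-1 by rewrite subr_gt0 invf_lt1.
have := @conjugate_powR _ w 1 r (1 - r^-1)^-1 w0 ler01 r0.
rewrite invr_gt0 rV invrK subrKC => /(_ isT erefl).
rewrite mulr1 powR1 mul1r => h.
have : r * w <= r * (w `^ r / r + (1 - r^-1)) by rewrite ler_wpM2l// ltW.
rewrite mulrDr mulrCA divff ?gt_eqF// mulr1 mulrBr mulr1 divff ?gt_eqF//; lra.
Qed.

Lemma powRB_gt0 x r s : 0 < x -> x `^ (r - s) = x `^ r / x `^ s.
Proof. by move=> x0; rewrite powRB// (gt_eqF x0) /= implybT. Qed.

Lemma powRD_gt0 x r s : 0 < x -> x `^ (r + s) = x `^ r * x `^ s.
Proof. by move=> x0; rewrite powRD// (gt_eqF x0) /= implybT. Qed.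

(** Bernoulli's inequality at [w^-1], multiplied by [w ^ r]: this is the tangent at [w], whereas the
    previous lemma is the tangent at 1. *)
Lemma powR_tangent_le r w : 1 <= r -> 0 < w ->
  w `^ r <= 1 + r * w `^ (r - 1) * (w - 1).
Proof.
move=> r1 w0.
have w1 : 0 <= w^-1 by rewrite invr_ge0 ltW.
have := bernoulli_powR r1 w1.
have -> : w^-1 `^ r = (w `^ r)^-1.
  by rewrite -{1}(powR_inv1 (ltW w0)) -powRrM mulN1r powRN.
move=> h.
have wr : 0 < w `^ r by rewrite powR_gt0.
have := ler_wpM2l (ltW wr) h; rewrite divff ?gt_eqF// => {}h.
have -> : w `^ (r - 1) = w `^ r / w.
  by rewrite powRB_gt0// powRr1 ?ltW.
suff : w `^ r * (1 + r * (w^-1 - 1)) = w `^ r - r * (w `^ r / w) * (w - 1) by lra.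
by field; rewrite gt_eqF.
Qed.

(** After the tangent bound the slope is [w ^ (q - 1)] instead of 1. The difference is again of
    order [w - 1], by the tangent bound for [w >= 1] and by Bernoulli for [w < 1], which yields the
    quadratic remainder. *)
Lemma powR_expand1 q w : 2 <= q -> 2^-1 <= w <= 2 ->
  w `^ q <= 1 + q * (w - 1) + q * q * 2 `^ q * (w - 1) ^+ 2.
Proof.
move=> q2 /andP[w1 w2]; have w0 : 0 < w by lra.
have h2 : 1 <= 2 `^ (q - 2) :> R.
  by rewrite -[leLHS](powRr0 2) ler_powR; lra.
have h3 : 2 `^ (q - 2) <= 2 `^ q :> R by rewrite ler_powR; lra.
have q1 : 1 <= q by lra.
have q11 : 1 <= q - 1 by lra.
apply: le_trans (powR_tangent_le q1 w0) _.
suff : (w `^ (q - 1) - 1) * (w - 1) <= q * 2 `^ q * (w - 1) ^+ 2.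
  move=> h; have := ler_wpM2l (_ : 0 <= q) h; rewrite !expr2 in h *.
  by move=> /(_ ltac:(lra)); lra.
have [w1'|w1'] := leP 1 w.
- have w10 : 0 <= w - 1 by lra.
  have := powR_tangent_le q11 w0.
  rewrite (_ : q - 1 - 1 = q - 2); last by lra.
  have ww : w `^ (q - 2) <= 2 `^ (q - 2).
    by apply: ge0_ler_powR; rewrite ?nnegrE; lra.
  have w20 : 0 <= w `^ (q - 2) by exact: powR_ge0.
  move=> h.
  apply: (@le_trans _ _ ((q - 1) * w `^ (q - 2) * (w - 1) * (w - 1))).
    by apply: ler_wpM2r => //; lra.
  rewrite -[X in X <= _]mulrA -expr2; apply: ler_wpM2r; first exact: sqr_ge0.
  by apply: ler_pM; lra.
- have := bernoulli_powR q11 (ltW w0) => h.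
  apply: (@le_trans _ _ ((q - 1) * (w - 1) ^+ 2)).
    rewrite expr2 mulrA; apply: ler_wnM2r; lra.
  apply: ler_wpM2r; first exact: sqr_ge0.
  by apply: (@le_trans _ _ (q * 1)); [lra|apply: ler_wpM2l; lra].
Qed.

Lemma powR_expand q y x : 2 <= q -> 0 < y -> `|x| <= y / 2 ->
  (y + x) `^ q <= y `^ q + q * y `^ (q - 1) * x
                  + q * q * 2 `^ q * y `^ (q - 2) * x ^+ 2.
Proof.
move=> q2 y0; rewrite ler_norml => /andP[x1 x2].
have yN : y != 0 by rewrite gt_eqF.
have e1 : y `^ (q - 1) = y `^ q / y.
  by rewrite powRB_gt0// powRr1 ?ltW.
have e2 : y `^ (q - 2) = y `^ q / y ^+ 2.
  by rewrite powRB_gt0// powR_mulrn ?ltW.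
have -> : y + x = y * (1 + x / y) by field.
have h : - 2^-1 <= x / y <= 2^-1.
  by rewrite ler_pdivlMr// ler_pdivrMr//; apply/andP; split; lra.
rewrite [X in X <= _]powRM; [|exact: ltW|lra].
have hw : 2^-1 <= 1 + x / y <= 2 by lra.
apply: le_trans (ler_wpM2l (powR_ge0 _ _) (powR_expand1 q2 hw)) _.
rewrite e1 e2 le_eqVlt; apply/orP; left; apply/eqP; field.
by rewrite gt_eqF.
Qed.

(** For [x <= 1] put [y = x / 2]: the left side is [2 + (expR y - expR (- y)) ^ 2], and the
    difference of exponentials is at most [3 * y]. For [x > 1] already [x <= 2 * x ^ 2]. *)
Lemma expR_sym_le x : expR x + expR (- x) <= 2 * expR (2 * x ^+ 2).
Proof.
wlog x0 : x / 0 <= x => [hw|].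
  have [|x0] := leP 0 x; first exact: hw.
  by have := hw (- x); rewrite opprK sqrrN addrC; apply; lra.
have [x1|x1] := leP x 1; last first.
  have : x <= 2 * x ^+ 2 by rewrite expr2; nra.
  rewrite -ler_expR => h1.
  have : expR (- x) <= expR x by rewrite ler_expR; lra.
  lra.
pose y := x / 2.
have eD : expR x = expR y ^+ 2 by rewrite expr2 -expRD /y; congr expR; lra.
have eN : expR (- x) = expR (- y) ^+ 2 by rewrite expr2 -expRD /y; congr expR; lra.
have e1 : expR y * expR (- y) = 1 by rewrite -expRD subrr expR0.
have y0 : 0 <= y <= 2^-1 by rewrite /y; lra.
have h1 : 1 - y <= expR (- y) by exact: expR_ge1Dx.
have h2 : 1 + y <= expR y by exact: expR_ge1Dx.
have h3 := expR_ge1Dx (2 * x ^+ 2).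
have Ey : 0 < expR y by exact: expR_gt0.
have h4 : expR y - expR (- y) <= 3 * y.
  have : expR y * (1 - y) <= 1 by rewrite -[leRHS]e1 ler_wpM2l// ltW.
  move=> h.
  have hy : 0 <= y * (1 - 2 * y) by rewrite mulr_ge0//; lra.
  have : expR y <= 1 + 2 * y.
    by rewrite -(@ler_pM2r _ (1 - y)); [nra|lra].
  lra.
have h5 : 0 <= expR y - expR (- y).
  have : expR (- y) <= expR y by rewrite ler_expR; lra.
  lra.
rewrite eD eN.
have : (expR y - expR (- y)) ^+ 2 <= (3 * y) ^+ 2.
  by rewrite ler_sqr ?nnegrE//; lra.
rewrite /y in y0 *; rewrite sqrrB exprMn e1; rewrite !expr2 in h3 *; nra.
Qed.

(** The left side is a weighted geometric mean of [be ^ p] and [u], hence at most their maximum. It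
    trades products of an entry and a mass for quantities that can be summed along a row. *)
Lemma powR_mixed_le (be u a c p : R) : 0 < a -> 0 <= c -> 0 <= be -> 0 < u ->
  0 < p -> a + c = p -> be `^ a * u `^ (c / p) <= be `^ p + u.
Proof.
move=> a0 c0 b0 u0 p0 e.
have pN : p != 0 by rewrite gt_eqF.
have [ub|ub] := leP u (be `^ p).
- apply: (@le_trans _ _ (be `^ p)); last by lra.
  rewrite [leRHS](_ : _ = be `^ a * (be `^ p) `^ (c / p)); last first.
    by rewrite -powRrM mulrCA divff// mulr1 -powRD ?e// (negbTE pN).
  apply: ler_wpM2l; first exact: powR_ge0.
  apply: ge0_ler_powR; rewrite ?nnegrE ?powR_ge0 ?divr_ge0//; exact: ltW.
- apply: (@le_trans _ _ u); last by have := powR_ge0 be p; lra.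
  rewrite [leRHS](_ : _ = u `^ (a / p) * u `^ (c / p)); last first.
    by rewrite -powRD_gt0// -mulrDl e divff// powRr1// ltW.
  apply: ler_wpM2r; first exact: powR_ge0.
  have -> : be `^ a = (be `^ p) `^ (a / p).
    by rewrite -powRrM mulrCA divff// mulr1.
  apply: ge0_ler_powR; rewrite ?nnegrE ?powR_ge0 ?divr_ge0//; exact: ltW.
Qed.

End ScalarInequalities.


(** * The effect of one random sign on one row *)

Section TwoPoint.
Context {R : realType}.
Variables (p q : R).
Hypotheses (p2 : 2 <= p) (q2 : 2 <= q).

(** Chosen so that, for [y <= 4 * r], the squared first-order term uses up exactly half of the
    weight loss ([XX] in [two_point_pos]). *)
Definition mgf_rate : R := (2 * q * q * 4 `^ q)^-1.

Definition quad_cst : R := q * q * 2 `^ q.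

(** One summand for each regime in which the weight loss cannot pay: [y <= 2 * z], where [y + z] and
    [y - z] are at most [3 * z] in absolute value, and [y ^ 2 < 16 * quad_cst * b ^ 2], where the
    second-order term is of the size of [u * b ^ q]. *)
Definition drift_cst : R :=
  3 `^ q + quad_cst * (Num.sqrt (16 * quad_cst)) `^ (q - 2).

Lemma mgf_rate_gt0 : 0 < mgf_rate.
Proof.
have q0 : 0 < q by have := q2; lra.
by rewrite invr_gt0 ?mulr_gt0 ?powR_gt0.
Qed.

Lemma quad_cst_gt0 : 0 < quad_cst.
Proof.
have q0 : 0 < q by have := q2; lra.
by rewrite ?mulr_gt0 ?powR_gt0.
Qed.

Lemma drift_cst_ge0 : 0 <= drift_cst.
Proof. 
apply: addr_ge0; first exact: powR_ge0.
by apply: mulr_ge0; [exact/ltW/quad_cst_gt0|exact: powR_ge0].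
Qed.

Variables (r b u : R).
Hypotheses (r0 : 0 < r) (b0 : 0 <= b) (u0 : 0 < u) (u1 : u <= 1).

(** A step adds [z] with a random sign to the partial sum [y] of a row; [om] is the weight that the
    row gives up for it; [lam] is inversely proportional to the mass [u] of the coordinate. *)
Let z := b * u `^ (1 - p^-1).
Let om := (u + (b / r) `^ p) / 8.
Let lam := mgf_rate / (r `^ q * u).

Let lam0 : 0 < lam.
Proof. by rewrite divr_gt0 ?mulr_gt0 ?powR_gt0// mgf_rate_gt0. Qed.

Let pV : 0 < p^-1 <= 2^-1.
Proof.
have P2 := p2; apply/andP; split; first by rewrite invr_gt0; lra.
by rewrite lef_pV2 ?posrE//; lra.
Qed.

Let z0 : 0 <= z. Proof. by rewrite mulr_ge0// powR_ge0. Qed.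

Lemma step_powq : z `^ q <= u * b `^ q.
Proof.
have [Q2 /andP[_ pV2]] := (q2, pV).
rewrite powRM ?powR_ge0// -powRrM mulrC; apply: ler_wpM2r; first exact: powR_ge0.
by apply: ge1r_powR; [rewrite u0|nra].
Qed.

(** [powR_mixed_le] with exponents [2] and [p - 2]. This is what dictates both summands of [om]. *)
Lemma step_sq_weight : z ^+ 2 / u <= 8 * r ^+ 2 * om.
Proof.
have P2 := p2; have br0 : 0 <= b / r by rewrite divr_ge0// ltW.
have pN : p != 0 by rewrite gt_eqF//; lra.
have := @powR_mixed_le R (b / r) u 2 (p - 2) p.
rewrite (_ : 2 + (p - 2) = p); last by ring.
move=> /(_ ltac:(lra) ltac:(lra) br0 u0 ltac:(lra) erefl).
rewrite powR_mulrn//.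
have -> : z ^+ 2 / u = r ^+ 2 * ((b / r) ^+ 2 * u `^ ((p - 2) / p)).
  have -> : (p - 2) / p = (1 - p^-1) * 2 - 1 by field.
  rewrite powRB_gt0// powRr1 ?ltW// powRrM powR_mulrn ?powR_ge0//.
  by rewrite /z; field; rewrite !gt_eqF.
move=> h; rewrite /om mulrAC -mulrA mulrC -mulrA.
have := ler_wpM2l (sqr_ge0 r) h; lra.
Qed.

Lemma step_sq : z ^+ 2 <= b ^+ 2 * u.
Proof.
have /andP[_ pV2] := pV.
rewrite /z exprMn; apply: ler_wpM2l; first exact: sqr_ge0.
rewrite -(powR_mulrn _ (powR_ge0 _ _)) -powRrM.
by apply: ge1r_powR; [rewrite u0|lra].
Qed.

Let powR_sub2 (y : R) : 0 < y -> y `^ q = y `^ (q - 2) * y ^+ 2.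
Proof.
by move=> y0; rewrite -powR_mulrn ?ltW// -powRD_gt0//; congr (_ `^ _); ring.
Qed.

(** [B] is the weight of the row after the step and [B + om] the weight before. In the Taylor
    expansion the linear terms of the two signs combine to a hyperbolic cosine, whose quadratic
    exponent takes half of [om * y ^ q]; the second-order term takes the other half, up to the
    drift. *)
Lemma two_point_pos (y B : R) : 0 <= y <= 4 * r -> 0 <= B <= 1 ->
  expR (lam * (B * `|y + z| `^ q - (B + om) * y `^ q)) +
  expR (lam * (B * `|y - z| `^ q - (B + om) * y `^ q))
  <= 2 * expR (lam * (drift_cst * (u * b `^ q))).
Proof.
move=> /andP[y0 yr] /andP[B0 B1].
have [[[[P2 Q2] R0] B0'] [U0 U1]] := (p2, q2, r0, b0, (u0, u1)).
have Z0 := z0.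
have q0 : 0 <= q by lra.
have om0 : 0 <= om by rewrite divr_ge0// addr_ge0 ?powR_ge0// ltW.
have omu : u / 8 <= om by rewrite /om; have := powR_ge0 (b / r) p; lra.
have yq0 : 0 <= y `^ q by exact: powR_ge0.
have ub0 : 0 <= u * b `^ q by rewrite mulr_ge0 ?powR_ge0// ltW.
have K0 : 0 <= quad_cst * (Num.sqrt (16 * quad_cst)) `^ (q - 2).
  by rewrite mulr_ge0 ?powR_ge0// ltW// quad_cst_gt0.
have [yz|yz] := leP y (2 * z).
(* The step dominates: both outcomes are at most [3 * z], and [z ^ q <= u * b ^ q], so no
   cancellation between the signs is called upon. *)
- have H (w : R) : `|w| <= 3 * z ->
    expR (lam * (B * `|w| `^ q - (B + om) * y `^ q)) <=
    expR (lam * (drift_cst * (u * b `^ q))).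
    move=> wz; rewrite ler_expR; apply: ler_wpM2l; first exact: ltW.
    have : `|w| `^ q <= 3 `^ q * (u * b `^ q).
      apply: le_trans (_ : (3 * z) `^ q <= _).
        by apply: ge0_ler_powR => //; rewrite nnegrE; have := normr_ge0 w; lra.
      rewrite powRM//; apply: ler_wpM2l; [exact: powR_ge0|exact: step_powq].
    have : 0 <= `|w| `^ q by exact: powR_ge0.
    rewrite /drift_cst mulrDl; set A := `|w| `^ q; set D := 3 `^ q * _.
    have := mulr_ge0 K0 ub0; rewrite -/D => h1 h2 h3.
    have h4 : B * A <= A by rewrite ler_piMl.
    have h5 : 0 <= B * y `^ q by rewrite mulr_ge0.
    have h6 : 0 <= om * y `^ q by rewrite mulr_ge0.
    by rewrite [leRHS]mulrDl -/D; lra.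
  have W1 : `|y + z| <= 3 * z by rewrite ler_norml; apply/andP; split; lra.
  have W2 : `|y - z| <= 3 * z by rewrite ler_norml; apply/andP; split; lra.
  by have := H _ W1; have := H _ W2; lra.
have yp : 0 < y by lra.
set X := q * y `^ (q - 1) * z.
set Y := quad_cst * y `^ (q - 2) * z ^+ 2.
have E1 : `|y + z| `^ q <= y `^ q + X + Y.
  rewrite ger0_norm; last by lra.
  by apply: powR_expand => //; rewrite ger0_norm//; lra.
have E2 : `|y - z| `^ q <= y `^ q - X + Y.
  rewrite ger0_norm; last by lra.
  have := @powR_expand R q y (- z) q2 yp.
  by rewrite normrN ger0_norm// sqrrN mulrN; apply; lra.
have Y0 : 0 <= Y.
  by rewrite !mulr_ge0 ?powR_ge0 ?sqr_ge0// ltW// quad_cst_gt0.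
have y2r : y `^ (q - 2) <= 4 `^ (q - 2) * r `^ (q - 2).
  rewrite -powRM ?(ltW r0)//; apply: ge0_ler_powR; rewrite ?nnegrE//; lra.
have r2 : r `^ q = r `^ (q - 2) * r ^+ 2 by exact: powR_sub2.
have y2 : y `^ q = y `^ (q - 2) * y ^+ 2 by exact: powR_sub2.
have XX : 2 * (lam * X ^+ 2) <= om * y `^ q / 2.
  have -> : X ^+ 2 = q ^+ 2 * (y `^ q * y `^ (q - 2)) * z ^+ 2.
    rewrite /X !exprMn; congr (_ * _ * _).
    rewrite -powRD_gt0// -(powR_mulrn _ (powR_ge0 _ _)) -powRrM.
    by congr (_ `^ _); ring.
  have -> : 2 * (lam * (q ^+ 2 * (y `^ q * y `^ (q - 2)) * z ^+ 2)) =
     y `^ q * ((2 * mgf_rate * q ^+ 2 / r `^ q) * (y `^ (q - 2) * (z ^+ 2 / u))).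
    by rewrite /lam; field; rewrite !gt_eqF ?powR_gt0.
  rewrite (_ : om * y `^ q / 2 = y `^ q * (om / 2)); last by ring.
  apply: ler_wpM2l => //.
  have D0 : 0 <= 2 * mgf_rate * q ^+ 2 / r `^ q.
    by rewrite divr_ge0 ?powR_ge0// !mulr_ge0 ?sqr_ge0// ltW// mgf_rate_gt0.
  apply: (@le_trans _ _ (2 * mgf_rate * q ^+ 2 / r `^ q *
     ((4 `^ (q - 2) * r `^ (q - 2)) * (8 * r ^+ 2 * om)))).
    apply: ler_wpM2l => //; apply: ler_pM => //; first exact: powR_ge0.
    - by rewrite divr_ge0 ?sqr_ge0// ltW.
    - exact: step_sq_weight.
  rewrite r2 /mgf_rate (_ : 4 `^ q = 4 `^ (q - 2) * 4 ^+ 2); last exact: powR_sub2.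
  rewrite le_eqVlt; apply/orP; left; apply/eqP; field.
  by rewrite !gt_eqF ?powR_gt0//; lra.
have YY : Y <= om * y `^ q / 2 + drift_cst * (u * b `^ q).
  have q2' : 0 <= q - 2 by lra.
  have YE : Y <= quad_cst * y `^ (q - 2) * (b ^+ 2 * u).
    apply: ler_wpM2l; last exact: step_sq.
    by rewrite mulr_ge0 ?powR_ge0// ltW// quad_cst_gt0.
  apply: le_trans YE _; rewrite /drift_cst mulrDl.
  have D3 : 0 <= 3 `^ q * (u * b `^ q) by rewrite mulr_ge0// powR_ge0.
  have KD := mulr_ge0 K0 ub0.
  (* Either [y] is so large that [u / 8 <= om] pays for the second-order term, or [y] is below a
     multiple of [b] and the term goes into the drift. *)
  have [small|big] := leP (16 * quad_cst * b ^+ 2) (y ^+ 2).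
    have : quad_cst * y `^ (q - 2) * (b ^+ 2 * u) <= u * y `^ q / 16.
      rewrite y2 (_ : _ * (b ^+ 2 * u) =
         (u * y `^ (q - 2) / 16) * (16 * quad_cst * b ^+ 2)); last by field.
      rewrite [leRHS](_ : _ = (u * y `^ (q - 2) / 16) * y ^+ 2); last by field.
      apply: ler_wpM2l => //; rewrite divr_ge0// mulr_ge0 ?powR_ge0// ltW//.
    have := ler_wpM2r yq0 omu; lra.
  have bp : 0 < b.
    rewrite lt_neqAle b0 andbT eq_sym; apply/eqP => be; move: big.
    by rewrite be expr0n mulr0 ltNge sqr_ge0.
  suff : quad_cst * y `^ (q - 2) * (b ^+ 2 * u) <=
     quad_cst * Num.sqrt (16 * quad_cst) `^ (q - 2) * (u * b `^ q).
    by have := mulr_ge0 om0 yq0; lra.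
  rewrite -(mulrA quad_cst) -(mulrA quad_cst (_ `^ _)).
  apply: ler_wpM2l; first exact: (ltW quad_cst_gt0).
  rewrite (_ : b `^ q = b `^ (q - 2) * b ^+ 2); last exact: powR_sub2.
  rewrite (_ : Num.sqrt (16 * quad_cst) `^ (q - 2) * _ =
     (Num.sqrt (16 * quad_cst) `^ (q - 2) * b `^ (q - 2)) * (b ^+ 2 * u)); last by ring.
  apply: ler_wpM2r; first by rewrite mulr_ge0 ?sqr_ge0// ltW.
  rewrite -powRM ?sqrtr_ge0//; apply: ge0_ler_powR; rewrite ?nnegrE ?mulr_ge0 ?sqrtr_ge0//.
  have c0 : 0 <= 16 * quad_cst by have := quad_cst_gt0; lra.
  rewrite -ler_sqr ?nnegrE ?mulr_ge0 ?sqrtr_ge0//.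
  by rewrite exprMn sqr_sqrtr// ltW.
set e := lam * (Y - om * y `^ q).
have F1 : expR (lam * (B * `|y + z| `^ q - (B + om) * y `^ q)) <=
    expR e * expR (lam * B * X).
  rewrite -expRD ler_expR (_ : e + _ = lam * (Y - om * y `^ q + B * X)); last by rewrite /e; ring.
  apply: ler_wpM2l; first exact: ltW.
  have := ler_wpM2l B0 E1; rewrite mulrDr mulrDr.
  have BY : B * Y <= Y by rewrite ler_piMl.
  by rewrite mulrDl; lra.
have F2 : expR (lam * (B * `|y - z| `^ q - (B + om) * y `^ q)) <=
    expR e * expR (- (lam * B * X)).
  rewrite -expRD ler_expR (_ : e - _ = lam * (Y - om * y `^ q - B * X)); last by rewrite /e; ring.
  apply: ler_wpM2l; first exact: ltW.
  have := ler_wpM2l B0 E2; rewrite mulrDr mulrBr.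
  have BY : B * Y <= Y by rewrite ler_piMl.
  by rewrite mulrDl; lra.
apply: le_trans (lerD F1 F2) _; rewrite -mulrDr.
apply: le_trans (ler_wpM2l (expR_ge0 _) (expR_sym_le _)) _.
rewrite mulrCA ler_pM2l// -expRD ler_expR.
have BX : (lam * B * X) ^+ 2 <= lam * (lam * X ^+ 2).
  have X2 : 0 <= lam * (lam * X ^+ 2).
    by apply: mulr_ge0; [exact: ltW|apply: mulr_ge0; [exact: ltW|exact: sqr_ge0]].
  rewrite (_ : _ ^+ 2 = B ^+ 2 * (lam * (lam * X ^+ 2))); last by ring.
  rewrite -[leRHS]mul1r; apply: ler_wpM2r => //.
  by rewrite expr_le1.
have h1 := ler_wpM2l (ltW lam0) XX.
have h2 := ler_wpM2l (ltW lam0) YY.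
rewrite (_ : lam * (2 * (lam * X ^+ 2)) = 2 * (lam * (lam * X ^+ 2))) in h1; last by ring.
rewrite mulrDr in h2.
have -> : lam * (drift_cst * (u * b `^ q)) =
   lam * (om * y `^ q / 2) + lam * (drift_cst * (u * b `^ q)) - lam * (om * y `^ q / 2) by ring.
rewrite /e mulrBr (_ : lam * (om * y `^ q) = 2 * (lam * (om * y `^ q / 2))); last by field.
lra.
Qed.

Lemma two_point (y B : R) : `|y| <= 4 * r -> 0 <= B <= 1 ->
  expR (lam * (B * `|y + z| `^ q - (B + om) * `|y| `^ q)) +
  expR (lam * (B * `|y - z| `^ q - (B + om) * `|y| `^ q))
  <= 2 * expR (lam * (drift_cst * (u * b `^ q))).
Proof.
move=> yr B01; have [y0|y0] := leP 0 y.
  by rewrite (ger0_norm y0) two_point_pos//; rewrite ger0_norm// in yr; rewrite y0.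
have yN : 0 <= `|y| <= 4 * r by rewrite normr_ge0.
have := two_point_pos yN B01.
have -> : `| `|y| + z| = `|y - z|.
  by rewrite (ltr0_norm y0) -[LHS]normrN; congr (`|_|); ring.
have -> : `| `|y| - z| = `|y + z|.
  by rewrite (ltr0_norm y0) -[LHS]normrN; congr (`|_|); ring.
by rewrite addrC.
Qed.

End TwoPoint.


Section SignFlip.
Context {R : realType} {E : finType}.

Definition flip_sign (e : E) (eps : {ffun E -> bool}) : {ffun E -> bool} :=
  [ffun x => (x == e) (+) eps x].

Lemma flip_signK e : involutive (flip_sign e).
Proof. by move=> eps; apply/ffunP => x; rewrite !ffunE addKb. Qed.

Lemma flip_sign_at e eps : flip_sign e eps e = ~~ eps e.
Proof. by rewrite ffunE eqxx. Qed.

Lemma flip_sign_ne e eps x : x != e -> flip_sign e eps x = eps x.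
Proof. by move=> xe; rewrite ffunE (negbTE xe). Qed.

(** Pairing each sign pattern with its flip at [e] averages over the sign at [e] with the others
    fixed; it plays the part of a conditional expectation. *)
Lemma sum_flip_sign e (h : {ffun E -> bool} -> R) :
  \sum_eps h eps = 2^-1 * \sum_eps (h eps + h (flip_sign e eps)).
Proof.
have h1 : \sum_eps h (flip_sign e eps) = \sum_eps h eps.
  by rewrite [RHS](reindex_inj (inv_inj (flip_signK e))).
by rewrite big_split/= h1; field.
Qed.

End SignFlip.

(** * The potential of a partially revealed product *)

Section Lyapunov.
Context {R : realType} {I J : finType}.
Variables (p q r : R) (b : I -> J -> R) (t u : J -> R).
Hypotheses (p2 : 2 <= p) (q2 : 2 <= q) (r0 : 0 < r).
Hypothesis rowb : forall i, \sum_j `|b i j| `^ p <= r `^ p.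
Hypothesis u01 : forall j, 0 <= u j <= 1.
Hypothesis tu : forall j, `|t j| = u j `^ (1 - p^-1).
Hypothesis su : \sum_j u j <= 3.

Implicit Types (S D : {set I * J}) (eps : {ffun I * J -> bool}).

(** [S] is the set of entries whose signs have been revealed, [u j] the mass of the coordinate
    [t j]. *)
Definition partial_row S eps i : R :=
  \sum_(j | (i, j) \in S) (-1) ^+ eps (i, j) * (b i j * t j).

(* A row has total weight at most (1 + 3) / 8 = 1 / 2. *)
Definition entry_weight (e : I * J) : R :=
  (u e.2 + (`|b e.1 e.2| / r) `^ p) / 8.

Definition row_weight S i : R := 1 - \sum_(j | (i, j) \in S) entry_weight (i, j).

Definition lyapunov S eps : R :=
  \sum_i row_weight S i * `|partial_row S eps i| `^ q.

Let p0 : 0 < p. Proof. by have P2 := p2; lra. Qed.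

Lemma entry_weight_ge0 e : 0 <= entry_weight e.
Proof.
have /andP[U _] := u01 e.2.
by rewrite divr_ge0// addr_ge0 ?powR_ge0.
Qed.

Let rowb1 i : \sum_j (`|b i j| / r) `^ p <= 1.
Proof.
under eq_bigr do rewrite powRM ?invr_ge0 ?(ltW r0)//.
rewrite -mulr_suml.
have -> : r^-1 `^ p = (r `^ p)^-1.
  by rewrite -(powR_inv1 (ltW r0)) -powRrM mulN1r powRN.
by rewrite ler_pdivrMr ?powR_gt0// mul1r.
Qed.

Lemma row_weight_ge i S : 2^-1 <= row_weight S i.
Proof.
suff : \sum_(j | (i, j) \in S) entry_weight (i, j) <= 2^-1.
  by rewrite /row_weight; lra.
apply: le_trans (_ : \sum_j entry_weight (i, j) <= _).
  rewrite [leRHS](bigID (fun j => (i, j) \in S))/= lerDl sumr_ge0// => j _.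
  exact: entry_weight_ge0.
rewrite /entry_weight/= -mulr_suml big_split/=.
have := rowb1 i; have := su; lra.
Qed.

Lemma row_weight_le1 i S : row_weight S i <= 1.
Proof.
rewrite /row_weight lerBlDr lerDl sumr_ge0// => j _; exact: entry_weight_ge0.
Qed.

Let entry_le i j : `|b i j * t j| <= r * ((`|b i j| / r) `^ p + u j).
Proof.
have /andP[U0 U1] := u01 j.
rewrite normrM tu.
have [->|uN] := eqVneq (u j) 0.
  rewrite powR0; first by rewrite mulr0 addr0 mulr_ge0 ?powR_ge0// ltW.
  have P2 := p2; have : p^-1 <= 2^-1 by rewrite lef_pV2 ?posrE//.
  by move=> h; rewrite gt_eqF//; lra.
have up : 0 < u j by rewrite lt_neqAle eq_sym uN.
have P2 := p2.
have B0 : 0 <= `|b i j| / r by rewrite divr_ge0// ltW.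
have := @powR_mixed_le R (`|b i j| / r) (u j) 1 (p - 1) p.
rewrite (_ : 1 + (p - 1) = p); last by ring.
move=> /(_ ltac:(lra) ltac:(lra) B0 up p0 erefl).
rewrite powRr1// (_ : (p - 1) / p = 1 - p^-1); last first.
  by field; rewrite gt_eqF.
move=> h; have := ler_wpM2l (ltW r0) h; rewrite mulrA mulrCA divff ?gt_eqF//.
by rewrite mulr1.
Qed.

(** Valid for every choice of signs: by [entry_le] the absolute values along a row add up to at most
    [r * (1 + 3)]. This supplies the bound [4 * r] assumed in [two_point]. *)
Lemma partial_row_le S eps i : `|partial_row S eps i| <= 4 * r.
Proof.
apply: le_trans (ler_norm_sum _ _ _) _.
apply: le_trans (_ : \sum_(j | (i, j) \in S)
   r * ((`|b i j| / r) `^ p + u j) <= _).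
  by apply: ler_sum => j _; rewrite normrM normrX normrN1 expr1n mul1r entry_le.
apply: le_trans (_ : \sum_j r * ((`|b i j| / r) `^ p + u j) <= _).
  rewrite [leRHS](bigID (fun j => (i, j) \in S))/= lerDl sumr_ge0// => j _.
  have /andP[U0 _] := u01 j.
  by rewrite mulr_ge0 ?addr_ge0 ?powR_ge0// ltW.
rewrite -mulr_sumr big_split/= [leRHS]mulrC; apply: ler_wpM2l; first exact: ltW.
have := rowb1 i; have := su; lra.
Qed.

Lemma partial_row_flip S eps e i : e \notin S ->
  partial_row S (flip_sign e eps) i = partial_row S eps i.
Proof.
move=> eS; apply: eq_bigr => j ijS; rewrite flip_sign_ne//.
by apply: contraNneq eS => <-.
Qed.

Lemma lyapunov_flip S eps e : e \notin S ->
  lyapunov S (flip_sign e eps) = lyapunov S eps.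
Proof. by move=> eS; apply: eq_bigr => i _; rewrite partial_row_flip. Qed.

Lemma sum_row_setU1 S e i (F : I * J -> R) : e \notin S ->
  \sum_(j | (i, j) \in e |: S) F (i, j) =
  (if i == e.1 then F e else 0) + \sum_(j | (i, j) \in S) F (i, j).
Proof.
case: e => i0 j0 eS /=; have [->|ne] := eqVneq i i0.
  rewrite (bigD1 j0)/= ?setU11//; congr (_ + _); apply: eq_bigl => j.
  rewrite !inE xpair_eqE eqxx/=; have [->|_] := eqVneq j j0; last by rewrite andbT.
  by rewrite andbF (negbTE eS).
rewrite /= add0r; apply: eq_bigl => j.
by rewrite !inE xpair_eqE (negbTE ne).
Qed.

(** Only the row of [e] changes, and its old weight is the new one plus [entry_weight e]; the
    increment thus takes the form treated in [two_point]. *)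
Lemma lyapunov_setU1 S eps e : e \notin S ->
  lyapunov (e |: S) eps - lyapunov S eps =
  row_weight (e |: S) e.1 *
    `|partial_row S eps e.1 + (-1) ^+ eps e * (b e.1 e.2 * t e.2)| `^ q -
  (row_weight (e |: S) e.1 + entry_weight e) * `|partial_row S eps e.1| `^ q.
Proof.
move=> eS; rewrite /lyapunov -sumrB (bigD1 e.1)//= big1 ?addr0; last first.
  move=> i ne; rewrite /row_weight (sum_row_setU1 _ entry_weight)// (negbTE ne) add0r.
  rewrite {1}/partial_row.
  rewrite (sum_row_setU1 _ (fun x => (-1) ^+ eps x * (b x.1 x.2 * t x.2)))//.
  by rewrite (negbTE ne) add0r subrr.
rewrite {1}/partial_row.
rewrite (sum_row_setU1 _ (fun x => (-1) ^+ eps x * (b x.1 x.2 * t x.2)))//.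
rewrite eqxx [X in `|X|]addrC; congr (_ - _ * _).
rewrite /row_weight (sum_row_setU1 _ entry_weight)// eqxx; ring.
Qed.

Lemma lyapunov_step S eps e (lam : R) : e \notin S -> 0 < u e.2 ->
  lam = mgf_rate q / (r `^ q * u e.2) ->
  expR (lam * (lyapunov (e |: S) eps - lyapunov S eps)) +
  expR (lam * (lyapunov (e |: S) (flip_sign e eps) - lyapunov S (flip_sign e eps)))
  <= 2 * expR (lam * (drift_cst q * (u e.2 * `|b e.1 e.2| `^ q))).
Proof.
move=> eS ue ->.
have /andP[_ U1] := u01 e.2.
rewrite !lyapunov_setU1// partial_row_flip// flip_sign_at.
set y := partial_row S eps e.1; set B := row_weight _ _.
have B01 : 0 <= B <= 1.
  by rewrite row_weight_le1 andbT; have := row_weight_ge e.1 (e |: S); rewrite -/B; lra.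
have := two_point p2 q2 r0 (normr_ge0 (b e.1 e.2)) ue U1
  (partial_row_le S eps e.1) B01.
rewrite -/y -tu -normrM -/(entry_weight e).
set x := b e.1 e.2 * t e.2.
(* Whatever the sign of [x] and the current value of [eps e], the two outcomes are [y + |x|] and
   [y - |x|]. *)
have key (F : R -> R) : F (y + (-1) ^+ eps e * x) + F (y + (-1) ^+ (~~ eps e) * x)
    = F (y + `|x|) + F (y - `|x|).
  have [x0|x0] := leP 0 x.
    by rewrite (ger0_norm x0); case: (eps e); rewrite /= expr0 expr1 mul1r mulN1r// addrC.
  rewrite (ltr0_norm x0) opprK.
  by case: (eps e); rewrite /= expr0 expr1 mul1r mulN1r// addrC.
pose c := mgf_rate q / (r `^ q * u e.2).
have /= E := key (fun v => expR (c * (B * `|v| `^ q - (B + entry_weight e) * `|y| `^ q))).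
by rewrite -/c E.
Qed.

(** All entries of [D] have the same mass, hence a common [lam]. For an entry [e] of [D], the
    potentials before [e] is revealed do not depend on its sign, so averaging over this sign splits
    off one factor from [lyapunov_step]; the rest is induction on the size of [D]. *)
Lemma lyapunov_mgf S D (lam : R) : (forall e, e \in D -> e \notin S) ->
  (forall e, e \in D -> 0 < u e.2 /\ lam = mgf_rate q / (r `^ q * u e.2)) ->
  \sum_eps expR (lam * (lyapunov (S :|: D) eps - lyapunov S eps)) <=
  #|{ffun I * J -> bool}|%:R *
    expR (lam * (drift_cst q * \sum_(e in D) u e.2 * `|b e.1 e.2| `^ q)).
Proof.
have [n] := ubnP #|D|; elim: n S D => // n IH S D Dn SD Du.
have [->|[e eD]] := set_0Vmem D.
  rewrite finset.setU0 big_set0 !mulr0 expR0 mulr1.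
  under eq_bigr do rewrite subrr mulr0 expR0.
  by rewrite big_const iter_addr_0 -mulr_natl mulr1.
set D' := D :\ e; have DE : D = e |: D' by rewrite finset.setD1K.
have eS : e \notin S by exact: SD.
have eSD : e \notin S :|: D' by rewrite !inE eqxx (negbTE eS).
have [ue lamE] := Du _ eD.
have {IH}IH := IH S D' _ _ _.
have {}IH : \sum_eps expR (lam * (lyapunov (S :|: D') eps - lyapunov S eps)) <=
  #|{ffun I * J -> bool}|%:R *
    expR (lam * (drift_cst q * \sum_(e in D') u e.2 * `|b e.1 e.2| `^ q)).
  apply: IH.
  - by rewrite (cardsD1 e) eD ltnS in Dn.
  - by move=> x /finset.setD1P[_ /SD].
  - by move=> x /finset.setD1P[_ xD]; exact: Du.
have -> : S :|: D = e |: (S :|: D') by rewrite DE finset.setUCA.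
rewrite (sum_flip_sign e).
pose X := expR (lam * (drift_cst q * (u e.2 * `|b e.1 e.2| `^ q))).
apply: le_trans (_ : 2^-1 * \sum_eps (2 * X *
   expR (lam * (lyapunov (S :|: D') eps - lyapunov S eps))) <= _).
  apply: ler_wpM2l; first by rewrite invr_ge0.
  apply: ler_sum => eps _.
  have split eps' : lam * (lyapunov (e |: (S :|: D')) eps' - lyapunov S eps') =
    lam * (lyapunov (e |: (S :|: D')) eps' - lyapunov (S :|: D') eps') +
    lam * (lyapunov (S :|: D') eps' - lyapunov S eps') by ring.
  rewrite (split eps) (split (flip_sign e eps)) !expRD.
  rewrite (lyapunov_flip _ eS) (lyapunov_flip _ eSD) -mulrDl.
  apply: ler_wpM2r; first exact: expR_ge0.
  by have := lyapunov_step eps eSD ue lamE; rewrite (lyapunov_flip _ eSD).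
rewrite -mulr_sumr; set Y := \sum_eps _ in IH *.
have -> : 2^-1 * (2 * X * Y) = X * Y by field.
apply: le_trans (ler_wpM2l (expR_ge0 _) IH) _.
rewrite mulrCA -expRD le_eqVlt; apply/orP; left; apply/eqP.
congr (_ * expR _); rewrite [in RHS]DE big_setU1 ?mulrDr//=.
by rewrite !inE eqxx.
Qed.

End Lyapunov.


(** * Dyadic vectors, their masses and prefixes *)

Section DyadicVectors.
Context {R : realType} {J : finType}.
Variables (p : R) (K : nat).

(** [None] codes a zero coordinate, [Some (l, s)] one of size [2 ^ (- l * (1 - 1/p))] with sign bit
    [s]. *)
Definition level := option ('I_K.+1 * bool).

Definition level_mass (o : level) : R :=
  if o is Some (l, _) then 2^-1 ^+ l else 0.

Definition level_coef (o : level) : R :=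
  if o is Some (l, s) then (-1) ^+ s * (2^-1 ^+ l) `^ (1 - p^-1) else 0.

Definition level_lt (l : nat) (o : level) : bool :=
  if o is Some (k, _) then (k < l)%N else false.

Definition dyadic := {ffun J -> level}.

Definition admissible (s : dyadic) : bool := \sum_j level_mass (s j) <= 3.

Definition prefix (s : dyadic) (l : nat) : dyadic :=
  [ffun j => if level_lt l (s j) then s j else None].

Lemma level_mass01 o : 0 <= level_mass o <= 1.
Proof.
case: o => [[l s]|] /=; last by rewrite lexx ler01.
by rewrite exprn_ge0//= exprn_ile1//; lra.
Qed.

Lemma level_ltW l o : level_lt l o -> level_lt l.+1 o.
Proof. by case: o => [[k s]|]//= /ltnW; rewrite ltnS. Qed.

Lemma prefix_lt (s : dyadic) l l' j : (l' <= l)%N -> level_lt l' (prefix s l j) = level_lt l' (s j).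
Proof.
move=> ll; rewrite ffunE; case: ifPn => // /negPf; case: (s j) => [[k b]|]//= h.
by apply/esym/negbTE; rewrite -leqNgt; apply: leq_trans ll _; rewrite leqNgt h.
Qed.

Lemma prefix_id (s : dyadic) l j : level_lt l (s j) -> prefix s l j = s j.
Proof. by move=> h; rewrite ffunE h. Qed.

Lemma prefix_admissible (s : dyadic) l : admissible s -> admissible (prefix s l).
Proof.
rewrite /admissible; apply: le_trans; apply: ler_sum => j _; rewrite ffunE.
by case: ifPn => // _; have /andP[] := level_mass01 (s j).
Qed.

Lemma sum_geom_tail (k n : nat) :
  \sum_(l < n | (k <= l)%N) (2^-1 : R) ^+ l <= 2 * 2^-1 ^+ k.
Proof.
have pos m : 0 <= (2^-1 : R) ^+ m by rewrite exprn_ge0.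
(* The induction on [n] carries the geometric remainder, which the final bound drops. *)
suff : \sum_(l < n | (k <= l)%N) (2^-1 : R) ^+ l
    <= 2 * 2^-1 ^+ k - (if (k <= n)%N then 2 * 2^-1 ^+ n else 2 * 2^-1 ^+ k).
  by have := pos n; have := pos k; case: ifP => _; lra.
elim: n => [|n IH].
  by rewrite big_ord0 leqn0; case: eqP => [->|_]; rewrite subrr.
rewrite big_mkcond big_ord_recr/= -big_mkcond/=.
have e : (2^-1 : R) ^+ n = 2 * 2^-1 ^+ n.+1.
  by rewrite exprS mulrA divff// mul1r.
have [kn|kn] := leqP k n.
  rewrite leqW//=; rewrite kn/= in IH.
  by move: IH; rewrite e; set A := _ ^+ n.+1; lra.
move: IH; rewrite leqNgt kn /= subrr addr0 => IH.
have [e'|ne] := eqVneq k n.+1; first by rewrite e' leqnn/= -e'; lra.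
by rewrite leqNgt ltn_neqAle eq_sym ne kn /=; lra.
Qed.

Lemma sum_option {T : finType} (F : option T -> R) :
  \sum_o F o = F None + \sum_x F (Some x).
Proof.
rewrite (bigD1 None)//=; congr (_ + _).
rewrite (reindex_omap Some id)/=; last by case.
by apply: eq_bigl => x; rewrite eqxx.
Qed.

(** The weight is [z] to the size of the support. It factors over the coordinates, each of which is
    zero or takes one of [2 * K.+1] values. *)
Lemma sum_dyadic_weight (z : R) : 0 <= z ->
  \sum_(s : dyadic) \prod_j (if s j is Some _ then z else 1) =
  (1 + (2 * K.+1)%:R * z) ^+ #|J|.
Proof.
move=> z0.
rewrite -(bigA_distr_bigA (fun (_ : J) (o : level) => if o is Some _ then z else 1)).
rewrite prodr_const; congr (_ ^+ _).
rewrite sum_option/=; congr (1 + _).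
by rewrite sumr_const card_prod card_ord card_bool mulnC mulr_natl.
Qed.

End DyadicVectors.

Arguments dyadic : clear implicits.

Section DyadicNorm.
Context {R : realType} {I J : finType}.

Definition row_power (q : R) (x : I -> J -> R) (t : J -> R) : R :=
  \sum_i `|\sum_j x i j * t j| `^ q.

(** On the scale of [q]-th powers: the operator norm is compared with its root of order [q]. The
    default 0 of the maximum is harmless because [row_power] is nonnegative. *)
Definition dyadic_norm (p q : R) (K : nat) (x : I -> J -> R) : R :=
  \big[Num.max/0]_(s : dyadic J K | @admissible R _ _ s)
    row_power q x (fun j => level_coef p (s j)).

Definition sign_mx (eps : {ffun I * J -> bool}) (x : I -> J -> R) i j : R :=
  (-1) ^+ eps (i, j) * x i j.

End DyadicNorm.

(** * The union bound over prefixes, level by level *)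

Section SignAverage.
Context {R : realType} {I J : finType}.
Variables (p q r cq Lam : R) (K : nat) (b : I -> J -> R).
Hypotheses (p2 : 2 <= p) (q2 : 2 <= q) (r0 : 0 < r) (Lam0 : 0 <= Lam).
Hypothesis rowb : forall i, \sum_j `|b i j| `^ p <= r `^ p.
Hypothesis colb : forall j, \sum_i `|b i j| `^ q <= cq.
Hypothesis cq0 : 0 <= cq.
Hypothesis hLam : (2 * K.+1)%:R * #|J|%:R <= expR Lam.

Implicit Types (s : dyadic J K) (eps : {ffun I * J -> bool}).

Let mass s j : R := level_mass (s j).
Let coef s j : R := level_coef p (s j).
Let lset s l : {set I * J} := [set e | level_lt l (s e.2)].
Let W s l eps : R := lyapunov p q r b (coef s) (mass s) (lset s l) eps.
Let rate : R := mgf_rate q / r `^ q.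
Let supp s l : nat := #|[set j | level_lt l (s j)]%SET|.
Let lmass s l : R := \sum_(j | level_lt l.+1 (s j) && ~~ level_lt l (s j)) mass s j.

Let rate0 : 0 < rate.
Proof. by rewrite divr_gt0 ?powR_gt0 ?mgf_rate_gt0. Qed.

Let mass01 s j : 0 <= mass s j <= 1. Proof. exact: level_mass01. Qed.

Let coefE s j : `|coef s j| = mass s j `^ (1 - p^-1).
Proof.
rewrite /coef /mass; case: (s j) => [[l o]|] /=.
  by rewrite normrM normrX normrN1 expr1n mul1r ger0_norm ?powR_ge0.
have P2 := p2; have : p^-1 <= 2^-1 by rewrite lef_pV2 ?posrE//; lra.
by move=> h; rewrite normr0 powR0// gt_eqF//; lra.
Qed.

Let W0 s eps : W s 0 eps = 0.
Proof.
have q0 : q != 0 by have Q2 := q2; rewrite gt_eqF//; lra.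
rewrite /W /lyapunov big1// => i _.
rewrite (_ : partial_row _ _ _ _ _ = 0) ?normr0 ?powR0 ?mulr0//.
by rewrite /partial_row big_pred0// => j; rewrite inE/=; case: (s j) => [[]|].
Qed.

Let W_prefix s l l' eps : (l' <= l)%N -> W (prefix s l) l' eps = W s l' eps.
Proof.
move=> ll.
have eqv i j : ((i, j) \in lset (prefix s l) l') = ((i, j) \in lset s l').
  by rewrite !inE/= prefix_lt.
have eqs i j : (i, j) \in lset s l' -> prefix s l j = s j.
  rewrite inE/= => h; apply: prefix_id.
  by move: h; case: (s j) => [[k o]|]//= kl; exact: leq_trans kl ll.
apply: eq_bigr => i _.
have -> : row_weight p r b (mass (prefix s l)) (lset (prefix s l) l') i =
    row_weight p r b (mass s) (lset s l') i.
  congr (1 - _); apply: eq_big => j; first exact: eqv.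
  by rewrite eqv => /eqs h; rewrite /entry_weight/= /mass h.
have -> // : partial_row b (coef (prefix s l)) (lset (prefix s l) l') eps i =
    partial_row b (coef s) (lset s l') eps i.
apply: eq_big => j; first exact: eqv.
by rewrite eqv => /eqs h; rewrite /coef h.
Qed.

Let lmass_prefix s l : lmass (prefix s l.+1) l = lmass s l.
Proof.
rewrite /lmass; apply: eq_big => j; first by rewrite !prefix_lt.
by rewrite !prefix_lt// => /andP[h _]; rewrite /mass prefix_id.
Qed.

(** One random variable that controls the increment at level [l] for all vectors at once, at the
    price [expR (- Lam)] per nonzero coordinate. The parameter [rate * 2 ^ l] is the [lam] of
    entries of mass [2 ^ (- l)]. *)
Definition exp_excess l eps : R :=
  \sum_(s | @admissible R _ _ s)
    (\prod_j (if s j is Some _ then expR (- Lam) else 1)) *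
    expR (rate * 2 ^+ l * (W s l.+1 eps - W s l eps - drift_cst q * cq * lmass s l)).

(** Each exponential has average at most 1, since [drift_cst q * cq * lmass s l] bounds the drift of
    the level. The weights sum to at most [(1 + (2 * K.+1) * expR (- Lam)) ^ #|J|], which is at most
    [expR 1] by [hLam]. *)
Let excess_sum l :
  \sum_eps exp_excess l eps <= #|{ffun I * J -> bool}|%:R * expR 1.
Proof.
rewrite /exp_excess exchange_big/=.
apply: le_trans (_ : \sum_(s : dyadic J K) #|{ffun I * J -> bool}|%:R *
   \prod_j (if s j is Some _ then expR (- Lam) else 1) <= _); last first.
  rewrite -mulr_sumr; apply: ler_wpM2l => //.
  rewrite sum_dyadic_weight; last exact: expR_ge0.
  apply: le_trans (_ : expR ((2 * K.+1)%:R * expR (- Lam)) ^+ #|J| <= _).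
    apply: lerXn2r; rewrite ?nnegrE ?addr_ge0 ?mulr_ge0 ?expR_ge0//.
    exact: expR_ge1Dx.
  rewrite -expRM_natl ler_expR expRN mulrA ler_pdivrMr ?expR_gt0//.
  by rewrite mul1r mulrC.
have pr0 s : 0 <= \prod_j (if s j is Some _ then expR (- Lam) else 1) :> R.
  by apply: prodr_ge0 => j _; case: (s j) => // _; exact: expR_ge0.
rewrite big_mkcond; apply: ler_sum => s _; case: ifPn => [adm|_]; last first.
  by rewrite mulr_ge0.
rewrite -mulr_sumr mulrC; apply: ler_wpM2r => //.
pose D := [set e : I * J | level_lt l.+1 (s e.2) && ~~ level_lt l (s e.2)]%SET.
have uE : lset s l.+1 = (lset s l :|: D)%SET.
  apply/finset.setP => e; rewrite !inE; case: (boolP (level_lt l (s e.2))) => h /=.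
    exact: level_ltW.
  by rewrite andbT.
have dis e : e \in D -> e \notin lset s l by rewrite !inE => /andP[].
set lam := rate * 2 ^+ l.
have lamE e : e \in D -> 0 < mass s e.2 /\ lam = mgf_rate q / (r `^ q * mass s e.2).
  rewrite inE /mass; case: (s e.2) => [[k o]|]//=; rewrite ltnS -leqNgt => kl.
  have {kl}-> : nat_of_ord k = l by apply/eqP; rewrite eqn_leq.
  split; first by rewrite exprn_gt0.
  by rewrite /lam /rate exprVn invfM invrK mulrA.
have mgf := lyapunov_mgf p2 q2 r0 rowb (mass01 s) (coefE s) adm dis lamE.
rewrite -uE in mgf.
have dm : \sum_(e in D) mass s e.2 * `|b e.1 e.2| `^ q <= cq * lmass s l.
  rewrite (eq_bigl (fun e : I * J => true && (level_lt l.+1 (s e.2) && ~~ level_lt l (s e.2)))); last first.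
    by move=> e; rewrite inE.
  rewrite -(pair_big (fun=> true) (fun j => level_lt l.+1 (s j) && ~~ level_lt l (s j))
     (fun i j => mass s j * `|b i j| `^ q))/= exchange_big/= mulr_sumr.
  apply: ler_sum => j _; rewrite -mulr_sumr mulrC; apply: ler_wpM2r => //.
  by have /andP[] := mass01 s j.
under eq_bigr => eps _ do rewrite mulrBr expRD.
rewrite -mulr_suml.
apply: le_trans (ler_wpM2r (expR_ge0 _) mgf) _.
rewrite -[X in X <= _]mulrA -expRD -[leRHS]mulr1; apply: ler_wpM2l => //.
rewrite -[leRHS]expR0 ler_expR subr_le0; apply: ler_wpM2l.
  by rewrite mulr_ge0 ?(ltW rate0)// exprn_ge0.
by rewrite -mulrA; apply: ler_wpM2l => //; exact: drift_cst_ge0.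
Qed.

(** The increment at level [l] depends on [prefix s l.+1] alone. Keeping the term of this prefix in
    [exp_excess] charges [Lam] only for coordinates of level at most [l], not for the whole support
    of [s]; then [1 + x <= expR x] removes the exponential. *)
Let increment_le s l eps : @admissible R _ _ s ->
  W s l.+1 eps - W s l eps <= drift_cst q * cq * lmass s l +
    rate^-1 * (2^-1 ^+ l * (Lam * (supp s l.+1)%:R + exp_excess l eps)).
Proof.
move=> adm.
set y := rate * 2 ^+ l * (W s l.+1 eps - W s l eps - drift_cst q * cq * lmass s l).
have le1 : expR (y - Lam * (supp s l.+1)%:R) <= exp_excess l eps.
  have adm' : @admissible R _ _ (prefix s l.+1) by exact: prefix_admissible.
  rewrite /exp_excess (bigD1 (prefix s l.+1))//= W_prefix// W_prefix// lmass_prefix -/y.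
  have -> : \prod_j (if prefix s l.+1 j is Some _ then expR (- Lam) else 1) =
      expR (- (Lam * (supp s l.+1)%:R)).
    rewrite -mulNr expRM_natr -prodr_const [RHS]big_mkcond/=; apply: eq_bigr => j _.
    by rewrite ffunE inE; case: (s j) => [[k o]|]//=; case: ifP.
  rewrite -expRD (addrC (- (Lam * _)) y) lerDl; apply: sumr_ge0 => s' _.
  apply: mulr_ge0; last exact: expR_ge0.
  by apply: prodr_ge0 => j _; case: (s' j) => // _; exact: expR_ge0.
have le2 : y <= Lam * (supp s l.+1)%:R + exp_excess l eps.
  by have := expR_ge1Dx (y - Lam * (supp s l.+1)%:R); lra.
have yE : W s l.+1 eps - W s l eps =
    drift_cst q * cq * lmass s l + rate^-1 * (2^-1 ^+ l * y).
  rewrite /y exprVn; field.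
  by rewrite expf_neq0// gt_eqF.
rewrite yE lerD2l; apply: ler_wpM2l; first by rewrite invr_ge0 ltW.
by apply: ler_wpM2l => //; rewrite exprn_ge0.
Qed.

Let sum_lmass s : @admissible R _ _ s -> \sum_(l < K.+1) lmass s l <= 3.
Proof.
apply: le_trans; rewrite /lmass; under eq_bigr do rewrite big_mkcond/=.
rewrite exchange_big/=; apply: ler_sum => j _; rewrite /mass.
case E : (s j) => [[k o]|] /=; last by rewrite big1.
rewrite -big_mkcond/= (big_pred1 k)// => l /=.
by rewrite ltnS -leqNgt -eqn_leq eq_sym.
Qed.

(** After exchanging the sums, a coordinate of level [k] is counted for all [l >= k] with total
    weight at most [2 * 2 ^ (- k)], twice its mass. This is why no factor [K] is lost. *)
Let sum_supp s : @admissible R _ _ s ->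
  \sum_(l < K.+1) 2^-1 ^+ l * (supp s l.+1)%:R <= 6 :> R.
Proof.
move=> adm; apply: le_trans (_ : 2 * \sum_j mass s j <= _); last first.
  by have : \sum_j mass s j <= 3 := adm; lra.
rewrite mulr_sumr.
under eq_bigr => l _.
  rewrite /supp -sum1_card natr_sum mulr_sumr big_mkcond/=.
  over.
rewrite exchange_big/=; apply: ler_sum => j _.
under eq_bigr do rewrite inE.
rewrite /mass; case: (s j) => [[k o]|] /=; last by rewrite big1// mulr0.
rewrite -big_mkcond/=; under eq_bigr do rewrite mulr1.
under eq_bigl do rewrite ltnS.
exact: sum_geom_tail.
Qed.

Lemma row_power_le s eps : @admissible R _ _ s ->
  row_power q (sign_mx eps b) (fun j => level_coef p (s j)) <=
  2 * (3 * (drift_cst q * cq) + rate^-1 *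
    (6 * Lam + \sum_(l < K.+1) 2^-1 ^+ l * exp_excess l eps)).
Proof.
move=> adm.
have half : row_power q (sign_mx eps b) (fun j => level_coef p (s j)) <=
    2 * W s K.+1 eps.
  rewrite /row_power mulr_sumr; apply: ler_sum => i _.
  have -> : \sum_j sign_mx eps b i j * level_coef p (s j) =
      partial_row b (coef s) (lset s K.+1) eps i.
    rewrite /partial_row [RHS]big_mkcond/=; apply: eq_bigr => j _.
    rewrite inE/= /sign_mx -mulrA /coef; case: (s j) => [[k o]|] /=.
      by rewrite ltn_ord.
    by rewrite !mulr0.
  have := row_weight_ge (p := p) (b := b) r0 rowb (mass01 s) adm i (lset s K.+1).
  set B := row_weight _ _ _ _ _ _; set A := `|_| `^ q => hB.
  have A0 : 0 <= A by exact: powR_ge0.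
  by have := ler_wpM2r A0 hB; lra.
apply: le_trans half _; rewrite ler_pM2l//.
have -> : W s K.+1 eps = \sum_(l < K.+1) (W s l.+1 eps - W s l eps).
  rewrite -(big_mkord predT (fun l => W s l.+1 eps - W s l eps)).
  by rewrite telescope_sumr// W0 subr0.
apply: le_trans (ler_sum _ (fun (l : 'I_K.+1) _ => increment_le l eps adm)) _.
rewrite big_split/=; apply: lerD.
  rewrite -mulr_sumr mulrC; apply: ler_wpM2r; last exact: sum_lmass.
  by rewrite mulr_ge0//; exact: drift_cst_ge0.
rewrite -mulr_sumr; apply: ler_wpM2l; first by rewrite invr_ge0 ltW.
under [X in X <= _]eq_bigr do rewrite mulrDr.
rewrite big_split/= lerD2r.
under eq_bigr do rewrite mulrCA.
rewrite -mulr_sumr mulrC; apply: ler_wpM2r => //; exact: sum_supp.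
Qed.

(** The bound of [row_power_le] is the same for every admissible vector, so it passes to the maximum
    before the average over signs is taken. *)
Lemma dyadic_norm_average :
  \sum_eps dyadic_norm p q K (sign_mx eps b) <= #|{ffun I * J -> bool}|%:R *
   (2 * (3 * (drift_cst q * cq) + r `^ q / mgf_rate q * (6 * Lam + 2 * expR 1))).
Proof.
have ex0 l eps : 0 <= exp_excess l eps.
  apply: sumr_ge0 => s' _; apply: mulr_ge0; last exact: expR_ge0.
  by apply: prodr_ge0 => j _; case: (s' j) => // _; exact: expR_ge0.
have dc0 : 0 <= drift_cst q by exact: drift_cst_ge0.
apply: le_trans (_ : \sum_eps 2 * (3 * (drift_cst q * cq) + rate^-1 *
    (6 * Lam + \sum_(l < K.+1) 2^-1 ^+ l * exp_excess l eps)) <= _).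
  apply: ler_sum => eps _; apply: bigmax_le => [|s adm]; last exact: row_power_le.
  rewrite mulr_ge0// addr_ge0 ?mulr_ge0 ?invr_ge0 ?(ltW rate0)//.
  rewrite addr_ge0 ?mulr_ge0// sumr_ge0// => l _.
  by rewrite mulr_ge0 ?exprn_ge0.
rewrite -mulr_sumr [leRHS]mulrCA; apply: ler_wpM2l => //.
rewrite big_split/= sumr_const -[_ *+ #|_|]mulr_natl mulrDr lerD2l.
rewrite -mulr_sumr [rate^-1]invf_div [leRHS]mulrCA; apply: ler_wpM2l.
  by rewrite divr_ge0 ?powR_ge0// ltW// mgf_rate_gt0.
rewrite big_split/= sumr_const -[_ *+ #|_|]mulr_natl mulrDr lerD2l.
rewrite exchange_big/=; under eq_bigr do rewrite -mulr_sumr.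
apply: le_trans (ler_sum _ (fun (l : 'I_K.+1) _ =>
  ler_wpM2l (exprn_ge0 l (_ : 0 <= 2^-1 :> R)) (excess_sum l))) _; first by [].
rewrite -mulr_suml.
rewrite [leRHS](_ : _ = 2 * (#|{ffun I * J -> bool}|%:R * expR 1)); last by ring.
 apply: ler_wpM2r.
  by rewrite mulr_ge0 ?expR_ge0.
have := sum_geom_tail (R := R) 0 K.+1; rewrite expr0 mulr1; apply: le_trans.
by rewrite le_eqVlt; apply/orP; left; apply/eqP; apply: eq_bigl.
Qed.

End SignAverage.


(** * Convexity and concavity of powers *)

Section PowerInequalities.
Context {R : realType}.
Implicit Types (a b x y z q D al : R).

Lemma le_powR2r q x y : 0 <= q -> 0 <= x -> x <= y -> x `^ q <= y `^ q.
Proof.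
by move=> q0 x0 xy; apply: ge0_ler_powR; rewrite ?nnegrE//; exact: le_trans xy.
Qed.

Lemma powR_invl q x : 0 <= x -> x^-1 `^ q = (x `^ q)^-1.
Proof. by move=> x0; rewrite -(powR_inv1 x0) -powRrM mulN1r powRN. Qed.

Lemma convex_powR_le q al a b : 1 <= q -> 0 <= a -> 0 <= b -> 0 <= al <= 1 ->
  (al * a + (1 - al) * b) `^ q <= al * a `^ q + (1 - al) * b `^ q.
Proof.
move=> q1 a0 b0 /andP[al0 al1]; set c := _ + _.
have l1 : 0 <= 1 - al by lra.
have c0 : 0 <= c by rewrite addr_ge0// mulr_ge0.
have [cz|cN] := eqVneq c 0.
  by rewrite cz powR0 ?gt_eqF//; [rewrite addr_ge0// mulr_ge0 ?powR_ge0|lra].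
have cp : 0 < c by rewrite lt_neqAle eq_sym cN.
have tang x : 0 <= x -> c `^ q * (1 + q * (x / c - 1)) <= x `^ q.
  move=> x0; have xc : 0 <= x / c by rewrite divr_ge0.
  have := ler_wpM2l (powR_ge0 c q) (bernoulli_powR q1 xc).
  by rewrite -powRM// mulrCA divff// mulr1.
have := lerD (ler_wpM2l al0 (tang a a0)) (ler_wpM2l l1 (tang b b0)).
apply: le_trans; rewrite le_eqVlt; apply/orP; left; apply/eqP.
rewrite (_ : al * _ + _ = c `^ q * (1 + q * (c / c - 1))).
  by rewrite divff// subrr mulr0 addr0 mulr1.
rewrite [in RHS](_ : c / c = (al * a + (1 - al) * b) / c)//; field.
by [].
Qed.

Lemma convex_normr_powR q al a b : 1 <= q -> 0 <= al <= 1 ->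
  `|al * a + (1 - al) * b| `^ q <= al * `|a| `^ q + (1 - al) * `|b| `^ q.
Proof.
move=> q1 al01; have /andP[al0 al1] := al01; have l1 : 0 <= 1 - al by lra.
apply: le_trans (convex_powR_le q1 (normr_ge0 a) (normr_ge0 b) al01).
apply: le_powR2r => //; first by lra.
by apply: le_trans (ler_normD _ _) _; rewrite !normrM (ger0_norm al0) (ger0_norm l1).
Qed.

Lemma normrD_powR q a b : 1 <= q ->
  `|a + b| `^ q <= 2 `^ q * (`|a| `^ q + `|b| `^ q).
Proof.
move=> q1.
have h : 0 <= (2^-1 : R) <= 1 by lra.
have := convex_normr_powR a b q1 h.
have -> : 2^-1 * a + (1 - 2^-1) * b = 2^-1 * (a + b) by field.
rewrite normrM powRM// ger0_norm// powR_invl// => h1.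
have p2 : 0 < 2 `^ q :> R by rewrite powR_gt0.
have := ler_wpM2l (ltW p2) h1; rewrite mulrA divff ?gt_eqF// mul1r => h2.
apply: (le_trans h2); apply: ler_wpM2l; first exact: ltW.
have := powR_ge0 `|a| q; have := powR_ge0 `|b| q; lra.
Qed.

Lemma powR_subadd q x y : 0 <= q <= 1 -> 0 <= x -> 0 <= y ->
  (x + y) `^ q <= x `^ q + y `^ q.
Proof.
move=> /andP[q0 q1] x0 y0.
have [s0|sN] := eqVneq (x + y) 0.
  have -> : x = 0 by lra.
  have -> : y = 0 by lra.
  by rewrite add0r lerDl powR_ge0.
have sp : 0 < x + y by rewrite lt_neqAle eq_sym sN addr_ge0.
have part z : 0 <= z <= x + y -> (x + y) `^ q * (z / (x + y)) <= z `^ q.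
  move=> /andP[z0 zs].
  have [->|zN] := eqVneq z 0; first by rewrite mul0r mulr0 powR_ge0.
  have zp : 0 < z by rewrite lt_neqAle eq_sym zN.
  rewrite [leRHS](_ : _ = (x + y) `^ q * (z / (x + y)) `^ q); last first.
    by rewrite -powRM ?divr_ge0 ?(ltW sp)// mulrCA divff// mulr1.
  apply: ler_wpM2l; first exact: powR_ge0.
  by apply: ger1_powR => //; rewrite divr_gt0//= ler_pdivrMr// mul1r.
have hx : 0 <= x <= x + y by lra.
have hy : 0 <= y <= x + y by lra.
apply: le_trans (lerD (part _ hx) (part _ hy)).
by rewrite -mulrDr -mulrDl divff// mulr1.
Qed.

(** A substitute for Jensen's inequality: the concave power is bounded by an affine function, which
    can be averaged, and [D] is later taken of the order of the mean of [y]. *)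
Lemma powR_le_affine q D y : 0 <= q <= 1 -> 0 < D -> 0 <= y ->
  y `^ q <= D `^ q * (1 + y / D).
Proof.
move=> /andP[q0 q1] D0 y0.
rewrite [leLHS](_ : _ = D `^ q * (y / D) `^ q); last first.
  by rewrite -powRM ?divr_ge0 ?(ltW D0)// mulrCA divff ?gt_eqF// mulr1.
apply: ler_wpM2l; first exact: powR_ge0.
have w0 : 0 <= y / D by rewrite divr_ge0// ltW.
apply: le_trans (_ : (1 + y / D) `^ q <= _); first by apply: le_powR2r => //; lra.
by apply: ler1_powR => //; lra.
Qed.

Lemma powRK q x : 0 <= x -> q != 0 -> (x `^ q) `^ q^-1 = x.
Proof. by move=> x0 qN; rewrite -powRrM divff// powRr1. Qed.

Lemma powRVK q x : 0 <= x -> q != 0 -> (x `^ q^-1) `^ q = x.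
Proof. by move=> x0 qN; rewrite -powRrM mulVf// powRr1. Qed.

End PowerInequalities.

(** * Reduction of the unit ball to dyadic vectors *)

Section Cover.
Context {R : realType} {I J : finType}.
Implicit Types (x : I -> J -> R) (t v tau : J -> R).

Lemma dyadic_round (K : nat) (v : R) : 0 <= v <= 1 ->
  exists l : 'I_K.+1, v <= 2^-1 ^+ l <= 2 * v + 2^-1 ^+ K.
Proof.
move=> /andP[v0 v1].
suff [l lK /andP[vl h]] : exists2 l, (l <= K)%N &
    (v <= 2^-1 ^+ l) && ((l == K) || (2^-1 ^+ l <= 2 * v)).
  exists (Ordinal (lK : (l < K.+1)%N)); rewrite /= vl /=.
  have pos : 0 <= (2^-1 : R) ^+ K by rewrite exprn_ge0.
  by case/orP: h => [/eqP ->|h]; lra.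
elim: K => [|K [l lK /andP[vl h]]]; first by exists 0%N; rewrite // expr0 v1 eqxx.
have [vK|vK] := leP v (2^-1 ^+ K.+1).
  by exists K.+1; rewrite // vK eqxx.
exists l; first exact: leqW.
rewrite vl/=; apply/orP; right; case/orP: h => // /eqP ->.
by move: vK; rewrite exprS; lra.
Qed.

(** A convex function on a box is largest at a vertex. One coordinate at a time is written as a
    convex combination of [tau j] and [- tau j], and the better endpoint is kept. *)
Lemma row_power_extreme q x t tau : 1 <= q -> (forall j, `|t j| <= tau j) ->
  exists eta : J -> bool,
    row_power q x t <= row_power q x (fun j => (-1) ^+ eta j * tau j).
Proof.
move=> q1 tt.
suff [eta he] : exists eta : J -> bool, row_power q x t <=
    row_power q x (fun j => if j \in enum J then (-1) ^+ eta j * tau j else t j).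
  exists eta; apply: (le_trans he); rewrite le_eqVlt; apply/orP; left; apply/eqP.
  apply: eq_bigr => i _; congr (`|_| `^ _); apply: eq_bigr => j _.
  by rewrite mem_enum.
elim: (enum J) => [|j0 s [eta he]]; first by exists (fun=> false).
pose v sb j := if j == j0 then (-1) ^+ (sb : bool) * tau j
   else if j \in s then (-1) ^+ eta j * tau j else t j.
pose w j := if j \in s then (-1) ^+ eta j * tau j else t j.
have [sb hsb] : exists sb, row_power q x w <= row_power q x (v sb).
  have w0 : `|w j0| <= tau j0.
    rewrite /w; case: ifP => // _; rewrite normrM normrX normrN1 expr1n mul1r.
    by rewrite ger0_norm//; exact: le_trans (tt j0).
  have [al al01 wE] : exists2 al, 0 <= al <= 1 & w j0 = al * tau j0 + (1 - al) * - tau j0.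
    have [t0|tN] := eqVneq (tau j0) 0.
      exists 0; first by lra.
      by move: w0; rewrite t0 normr_le0 => /eqP ->; ring.
    have tp : 0 < tau j0 by rewrite lt_neqAle eq_sym tN; exact: le_trans (tt j0).
    exists ((w j0 / tau j0 + 1) / 2); last by field.
    move: w0; rewrite ler_norml => /andP[w1 w2].
    have a1 : w j0 / tau j0 <= 1 by rewrite ler_pdivrMr// mul1r.
    have a2 : -1 <= w j0 / tau j0 by rewrite ler_pdivlMr// mulN1r.
    lra.
  have split : row_power q x w <=
      al * row_power q x (v false) + (1 - al) * row_power q x (v true).
    rewrite /row_power !mulr_sumr -big_split/=; apply: ler_sum => i _.
    apply: le_trans (convex_normr_powR _ _ q1 al01).
    rewrite le_eqVlt; apply/orP; left; apply/eqP; congr (`|_| `^ _).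
    rewrite !mulr_sumr -big_split/=; apply: eq_bigr => j _.
    rewrite /v; have [->|_] := eqVneq j j0.
      by rewrite wE expr0 expr1; ring.
    by rewrite -/(w j); ring.
  have /andP[al0 al1] := al01.
  have [le|le] := leP (row_power q x (v false)) (row_power q x (v true)).
    exists true; apply: (le_trans split).
    have := ler_wpM2l al0 le; lra.
  exists false; apply: (le_trans split).
  have l1 : 0 <= 1 - al by lra.
  have := ler_wpM2l l1 (ltW le); lra.
exists (fun j => if j == j0 then sb else eta j).
apply: le_trans he _; apply: (le_trans hsb).
rewrite le_eqVlt; apply/orP; left; apply/eqP.
apply: eq_bigr => i _; congr (`|_| `^ _); apply: eq_bigr => j _.
by rewrite /v inE; case: eqP => [->|].
Qed.

(** The masses [|t_j| ^ p'] are rounded up to powers of 2. Rounding doubles them at most, except at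
    the lowest level, where it adds up to [2 ^ (- K)] per coordinate and at most 1 in all; hence the
    bound [2 + 1 = 3] in [admissible]. *)
Lemma le_dyadic_norm (p p' q : R) (K : nat) x t :
  0 < p' -> p^-1 + p'^-1 = 1 -> 1 <= q -> (#|J| <= 2 ^ K)%N ->
  \sum_j `|t j| `^ p' <= 1 -> row_power q x t <= dyadic_norm p q K x.
Proof.
move=> p'0 pp' q1 JK t1.
have v01 j : 0 <= `|t j| `^ p' <= 1.
  rewrite powR_ge0/=; apply: le_trans t1; rewrite (bigD1 j)//= lerDl.
  by apply: sumr_ge0 => k _; exact: powR_ge0.
have /fin_all_exists[l hl] : forall j, exists l : 'I_K.+1,
    `|t j| `^ p' <= 2^-1 ^+ l <= 2 * `|t j| `^ p' + 2^-1 ^+ K.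
  by move=> j; exact: dyadic_round.
have e1 : 1 - p^-1 = p'^-1 by lra.
have tl j : `|t j| <= (2^-1 ^+ l j) `^ (1 - p^-1).
  have /andP[h _] := hl j; rewrite -[leLHS](@powRK _ p') ?gt_eqF// e1.
  by apply: le_powR2r; rewrite ?powR_ge0 ?invr_ge0 ?(ltW p'0).
have [eta he] := row_power_extreme x q1 tl.
pose s : dyadic J K := [ffun j => Some (l j, eta j)].
apply: (le_trans he).
have -> : row_power q x (fun j => (-1) ^+ eta j * (2^-1 ^+ l j) `^ (1 - p^-1)) =
    row_power q x (fun j => level_coef p (s j)).
  apply: eq_bigr => i _; congr (`|_| `^ _); apply: eq_bigr => j _.
  by rewrite ffunE.
suff adm : @admissible R _ _ s.
  exact: (le_bigmax_cond 0
    (fun s : dyadic J K => row_power q x (fun j => level_coef p (s j))) adm).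
rewrite /admissible; under eq_bigr do rewrite ffunE/=.
apply: le_trans (_ : \sum_j (2 * `|t j| `^ p' + 2^-1 ^+ K) <= _).
  by apply: ler_sum => j _; have /andP[] := hl j.
rewrite big_split/= -mulr_sumr sumr_const.
have : (2^-1 : R) ^+ K *+ #|J| <= 1.
  rewrite -mulr_natl exprVn ler_pdivrMr ?exprn_gt0// mul1r -natrX ler_nat.
  exact: JK.
lra.
Qed.

End Cover.

(** * Passing to the transposed matrix *)

Section Duality.
Context {R : realType}.

Lemma holder_unit_ball {J : finType} (p p' : R) (t w : J -> R) :
  0 < p -> 0 < p' -> p^-1 + p'^-1 = 1 -> \sum_j `|t j| `^ p' <= 1 ->
  \sum_j t j * w j <= (\sum_j `|w j| `^ p) `^ p^-1.
Proof.
move=> p0 p'0 pp' t1; set W := \sum_j `|w j| `^ p.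
have W0 : 0 <= W by apply: sumr_ge0 => j _; exact: powR_ge0.
have [Wz|WN] := eqVneq W 0.
  have w0 j : w j = 0.
    have /eqP := Wz; rewrite psumr_eq0; last by move=> k _; exact: powR_ge0.
    by move=> /allP/(_ j (mem_index_enum _))/=/eqP/powR_eq0_eq0/eqP; rewrite normr_eq0 => /eqP.
  by rewrite big1 ?powR_ge0// => j _; rewrite w0 mulr0.
have Wp : 0 < W by rewrite lt_neqAle eq_sym WN.
set D := W `^ p^-1; have D0 : 0 < D by rewrite powR_gt0.
have DW : D `^ p = W by rewrite powRVK// gt_eqF.
rewrite -[leRHS]mul1r -ler_pdivrMr// mulr_suml.
apply: le_trans (_ : \sum_j ((`|w j| / D) `^ p / p + `|t j| `^ p' / p') <= _).
  apply: ler_sum => j _; rewrite -mulrA.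
  apply: le_trans (_ : (`|w j| / D) * `|t j| <= _).
    rewrite mulrC; apply: le_trans (ler_norm _) _.
    by rewrite !normrM normfV (gtr0_norm D0).
  by apply: conjugate_powR; rewrite ?divr_ge0// ltW.
rewrite big_split/= -!mulr_suml.
have -> : \sum_j (`|w j| / D) `^ p = 1.
  under eq_bigr do rewrite powRM ?invr_ge0 ?(ltW D0)//.
  rewrite -mulr_suml powR_invl ?(ltW D0)// DW divff//.
by rewrite div1r -[leRHS]pp' lerD2l ler_piMl// invr_ge0 ltW.
Qed.

(** The l_q norm of [y = x t] is its pairing with a vector [s] of the dual ball. Moving the matrix
    to the other side of the pairing and applying Hölder leaves the l_p norm of the transposed
    matrix at [s]. The exponent [p^-1 * q] converts a [p]-th power into a [q]-th power. *)
Lemma row_power_dual {I J : finType} (p p' q : R) (K : nat)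
    (x : I -> J -> R) (t : J -> R) :
  1 <= p -> 0 < p' -> p^-1 + p'^-1 = 1 -> 2 <= q -> (#|I| <= 2 ^ K)%N ->
  \sum_j `|t j| `^ p' <= 1 ->
  row_power q x t <= (dyadic_norm q p K (fun j i => x i j)) `^ (p^-1 * q).
Proof.
move=> p1 p'0 pp' q2 IK t1; set F := row_power q x t.
have p0 : 0 < p by lra.
have q0 : 0 < q by lra.
have qN : q != 0 by rewrite gt_eqF.
have F0 : 0 <= F by apply: sumr_ge0 => i _; exact: powR_ge0.
have [Fz|FN] := eqVneq F 0; first by rewrite Fz powR_ge0.
have Fp : 0 < F by rewrite lt_neqAle eq_sym FN.
pose y i := \sum_j x i j * t j.
pose q' := (1 - q^-1)^-1.
have qV : 0 < q^-1 <= 2^-1.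
  by rewrite invr_gt0 q0 lef_pV2 ?posrE//; lra.
have c0 : 0 < 1 - q^-1 by lra.
have q'0 : 0 < q' by rewrite invr_gt0.
have qq' : q^-1 + q'^-1 = 1 by rewrite invrK; ring.
have q1q : (q - 1) * q' = q.
  by rewrite /q'; field; rewrite qN /=; lra.
pose s i := Num.sg (y i) * `|y i| `^ (q - 1) / F `^ q'^-1.
have s1 : \sum_i `|s i| `^ q' <= 1.
  have sE i : `|s i| `^ q' = `|y i| `^ q / F.
    have [yz|yN] := eqVneq (y i) 0.
      by rewrite /s yz sgr0 !mul0r normr0 !powR0 ?mul0r// gt_eqF.
    rewrite /s !normrM normr_sg yN mul1r normfV (ger0_norm (powR_ge0 _ _)) (ger0_norm (powR_ge0 F _)).
    rewrite powRM ?invr_ge0 ?powR_ge0// -powRrM q1q; congr (_ * _).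
    by rewrite -powRN -powRrM mulNr mulVf ?gt_eqF// powRN powRr1.
  under eq_bigr do rewrite sE.
  by rewrite -mulr_suml divff.
have sy : \sum_i s i * y i = F `^ q^-1.
  have -> : \sum_i s i * y i = (\sum_i `|y i| `^ q) / F `^ q'^-1.
    rewrite mulr_suml; apply: eq_bigr => i _.
    rewrite /s mulrAC; congr (_ / _).
    have -> : Num.sg (y i) * `|y i| `^ (q - 1) * y i = `|y i| * `|y i| `^ (q - 1).
      by rewrite mulrAC -normrEsg.
    by rewrite mulr_powRB1.
  rewrite -/F -/(row_power q x t) -/F (_ : q^-1 = 1 - q'^-1); last by lra.
  by rewrite powRB_gt0// powRr1.
have main : F `^ q^-1 <= (dyadic_norm q p K (fun j i => x i j)) `^ p^-1.
  rewrite -sy.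
  have -> : \sum_i s i * y i = \sum_j t j * \sum_i x i j * s i.
    under eq_bigr do rewrite /y mulr_sumr.
    rewrite exchange_big/=; apply: eq_bigr => j _; rewrite mulr_sumr.
    by apply: eq_bigr => i _; ring.
  apply: le_trans (holder_unit_ball _ p0 p'0 pp' t1) _.
  apply: le_powR2r; [by rewrite invr_ge0 ltW| |exact: le_dyadic_norm qq' _ _ _].
  by apply: sumr_ge0 => j _; exact: powR_ge0.
rewrite powRrM; apply: le_trans (_ : (F `^ q^-1) `^ q <= _).
  by rewrite powRVK.
by apply: le_powR2r => //; [exact: ltW|exact: powR_ge0].
Qed.

End Duality.

(** * Independence *)


Section IntegralMonotone.
Local Open Scope ereal_scope.
Context d (T : measurableType d) (R : realType).

(* No measurability is needed: integrals of nonnegative functions are suprema over simple minorants. *)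
Lemma ge0_le_integralT (mu : {measure set T -> \bar R}) (f g : T -> \bar R) :
  (forall x, 0 <= f x) -> (forall x, f x <= g x) ->
  \int[mu]_x f x <= \int[mu]_x g x.
Proof.
move=> f0 fg; have g0 x : 0 <= g x by exact: le_trans (fg x).
rewrite !ge0_integralTE//; apply: ereal_sup_le => _ [h hf <-].
by exists h => // x; exact: le_trans (fg x).
Qed.

End IntegralMonotone.

(** * The product sigma-algebra on finite families of reals *)

Section CoordinateSigmaAlgebra.
Context {R : realType} (E : finType).

Definition coord_rays : set (set (E -> R)) :=
  [set A | exists e a, A = [set x | x e < a]].

Definition coordType := g_sigma_algebraType coord_rays.

Lemma measurable_coord e : measurable_fun [set: coordType] (fun x : coordType => x e).
Proof.
apply: (measurability _ (RGenInftyO.measurableE R)) => //.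
move=> _ [_ [a ->] <-]; rewrite setTI; apply: sub_sigma_algebra.
by exists e, a; apply/seteqP; split=> x /=; rewrite in_itv.
Qed.

Lemma measurable_coordP d (T : measurableType d) (F : T -> coordType) :
  (forall e, measurable_fun [set: T] (fun w => F w e)) ->
  measurable_fun [set: T] F.
Proof.
move=> mF; apply: (@measurability _ _ T coordType setT F coord_rays) => //.
move=> _ [_ [e [a ->]] <-].
have -> : [set: T] `&` F @^-1` [set x | x e < a] =
    [set: T] `&` (fun w => F w e) @^-1` `]-oo, a[.
  by apply/seteqP; split=> x /=; rewrite in_itv.
exact: mF.
Qed.

Definition coord_boxes : set (set (E -> R)) :=
  [set B | exists2 A : E -> set R, (forall e, measurable (A e)) &
     B = [set x | forall e, A e (x e)]].

Lemma coord_boxes_setI : setI_closed coord_boxes.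
Proof.
move=> _ _ [A mA ->] [B mB ->]; exists (fun e => A e `&` B e).
  by move=> e; exact: measurableI.
by apply/seteqP; split=> x /=; [move=> [h1 h2] e|move=> h; split=> e; have [] := h e].
Qed.

Lemma coord_box_measurable (A : E -> set R) : (forall e, measurable (A e)) ->
  measurable ([set x | forall e, A e (x e)] : set coordType).
Proof.
move=> mA.
have -> : [set x | forall e, A e (x e)] =
    \bigcap_(e in [set: E]) ((fun x : coordType => x e) @^-1` A e).
  by apply/seteqP; split=> x /= h; [move=> e _; exact: h|move=> e; exact: (h e)].
apply: fin_bigcap_measurable; first exact: finite_finset.
move=> e _; rewrite -[X in measurable X]setTI; exact: measurable_coord.
Qed.

Lemma coord_boxes_generate : @measurable _ coordType = <<s coord_boxes >>.
Proof.
apply/seteqP; split.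
  apply: smallest_sub; first exact: smallest_sigma_algebra.
  move=> _ [e [a ->]]; apply: sub_sigma_algebra.
  exists (fun e' => if e' == e then `]-oo, a[%classic else setT).
    by move=> e'; case: ifP.
  apply/seteqP; split=> x /=.
    by move=> xa e'; case: eqP => [->|//]; rewrite /= in_itv.
  by move=> /(_ e); rewrite eqxx /= in_itv.
apply: smallest_sub; first exact: sigma_algebra_measurable.
by move=> _ [A mA ->]; exact: coord_box_measurable.
Qed.

End CoordinateSigmaAlgebra.

(** * Integrating out independent variables *)

Section PairLaw.
Local Open Scope ereal_scope.
Context d (T : measurableType d) (R : realType) (P : probability T R).
Context d1 d2 (T1 : measurableType d1) (T2 : measurableType d2).
Variables (U : T -> T1) (V : T -> T2).
Hypotheses (mU : measurable_fun [set: T] U) (mV : measurable_fun [set: T] V).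
Hypothesis UV : forall A B, measurable A -> measurable B ->
  P (U @^-1` A `&` V @^-1` B) = P (U @^-1` A) * P (V @^-1` B).

(** The law of [(U, V)] agrees with the product of the two laws on rectangles, hence everywhere, and
    Tonelli applies. Conditioning on [V] becomes freezing it at a second sample point [w']. *)
Lemma integral_independent_pair (h : T1 * T2 -> \bar R) :
  measurable_fun [set: T1 * T2] h -> (forall z, 0 <= h z) ->
  \int[P]_w h (U w, V w) = \int[P]_w' \int[P]_w h (U w, V w').
Proof.
move=> mh h0.
have mUV : measurable_fun [set: T] (fun w => (U w, V w)) by exact/measurable_fun_pair.
pose fU : {mfun T >-> T1} := mfun_Sub (mem_set mU).
pose fV : {mfun T >-> T2} := mfun_Sub (mem_set mV).
pose fUV : {mfun T >-> (T1 * T2)%type} := mfun_Sub (mem_set mUV).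
pose PU := distribution P fU.
pose PV := distribution P fV.
pose PUV := distribution P fUV.
have law X : measurable X -> (PU \x PV) X = PUV X.
  apply: product_measure_unique => A B mA mB.
  exact: UV.
transitivity (\int[PUV]_z h z).
  by rewrite ge0_integral_pushforward.
rewrite (eq_measure_integral (PU \x PV)); last by move=> A mA _; exact/esym/law.
rewrite fubini_tonelli2//.
rewrite ge0_integral_pushforward//=; first last.
- by move=> y _; apply: integral_ge0.
- exact: measurable_fun_fubini_tonelli_G.
apply: eq_integral => w' _ /=.
rewrite /fubini_G ge0_integral_pushforward//.
exact: measurableT_comp.
Qed.

End PairLaw.

Section IndependentFamily.
Local Open Scope ereal_scope.
Context d (T : measurableType d) (R : realType) (P : probability T R).
Context (E : finType).
Variable G : E -> T -> R.
Hypothesis mG : forall e, measurable_fun [set: T] (G e).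
Hypothesis indG : mutually_independent P G.

Let W := @coordType R E.

(** The other variables of the family, with 0 written at [e], so that they live in the same space
    [W] as the whole family. *)
Definition erase (e : E) (w : T) : W := fun e' => if e' == e then 0%R else G e' w.

Definition plug (e : E) (a : R) (v : W) : W := fun e' => if e' == e then a else v e'.

Lemma measurable_erase e : measurable_fun [set: T] (erase e).
Proof.
apply: measurable_coordP => e'; rewrite /erase.
by case: eqP => _ //; exact: mG.
Qed.

Lemma measurable_plug e :
  measurable_fun [set: R * W] (fun z : R * W => plug e z.1 z.2).
Proof.
apply: measurable_coordP => e'; rewrite /plug; case: eqP => _; first exact: measurable_fst.
by apply: (@measurableT_comp _ _ _ _ _ _ (fun x : W => x e') setT snd);
  [exact: measurable_coord|exact: measurable_snd].
Qed.

Lemma plug_erase e w : plug e (G e w) (erase e w) = fun e' => G e' w.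
Proof. by apply/funext => e'; rewrite /plug /erase; case: eqP => [->|]. Qed.

Let preim_measurable d' (T' : measurableType d') (f : T -> T') A :
  measurable_fun [set: T] f -> measurable A -> measurable (f @^-1` A).
Proof. by move=> mf mA; rewrite -[X in measurable X]setTI; exact: mf. Qed.

(** Two finite measures in [B] that agree on the boxes, which form a generating system stable under
    intersection, are equal. *)
Lemma erase_independent e (A : set R) (B : set W) : measurable A -> measurable B ->
  P (G e @^-1` A `&` erase e @^-1` B) = P (G e @^-1` A) * P (erase e @^-1` B).
Proof.
move=> mA; move: B.
have mGA : measurable (G e @^-1` A) by exact: preim_measurable.
pose f : {mfun T >-> W} := mfun_Sub (mem_set (measurable_erase e)).
pose k : {nonneg R} := NngNum (fine_ge0 (measure_ge0 P (G e @^-1` A))).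
pose m1_ : {measure set W -> \bar R} := pushforward (mrestr P mGA) f.
pose m1 := m1_ (measurable_erase e).
pose m2 : {measure set W -> \bar R} := mscale k (distribution P f).
have m1E B : m1 B = P (erase e @^-1` B `&` G e @^-1` A) by [].
have m2E B : m2 B = P (G e @^-1` A) * P (erase e @^-1` B).
  by congr (_ * _); rewrite /= fineK// fin_num_measure.
suff m12 B : measurable B -> m1 B = m2 B.
  by move=> B /m12; rewrite m1E m2E setIC.
move=> mB; apply: (@measure_unique _ R W (@coord_boxes R E) (fun=> setT)) => //.
- exact: coord_boxes_generate.
- exact: coord_boxes_setI.
- by move=> _; exists (fun=> setT) => //; apply/seteqP; split.
- by rewrite bigcup_const.
- move=> _ [S mS ->]; rewrite m1E m2E.
  (* The erased slot is constantly 0: a box whose side at [e] misses 0 has empty preimage, and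
     otherwise that side is no constraint. *)
  have [S0|S0] := pselect (S e 0%R); last first.
    have -> : erase e @^-1` [set x | forall e', S e' (x e')] = set0.
      apply/seteqP; split=> // w /= /(_ e); rewrite /erase eqxx => h; exact: S0.
    by rewrite set0I measure0 mule0.
  have eraseE : erase e @^-1` [set x | forall e', S e' (x e')] =
      \bigcap_(e' in [set` [set~ e]%SET]) (G e' @^-1` S e').
    apply/seteqP; split=> w /= h e'; last first.
      by rewrite /erase; case: eqP => [->//|/eqP ne]; apply: h; rewrite /= !inE.
    by rewrite /= !inE => ne; have := h e'; rewrite /erase (negbTE ne).
  rewrite eraseE indG//.
  pose S' e' := if e' == e then A else S e'.
  have mS' e' : measurable (S' e') by rewrite /S'; case: ifP.
  have -> : \bigcap_(e' in [set` [set~ e]%SET]) (G e' @^-1` S e') `&` G e @^-1` A =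
      \bigcap_(e' in [set` [set: E]%SET]) (G e' @^-1` S' e').
    apply/seteqP; split=> w /=.
      move=> [h hA] e' _; rewrite /S'; case: eqP => [->//|/eqP ne].
      by apply: h; rewrite /= !inE.
    move=> h; split; last by have := h e; rewrite /= inE /S' eqxx; apply.
    move=> e'; rewrite /= !inE => ne.
    by have := h e'; rewrite /= inE /S' (negbTE ne); apply.
  rewrite indG// (bigD1 e)/=; last by rewrite inE.
  rewrite {1}/S' eqxx; congr (_ * _).
  apply: eq_big => [e'|e']; first by rewrite !inE.
  by rewrite /S' => /andP[_ /negbTE ->].
- move=> _; rewrite m1E.
  apply: le_lt_trans (_ : P setT < _); last by rewrite probability_setT ltry.
  apply: le_measure; rewrite ?inE//.
  by rewrite preimage_setT setTI.
Qed.

Lemma integral_plug e (h : W -> \bar R) :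
  measurable_fun [set: W] h -> (forall x, 0 <= h x) ->
  \int[P]_w h (fun e' => G e' w) =
  \int[P]_w' \int[P]_w h (plug e (G e w) (erase e w')).
Proof.
move=> mh h0; under eq_integral do rewrite -(plug_erase e).
rewrite (integral_independent_pair (mG e) (measurable_erase e) (erase_independent e)
  (h := fun z => h (plug e z.1 z.2)))//.
exact: (measurableT_comp mh (measurable_plug e)).
Qed.

End IndependentFamily.

(** * Gaussian variables *)


Section NormalLaw.
Context {R : realType}.
Local Notation mu := (@lebesgue_measure R).

Lemma normal_pdf_even (x : R) : normal_pdf 0 1 (- x) = normal_pdf 0 1 x.
Proof. by rewrite normal_pdfE ?oner_eq0// /normal_fun !subr0 sqrrN. Qed.

Lemma normal_prob_ray (x : R) :
  normal_prob 0 1 `]-oo, x[ = normal_prob 0 1 `]- x, +oo[.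
Proof.
have N1 : (1 : R) != 0 by rewrite oner_eq0.
have cpdf : continuous (normal_pdf (0 : R) 1) by exact: continuous_normal_pdf.
have mpdf D : measurable_fun D (fun y : R => (normal_pdf 0 1 y)%:E).
  by apply/measurable_funTS/measurable_EFinP; exact: measurable_normal_pdf.
rewrite /normal_prob integral_itv_bndo_bndc; last exact: mpdf.
rewrite integral_itv_obnd_cbnd; last exact: mpdf.
have := @ge0_integration_by_substitutionNy R (normal_pdf 0 1) (- x).
rewrite opprK => ->.
- by apply: eq_integral => y _; rewrite /= normal_pdf_even.
- exact: continuous_subspaceT.
- by move=> y _; exact: normal_pdf_ge0.
Qed.

Section Gaussian.
Context d (T : measurableType d) (P : probability T R).
Variable X : {RV P >-> R}.
Hypothesis gX : std_gaussian X.

Lemma gaussian_sym (A : set R) : measurable A ->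
  P (X @^-1` A) = P ((fun w => - X w) @^-1` A).
Proof.
have mN : measurable_fun [set: T] (fun w => - X w).
  by apply: (measurableT_comp (@oppr_measurable R setT)); exact: measurable_funPT.
pose Y : {mfun T >-> R} := mfun_Sub (mem_set mN).
move=> mA; rewrite -[LHS]/(distribution P X A) -[RHS]/(distribution P Y A).
apply: (@measure_unique _ R R (@RGenInftyO.G R) (fun n => `]-oo, n%:R[%classic)) => //.
- exact: RGenInftyO.measurableE.
- move=> _ _ [x ->] [y ->]; exists (Num.min x y).
  by apply/seteqP; split=> z /=; rewrite !in_itv/= lt_min => /andP.
- by move=> n; exists n%:R.
- apply/seteqP; split=> // x _; exists (Num.truncn `|x|).+1 => //=.
  by rewrite in_itv/=; apply: le_lt_trans (ler_norm x) _; exact: truncnS_gt.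
- move=> _ [x ->]; transitivity (normal_prob (0 : R) 1 `]-oo, x[); first exact: gX.
  rewrite normal_prob_ray -gX//.
  by congr (P _); apply/seteqP; split=> w /=; rewrite !in_itv/= ?andbT; lra.
- by move=> n; apply: le_lt_trans (probability_le1 _ _) _; rewrite ?ltry.
Qed.

(** Where [x ^ 2 >= k], [expR (- x ^ 2 / 2)] is at most [expR (- k / 4) * expR (- x ^ 2 / 4)], and
    the last factor is a normal density of variance 2 up to its peak. *)
Lemma gaussian_sq_tail (k : nat) :
  (P [set w | (k%:R <= X w ^+ 2)%R] <=
   (normal_peak 1 / normal_peak (Num.sqrt 2) * expR (- 4^-1) ^+ k)%:E)%E.
Proof.
pose D := [set x : R | k%:R <= x ^+ 2].
have mD : measurable D.
  rewrite -[D]setTI; rewrite (_ : D = (fun x => x ^+ 2) @^-1` `[k%:R, +oo[).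
    by apply: (exprn_measurable 2 measurableT) => //; exact: measurable_itv.
  by apply/seteqP; split=> x /=; rewrite in_itv/= andbT.
have -> : P [set w | (k%:R <= X w ^+ 2)%R] = normal_prob 0 1 D by rewrite -gX.
have N1 : (1 : R) != 0 by rewrite oner_eq0.
have N2 : Num.sqrt (2 : R) != 0 by rewrite gt_eqF// sqrtr_gt0.
set c := _ / _ * _.
have c0 : 0 <= c.
  by rewrite !mulr_ge0 ?invr_ge0 ?normal_peak_ge0// exprn_ge0// expR_ge0.
have mpdf s : measurable_fun setT (fun y : R => (normal_pdf 0 s y)%:E).
  by apply/measurable_EFinP; exact: measurable_normal_pdf.
apply: (@le_trans _ _ (\int[mu]_x (c * normal_pdf 0 (Num.sqrt 2) x)%:E)%E).
  rewrite /normal_prob integral_mkcond; apply: ge0_le_integralT => x.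
    by rewrite patchE; case: ifP => // _; rewrite lee_fin normal_pdf_ge0.
  rewrite patchE; case: ifPn => [|_]; last first.
    by rewrite lee_fin mulr_ge0// normal_pdf_ge0.
  rewrite inE /D /= => kx; rewrite lee_fin !normal_pdfE// /normal_fun !subr0 expr1n.
  rewrite sqr_sqrtr// [leRHS](_ : _ = normal_peak 1 *
      (expR (k%:R * (- 4^-1)) * expR (- x ^+ 2 / (2 *+ 2)))); last first.
    by rewrite /c expRM_natl; field; rewrite gt_eqF// normal_peak_gt0.
  apply: ler_wpM2l; first exact: normal_peak_ge0.
  rewrite -expRD ler_expR.
  have -> : (1 : R) *+ 2 = 2 by [].
  have -> : (2 : R) *+ 2 = 4 by rewrite mulr2n -natrD.
  by lra.
under eq_integral do rewrite EFinM.
rewrite ge0_integralZl_EFin//.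
- by rewrite integral_normal_pdf mule1.
- by move=> x _; rewrite lee_fin normal_pdf_ge0.
- exact: mpdf.
Qed.

Lemma gaussian_small (e : R) : 0 <= e ->
  (P [set w | (`|X w| < e)%R] <= (2 * e * normal_peak 1)%:E)%E.
Proof.
move=> e0.
have N1 : (1 : R) != 0 by rewrite oner_eq0.
have -> : P [set w | (`|X w| < e)%R] = normal_prob 0 1 `]- e, e[.
  rewrite -gX//; congr (P _); apply/seteqP; split=> w /=; rewrite in_itv/=;
    by rewrite ltr_norml.
apply: (@le_trans _ _ (\int[mu]_(x in `](- e)%R, e[) (normal_peak 1)%:E)%E).
  rewrite /normal_prob integral_mkcond [leRHS]integral_mkcond.
  apply: ge0_le_integralT => x; rewrite !patchE; case: ifP => // _; rewrite lee_fin.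
    exact: normal_pdf_ge0.
  exact: normal_pdf_ub.
rewrite integral_cst//= lebesgue_measure_itv/= lte_fin.
case: ifP => _; last by rewrite mule0 lee_fin !mulr_ge0// normal_peak_ge0.
by rewrite -EFinB -EFinM lee_fin opprK; rewrite le_eqVlt; apply/orP; left; apply/eqP; ring.
Qed.

(** Half of the threshold [1 / (4 * normal_peak 1)], below which [|X|] falls with probability at
    most one half. *)
Definition gauss_abs_cst : R := (8 * normal_peak 1)^-1.

Lemma gauss_abs_cst_gt0 : 0 < gauss_abs_cst.
Proof. by rewrite invr_gt0 mulr_gt0// normal_peak_gt0 ?oner_eq0. Qed.

Lemma gaussian_abs_ge : (gauss_abs_cst%:E <= \int[P]_w `|X w|%:E)%E.
Proof.
have peak0 : 0 < normal_peak (1 : R) by rewrite normal_peak_gt0 ?oner_eq0.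
pose e : R := (4 * normal_peak 1)^-1.
have e0 : 0 < e by rewrite invr_gt0 mulr_gt0.
have := gaussian_small (ltW e0).
have -> : 2 * e * normal_peak 1 = 2^-1 by rewrite /e; field; rewrite gt_eqF.
move=> small.
pose A := [set w | e <= `|X w|].
have mX : measurable_fun [set: T] (fun w => `|X w|).
  by apply: measurableT_comp; [exact: normr_measurable|exact: measurable_funPT].
have mA : measurable A.
  rewrite -[A]setTI (_ : A = (fun w => `|X w|) @^-1` `[e, +oo[).
    by apply: mX => //; exact: measurable_itv.
  by apply/seteqP; split=> x /=; rewrite in_itv/= andbT.
have PA : (2^-1%:E <= P A)%E.
  have AC : ~` A = [set w | `|X w| < e].
    by apply/seteqP; split=> w /=; rewrite /A /= real_ltNge ?num_real// => /negP.
  have := small; rewrite -AC probability_setC// leeBlDr ?fin_num_measure//.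
  rewrite -leeBlDl ?fin_num_measure// => h.
  move: h; rewrite -[P A]fineK ?fin_num_measure//.
  by rewrite -EFinB !lee_fin; lra.
apply: (@le_trans _ _ (\int[P]_w (e * \1_A w)%:E)%E); last first.
  apply: ge0_le_integralT => w; rewrite lee_fin; first by rewrite mulr_ge0// ltW.
  rewrite indicE; case: (boolP (w \in A)) => [|_]; last by rewrite mulr0.
  by rewrite inE /A /= mulr1.
under eq_integral do rewrite EFinM.
have mi : measurable_fun [set: T] (fun w => (\1_A w : R)%:E).
  by apply/measurable_EFinP; exact: measurable_indic.
rewrite ge0_integralZl_EFin ?(ltW e0)//.
rewrite integral_indic// setIT.
apply: (@le_trans _ _ (e%:E * 2^-1%:E)%E); last by apply: lee_wpmul2l => //; rewrite lee_fin; exact: ltW.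
rewrite -EFinM lee_fin /gauss_abs_cst /e le_eqVlt; apply/orP; left; apply/eqP.
by field; rewrite gt_eqF.
Qed.

End Gaussian.

End NormalLaw.

(** * Exponential moments from geometric tails *)

Section ExponentialMoment.
Context d (T : measurableType d) (R : realType) (P : probability T R).
Local Open Scope ereal_scope.

Lemma geometric_partial_le (x : R) n : (0 <= x)%R -> (x < 1)%R ->
  (\sum_(i < n) x ^+ i <= (1 - x)^-1)%R.
Proof.
move=> x0 x1; have h : (0 < 1 - x)%R by lra.
rewrite -[leRHS]mul1r ler_pdivlMr//.
have := subrX1 x n => e.
have -> : ((\sum_(i < n) x ^+ i) * (1 - x) = 1 - x ^+ n)%R.
  by rewrite -opprB mulrN mulrC -e opprB.
by rewrite gerBl exprn_ge0.
Qed.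

Lemma exp_moment_le (Y : T -> R) (c a rho : R) :
  measurable_fun [set: T] Y -> (forall w, 0 <= Y w)%R ->
  (0 <= c)%R -> (0 <= a)%R -> (0 <= rho)%R -> (expR c * rho < 1)%R ->
  (forall k : nat, P [set w | (k%:R <= Y w)%R] <= (a * rho ^+ k)%:E) ->
  \int[P]_w (expR (c * Y w))%:E <= (a * expR c / (1 - expR c * rho))%:E.
Proof.
move=> mY Y0 c0 a0 rho0 crho tail.
pose A (k : nat) := [set w | (k%:R <= Y w)%R].
have mA k : measurable (A k).
  rewrite -[A k]setTI (_ : A k = Y @^-1` `[k%:R, +oo[).
    by apply: mY => //; exact: measurable_itv.
  by apply/seteqP; split=> x /=; rewrite in_itv/= andbT.
(* With [k] the integer part of [Y w], the single term [f k w] already dominates [expR (c * Y w)];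
   integrating the series termwise gives a geometric sum. *)
pose f (k : nat) w : \bar R := (expR (c * k.+1%:R) * \1_(A k) w)%:E.
have f0 k w : 0 <= f k w by rewrite lee_fin mulr_ge0// expR_ge0.
apply: (@le_trans _ _ (\int[P]_w \sum_(k <oo) f k w)).
  apply: ge0_le_integralT => w; first by rewrite lee_fin expR_ge0.
  pose k := Num.truncn (Y w).
  have kY : (k%:R <= Y w < k.+1%:R)%R by apply: truncn_itv.
  apply: (@le_trans _ _ (f k w)).
    have /andP[k1 k2] := kY.
    rewrite /f indicE mem_set// mulr1 lee_fin ler_expR; apply: ler_wpM2l => //.
    exact: ltW.
  rewrite (nneseriesD1 (n := k))//.
  by rewrite leeDl// nneseries_ge0.
have mf k : measurable_fun [set: T] (f k).
  by apply/measurable_EFinP; apply: measurable_funM => //; exact: measurable_indic.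
rewrite integral_nneseries//.
apply: lime_le; first by apply: is_cvg_nneseries => k _ _; exact: integral_ge0.
apply: nearW => n.
have fE k : \int[P]_w f k w <= (a * expR c * (expR c * rho) ^+ k)%:E.
  rewrite /f; under eq_integral do rewrite EFinM.
  have mi : measurable_fun [set: T] (fun w => (\1_(A k) w : R)%:E).
    by apply/measurable_EFinP; exact: measurable_indic.
  rewrite ge0_integralZl_EFin ?expR_ge0//.
  rewrite integral_indic// setIT.
  apply: le_trans (lee_wpmul2l _ (tail k)) _; first by rewrite lee_fin expR_ge0.
  rewrite -EFinM lee_fin exprMn -expRM_natl le_eqVlt; apply/orP; left; apply/eqP.
  have -> : (c * k.+1%:R = c + k%:R * c)%R by rewrite -natr1; ring.
  by rewrite expRD; ring.
apply: le_trans (lee_sum _ (fun k _ => fE k)) _.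
rewrite sumEFin lee_fin -mulr_sumr big_mkord; apply: ler_wpM2l.
  by rewrite mulr_ge0// expR_ge0.
by apply: geometric_partial_le => //; rewrite mulr_ge0// expR_ge0.
Qed.

End ExponentialMoment.

Section GaussianExp.
Context d (T : measurableType d) (R : realType) (P : probability T R).

Definition gauss_exp_cst : R :=
  normal_peak 1 / normal_peak (Num.sqrt 2) * expR 8^-1 / (1 - expR 8^-1 * expR (- 4^-1)).

Lemma gaussian_exp_le (X : {RV P >-> R}) : std_gaussian X ->
  (\int[P]_w (expR (8^-1 * X w ^+ 2))%:E <= gauss_exp_cst%:E)%E.
Proof.
move=> gX; apply: exp_moment_le.
- by apply: measurable_funX; exact: measurable_funPT.
- by move=> w; exact: sqr_ge0.
- by [].
- by rewrite divr_ge0// normal_peak_ge0.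
- exact: expR_ge0.
- by rewrite -expRD -[ltRHS]expR0 ltr_expR; lra.
- exact: gaussian_sq_tail.
Qed.

End GaussianExp.


(** * Symmetrization *)

Section SignSymmetry.
Local Open Scope ereal_scope.
Context d (T : measurableType d) (R : realType) (P : probability T R).
Context (E : finType).
Variable G : E -> T -> R.
Hypothesis mG : forall e, measurable_fun [set: T] (G e).
Hypothesis indG : mutually_independent P G.
Hypothesis symG : forall e (A : set R), measurable A ->
  P (G e @^-1` A) = P ((fun w => - G e w)%R @^-1` A).

Let W := @coordType R E.

Definition signed (s : seq E) (eps : {ffun E -> bool}) (x : E -> R) : W :=
  fun e => if e \in s then ((-1) ^+ eps e * x e)%R else x e.

Lemma measurable_signed s eps : measurable_fun [set: W] (signed s eps : W -> W).
Proof.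
apply: measurable_coordP => e; rewrite /signed; case: (e \in s).
  by apply: (@measurable_funM _ _ _ setT (fun=> (-1) ^+ eps e)%R (fun x : W => x e));
    [exact: measurable_cst|exact: measurable_coord].
exact: measurable_coord.
Qed.

Lemma integral_flip e (h : W -> \bar R) :
  measurable_fun [set: W] h -> (forall x, 0 <= h x) ->
  \int[P]_w h (fun e' => if e' == e then (- G e' w)%R else G e' w) =
  \int[P]_w h (fun e' => G e' w).
Proof.
move=> mh h0.
pose g (x : W) : W := fun e' => if e' == e then (- x e')%R else x e'.
have mg : measurable_fun [set: W] g.
  apply: measurable_coordP => e'; rewrite /g; case: eqP => _.
    by apply: (measurableT_comp (@oppr_measurable R setT)); exact: measurable_coord.
  exact: measurable_coord.
rewrite (integral_plug mG indG e mh h0).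
have := integral_plug mG indG e (h := h \o g) (measurableT_comp mh mg) (fun x => h0 _).
rewrite /= => ->; apply: eq_integral => w' _.
pose v := erase G e w'.
have gE a : g (plug e a v) = plug e (- a)%R v.
  by apply/funext => e'; rewrite /g /plug /v /erase; case: eqP.
under eq_integral do rewrite gE.
have mN : measurable_fun [set: T] (fun w => - G e w)%R.
  by apply: (measurableT_comp (@oppr_measurable R setT)); exact: mG.
pose X1 : {mfun T >-> R} := mfun_Sub (mem_set (mG e)).
pose X2 : {mfun T >-> R} := mfun_Sub (mem_set mN).
have mhp : measurable_fun [set: R] (fun a : R => h (plug e a v)).
  apply: (measurableT_comp mh); apply: measurable_coordP => e'; rewrite /plug.
  by case: eqP.
transitivity (\int[distribution P X2]_a h (plug e a v)).
  by rewrite ge0_integral_pushforward.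
transitivity (\int[distribution P X1]_a h (plug e a v)).
  by apply: eq_measure_integral => A mA _; exact/esym/symG.
by rewrite ge0_integral_pushforward.
Qed.

Lemma integral_signed (s : seq E) eps (h : W -> \bar R) : uniq s ->
  measurable_fun [set: W] h -> (forall x, 0 <= h x) ->
  \int[P]_w h (signed s eps (fun e => G e w)) = \int[P]_w h (fun e => G e w).
Proof.
elim: s => [|e s IH] /=; first by [].
move=> /andP[es us] mh h0; rewrite -IH//.
case epsE : (eps e); last first.
  apply: eq_integral => w _; congr h; apply/funext => e'.
  rewrite /signed inE; case: eqP => [->|//].
  by rewrite (negbTE es) epsE /= expr0 mul1r.
have mhs : measurable_fun [set: W] (h \o (signed s eps : W -> W)).
  by apply: measurableT_comp => //; exact: measurable_signed.
rewrite -(integral_flip e mhs (fun x => h0 _)).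
apply: eq_integral => w _ /=; congr h; apply/funext => e'.
rewrite /signed inE; case: eqP => [->|//].
by rewrite (negbTE es) epsE /= expr1 mulN1r.
Qed.

(** Every sign pattern leaves the expectation unchanged, so the expectation equals that of the
    average over all patterns. A Rademacher bound for the coefficients [G e w], valid at each [w],
    thereby becomes a bound for the random family itself. *)
Lemma sign_average_le (h : W -> R) (B : T -> R) :
  measurable_fun [set: W] h -> (forall x, 0 <= h x)%R ->
  measurable_fun [set: T] B -> (forall w, 0 <= B w)%R ->
  (forall w, \sum_(eps : {ffun E -> bool}) h (fun e => (-1) ^+ eps e * G e w) <=
     #|{ffun E -> bool}|%:R * B w)%R ->
  \int[P]_w (h (fun e => G e w))%:E <= \int[P]_w (B w)%:E.
Proof.
move=> mh h0 mB B0 hB.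
pose N : R := (#|{ffun E -> bool}|%:R)%R.
have N0 : (0 < N)%R by rewrite ltr0n; apply/card_gt0P; exists [ffun=> false].
have mhE : measurable_fun [set: W] (EFin \o h) by exact/measurable_EFinP.
have avg (eps : {ffun E -> bool}) : \int[P]_w (h (fun e => (-1) ^+ eps e * G e w)%R)%:E =
    \int[P]_w (h (fun e => G e w))%:E.
  rewrite -(integral_signed eps (enum_uniq E) mhE)//=.
  apply: eq_integral => w _; do 2 congr (_ _); apply/funext => e.
  by rewrite /signed mem_enum.
have m1 (eps : {ffun E -> bool}) : measurable_fun [set: T] (fun w => (h (fun e => (-1) ^+ eps e * G e w)%R)%:E).
  apply/measurable_EFinP; apply: (measurableT_comp mh).
  by apply: measurable_coordP => e; apply: measurable_funM.
have sumE : N%:E * \int[P]_w (h (fun e => G e w))%:E =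
    \int[P]_w (\sum_(eps : {ffun E -> bool}) (h (fun e => (-1) ^+ eps e * G e w)%R)%:E).
  have m1' (eps : {ffun E -> bool}) w : setT w ->
      0 <= (h (fun e => (-1) ^+ eps e * G e w)%R)%:E by rewrite lee_fin.
  rewrite (ge0_integral_sum _ _ m1 m1')//.
  have -> : N%:E = \sum_(eps : {ffun E -> bool}) 1%:E by rewrite sumEFin sumr_const.
  by rewrite ge0_sume_distrl//; apply: eq_bigr => eps _; rewrite mul1e avg.
have : N%:E * \int[P]_w (h (fun e => G e w))%:E <= N%:E * \int[P]_w (B w)%:E.
  have B0' w : setT w -> 0 <= (B w)%:E by rewrite lee_fin.
  rewrite sumE -(ge0_integralZl_EFin _ _ B0') ?(ltW N0)//; last exact/measurable_EFinP.
  apply: ge0_le_integralT => w; first by apply: sume_ge0 => *; rewrite lee_fin.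
  by rewrite sumEFin -EFinM lee_fin.
by rewrite lee_pmul2l// lte_fin.
Qed.

End SignSymmetry.

Section ProductExpectation.
Local Open Scope ereal_scope.
Context d (T : measurableType d) (R : realType) (P : probability T R).
Context (E : finType).
Variable G : E -> T -> R.
Hypothesis mG : forall e, measurable_fun [set: T] (G e).
Hypothesis indG : mutually_independent P G.

(** The variables are integrated out one after the other by [integral_plug]. *)
Lemma integral_prod_le (s : seq E) (F : E -> R -> R) (c : E -> R) : uniq s ->
  (forall e, measurable_fun [set: R] (F e)) -> (forall e x, 0 <= F e x)%R ->
  (forall e, e \in s -> \int[P]_w (F e (G e w))%:E <= (c e)%:E) ->
  \int[P]_w (\prod_(e <- s) F e (G e w))%:E <= (\prod_(e <- s) c e)%:E.
Proof.
move=> us mF F0; elim: s us => [_ _|e s IH /= /andP[es us] hc].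
  under eq_integral do rewrite big_nil.
  by rewrite big_nil integral_cst//= probability_setT mule1.
pose h (x : @coordType R E) : \bar R := (\prod_(e <- e :: s) F e (x e))%:E.
have mh : measurable_fun setT h.
  apply/measurable_EFinP; apply: measurable_prod => e' _.
  by apply: measurableT_comp => //; exact: measurable_coord.
have h0 x : 0 <= h x by rewrite lee_fin; apply: prodr_ge0.
rewrite (integral_plug mG indG e mh h0) big_cons.
pose Q w := (\prod_(e <- s) F e (G e w))%R.
have Q0 w : (0 <= Q w)%R by apply: prodr_ge0.
have mQ : measurable_fun [set: T] (EFin \o Q).
  apply/measurable_EFinP; apply: measurable_prod => e' _.
  exact: measurableT_comp.
have c0 : (0 <= c e)%R.
  rewrite -lee_fin; apply: le_trans (hc e (mem_head _ _)).
  by apply: integral_ge0 => w _; rewrite lee_fin.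
have innerE w' : \int[P]_w h (plug e (G e w) (erase G e w')) <= (c e)%:E * (Q w')%:E.
  have hE w : h (plug e (G e w) (erase G e w')) = (Q w')%:E * (F e (G e w))%:E.
    rewrite /h big_cons /plug eqxx -EFinM mulrC; congr (_ * _)%:E.
    apply: eq_big_seq => e' e's; rewrite /erase.
    by case: eqP => // ee; rewrite -ee e's in es.
  under eq_integral do rewrite hE.
  have Fe0 w : setT w -> 0 <= (F e (G e w))%:E by rewrite lee_fin.
  have mFe : measurable_fun [set: T] (fun w => (F e (G e w))%:E).
    by apply/measurable_EFinP; exact: measurableT_comp.
  rewrite (ge0_integralZl_EFin _ _ Fe0)//.
  by rewrite muleC; apply: lee_wpmul2r; [rewrite lee_fin|apply: hc; rewrite mem_head].
apply: (@le_trans _ _ (\int[P]_w' ((c e)%:E * (Q w')%:E))).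
  by apply: ge0_le_integralT => // w'; apply: integral_ge0.
have Q0' w : setT w -> 0 <= (Q w)%:E by rewrite lee_fin.
rewrite (ge0_integralZl_EFin _ _ Q0')// EFinM; apply: lee_wpmul2l; first by rewrite lee_fin.
by apply: IH => // e' e's; apply: hc; rewrite inE e's orbT.
Qed.

End ProductExpectation.


Section Reindex.
Context d (T : measurableType d) (R : realType) (P : probability T R).

Lemma mutually_independent_inj (E E' : finType) (G : E -> T -> R) (f : E' -> E) :
  injective f -> mutually_independent P G ->
  mutually_independent P (fun e => G (f e)).
Proof.
move=> finj indG J A mA.
pose A' e := if [pick e' | f e' == e] is Some e' then A e' else setT.
have A'f e : A' (f e) = A e.
  rewrite /A'; case: pickP => [e' /eqP/finj ->//|/(_ e)].
  by rewrite eqxx.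
have mA' e : measurable (A' e) by rewrite /A'; case: pickP.
have := indG (f @: J)%SET A' mA'.
rewrite big_imset/=; last by move=> x y _ _; exact: finj.
under eq_bigr do rewrite A'f.
move=> <-; congr (P _); apply/seteqP; split=> w /=.
  by move=> h e; rewrite /= => /imsetP[e' e'J ->]; rewrite A'f; exact: h.
move=> h e /= eJ; have := h (f e); rewrite /= A'f; apply.
exact: imset_f.
Qed.

End Reindex.

Section MeasurablePower.
Context d (T : measurableType d) (R : realType).

Lemma measurable_powR_fun (p : R) (f : T -> R) : measurable_fun [set: T] f ->
  measurable_fun [set: T] (fun w => f w `^ p).
Proof.
move=> mf; apply: (@measurableT_comp _ _ _ _ _ _ (fun x => x `^ p) setT f) => //.
Qed.

Lemma measurable_normr_fun (f : T -> R) : measurable_fun [set: T] f ->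
  measurable_fun [set: T] (fun w => `|f w|).
Proof.
move=> mf; apply: (@measurableT_comp _ _ _ _ _ _ (fun x : R => `|x| : R) setT f) => //.
Qed.

End MeasurablePower.

Section RealIntegralBounds.
Local Open Scope ereal_scope.
Context d (T : measurableType d) (R : realType) (P : probability T R).
Implicit Types f g : T -> R.

Lemma integral_le f g (c : R) : (forall w, 0 <= f w)%R -> (forall w, f w <= g w)%R ->
  \int[P]_w (g w)%:E <= c%:E -> \int[P]_w (f w)%:E <= c%:E.
Proof.
move=> f0 fg; apply: le_trans; apply: ge0_le_integralT => w; by rewrite lee_fin.
Qed.

Lemma integral_scale_le f (k c : R) : measurable_fun [set: T] f ->
  (forall w, 0 <= f w)%R -> (0 <= k)%R -> \int[P]_w (f w)%:E <= c%:E ->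
  \int[P]_w (k * f w)%:E <= (k * c)%:E.
Proof.
move=> mf f0 k0 fc; under eq_integral do rewrite EFinM.
have f0' w : setT w -> 0 <= (f w)%:E by rewrite lee_fin.
rewrite (ge0_integralZl_EFin _ _ f0')//; last exact/measurable_EFinP.
by rewrite EFinM; apply: lee_wpmul2l; rewrite ?lee_fin.
Qed.

Lemma integral_add_le f g (c c' : R) : measurable_fun [set: T] f ->
  measurable_fun [set: T] g -> (forall w, 0 <= f w)%R -> (forall w, 0 <= g w)%R ->
  \int[P]_w (f w)%:E <= c%:E -> \int[P]_w (g w)%:E <= c'%:E ->
  \int[P]_w (f w + g w)%:E <= (c + c')%:E.
Proof.
move=> mf mg f0 g0 fc gc; under eq_integral do rewrite EFinD.
have f0' w : setT w -> 0 <= (f w)%:E by rewrite lee_fin.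
have g0' w : setT w -> 0 <= (g w)%:E by rewrite lee_fin.
have mf' : measurable_fun [set: T] (fun w => (f w)%:E) by exact/measurable_EFinP.
have mg' : measurable_fun [set: T] (fun w => (g w)%:E) by exact/measurable_EFinP.
rewrite (@ge0_integralD _ _ _ P setT measurableT _ _ f0' mf' g0' mg').
by rewrite EFinD; apply: leeD.
Qed.

Lemma integral_cst_real (c : R) : \int[P]_w c%:E = c%:E.
Proof. by rewrite integral_cst//= probability_setT mule1. Qed.

Lemma integral_sum_le (I : Type) (s : seq I) (f : I -> T -> R) (c : I -> R) :
  (forall i, measurable_fun [set: T] (f i)) -> (forall i w, 0 <= f i w)%R ->
  (forall i, \int[P]_w (f i w)%:E <= (c i)%:E) ->
  \int[P]_w (\sum_(i <- s) f i w)%:E <= (\sum_(i <- s) c i)%:E.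
Proof.
move=> mf f0 fc; elim: s => [|i s IH].
  by under eq_integral do rewrite big_nil; rewrite big_nil integral_cst_real.
under eq_integral do rewrite big_cons.
rewrite big_cons; apply: integral_add_le => //.
  exact: measurable_sum.
by move=> w; exact: sumr_ge0.
Qed.

End RealIntegralBounds.

Section GaussianMoments.
Context {R : realType}.

Lemma ln_ge_half (x : R) : 2 <= x -> 2^-1 <= ln x.
Proof.
move=> x2; have x0 : 0 < x by lra.
have h : ln 2 <= ln x by rewrite ler_ln ?posrE.
have : ln (1 + - 2^-1) <= - 2^-1 :> R by apply: le_ln1Dx; lra.
have -> : 1 + - 2^-1 = 2^-1 :> R by lra.
by rewrite lnV ?posrE//; lra.
Qed.

Lemma powR_le_expR (a c y : R) : 0 < a -> 0 < c -> 0 <= y ->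
  y `^ a <= (a / c) `^ a * expR (c * y).
Proof.
move=> a0 c0 y0; set z := c * y / a.
have z0 : 0 <= z by rewrite divr_ge0 ?mulr_ge0 ?(ltW a0) ?(ltW c0).
have -> : y = (a / c) * z by rewrite /z; field; rewrite !gt_eqF.
have ac0 : 0 <= a / c by rewrite divr_ge0 ?(ltW a0) ?(ltW c0).
rewrite (powRM _ ac0 z0).
apply: ler_wpM2l; first exact: powR_ge0.
have -> : c * (a / c * z) = z * a by field; rewrite gt_eqF.
rewrite expRM; apply: le_powR2r; [exact: ltW|exact: z0|].
by have := expR_ge1Dx z; lra.
Qed.

(** The constant of [powR_le_expR] for [y = x ^ 2], [a = p / 2] and [c = 1 / 16]. *)
Definition pow_exp_cst (p : R) : R := (p / 2 * 16) `^ (p / 2).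

Lemma normr_powR_le_exp (p x : R) : 0 < p ->
  `|x| `^ p <= pow_exp_cst p * expR (16^-1 * x ^+ 2).
Proof.
move=> p0; have -> : `|x| `^ p = (x ^+ 2) `^ (p / 2).
  rewrite -real_normK ?num_real// -powR_mulrn// -powRrM; congr (_ `^ _).
  by field.
have c0 : (0 : R) < 16^-1 by rewrite invr_gt0.
have a0 : 0 < p / 2 by lra.
by have := powR_le_expR a0 c0 (sqr_ge0 x); rewrite invrK.
Qed.

Lemma normr_powR_le_exp8 (p x : R) : 0 < p ->
  `|x| `^ p <= pow_exp_cst p * expR (8^-1 * x ^+ 2).
Proof.
move=> p0; apply: le_trans (normr_powR_le_exp x p0) _.
apply: ler_wpM2l; first exact: powR_ge0.
by rewrite ler_expR; have := sqr_ge0 x; lra.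
Qed.

(** Beyond [4 * sqrt L] one has [x ^ 2 / 16 >= L], so the remainder gains a factor [expR (- L)],
    which later pays for a sum over [expR L] rows. *)
Lemma normr_powR_trunc (p x L : R) : 0 < p -> 0 <= L ->
  `|x| `^ p <= (Num.min `|x| (4 * Num.sqrt L)) `^ p +
     pow_exp_cst p * expR (- L) * expR (8^-1 * x ^+ 2).
Proof.
move=> p0 L0; have T0 : 0 <= 4 * Num.sqrt L by rewrite mulr_ge0// sqrtr_ge0.
have [xT|xT] := leP `|x| (4 * Num.sqrt L).
  by rewrite lerDl !mulr_ge0 ?powR_ge0 ?expR_ge0.
apply: le_trans (normr_powR_le_exp x p0) _.
apply: (@le_trans _ _ (pow_exp_cst p * expR (- L) * expR (8^-1 * x ^+ 2))); last first.
  by rewrite lerDr powR_ge0.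
rewrite -mulrA; apply: ler_wpM2l; first exact: powR_ge0.
rewrite -expRD ler_expR.
have : (4 * Num.sqrt L) ^+ 2 <= `|x| ^+ 2 by rewrite ler_sqr ?nnegrE// ltW.
by rewrite exprMn sqr_sqrtr// real_normK ?num_real//; lra.
Qed.

Lemma gauss_exp_cst_ge0 : 0 <= gauss_exp_cst R.
Proof.
rewrite /gauss_exp_cst !mulr_ge0 ?normal_peak_ge0 ?invr_ge0 ?normal_peak_ge0 ?expR_ge0//.
rewrite subr_ge0 -expRD -[leRHS]expR0 ler_expR; lra.
Qed.

Lemma gaussian_moment d (T : measurableType d) (P : probability T R)
    (X : {RV P >-> R}) (p : R) : std_gaussian X -> 0 < p ->
  (\int[P]_w (`|X w| `^ p)%:E <= (pow_exp_cst p * gauss_exp_cst R)%:E)%E.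
Proof.
move=> gX p0.
apply: (@le_trans _ _ (\int[P]_w ((pow_exp_cst p)%:E * (expR (8^-1 * X w ^+ 2))%:E))%E).
  apply: ge0_le_integralT => w; first by rewrite lee_fin powR_ge0.
  by rewrite -EFinM lee_fin; exact: normr_powR_le_exp8.
have e0 w : setT w -> (0 <= (expR (8^-1 * X w ^+ 2))%:E)%E by rewrite lee_fin expR_ge0.
have me : measurable_fun [set: T] (fun w => (expR (8^-1 * X w ^+ 2))%:E).
  apply/measurable_EFinP; apply: measurableT_comp; first exact: measurable_expR.
  by apply: measurable_funM => //; apply: measurable_funX; exact: measurable_funPT.
rewrite (ge0_integralZl_EFin _ _ e0) ?powR_ge0//.
by rewrite EFinM; apply: lee_wpmul2l; [rewrite lee_fin powR_ge0|exact: gaussian_exp_le].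
Qed.

End GaussianMoments.

(** * The maximal row norm of a Gaussian matrix *)

Section MaxNorm.
Context {R : realType} (p : R).
Hypothesis p2 : 2 <= p.

Let p0 : 0 < p. Proof. by have P2 := p2; lra. Qed.

Definition max_norm_cst : R :=
  1 + (2 * 4 `^ p + (expR 1 + 1) * (pow_exp_cst p * gauss_exp_cst R)).

Lemma max_norm_cst_ge0 : 0 <= max_norm_cst.
Proof.
have e1 : 0 <= expR 1 + 1 :> R by rewrite addr_ge0 ?expR_ge0.
have ge : 0 <= pow_exp_cst p * gauss_exp_cst R.
  exact: mulr_ge0 (powR_ge0 _ _) gauss_exp_cst_ge0.
apply: addr_ge0 => //; apply: addr_ge0; last exact: mulr_ge0 e1 ge.
by rewrite mulr_ge0 ?powR_ge0.
Qed.

Lemma expR_le_affine (u : R) : 0 <= u <= 1 -> expR u <= 1 + expR 1 * u.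
Proof.
move=> /andP[u0 u1].
have h1 : expR u * expR (- u) = 1 by rewrite -expRD subrr expR0.
have h2 := expR_ge1Dx (- u).
have h3 := expR_ge0 u.
have h4 : expR u <= expR 1 by rewrite ler_expR.
have : expR u * (1 - u) <= 1 by rewrite -[leRHS]h1 ler_wpM2l.
have : expR u * u <= expR 1 * u by rewrite ler_wpM2r.
lra.
Qed.

Context d (T : measurableType d) (P : probability T R).

(** Truncation keeps the exponent in [[0, 1]], where [expR] is at most affine with slope [expR 1];
    then only the moment of order [p] matters. *)
Let trunc_moment (X : {RV P >-> R}) (c M th : R) : std_gaussian X ->
  0 < M -> 0 <= c -> 0 <= th -> c * th `^ p <= M ->
  (\int[P]_w (expR (M^-1 * (c * Num.min `|X w| th `^ p)))%:E <=
   (expR (expR 1 * (pow_exp_cst p * gauss_exp_cst R) / M * c))%:E)%E.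
Proof.
move=> gX M0 c0 th0 cth.
have mX : measurable_fun [set: T] (fun w => `|X w| `^ p).
  by apply/measurable_powR_fun/measurable_normr_fun; exact: measurable_funPT.
apply: (@le_trans _ _ (\int[P]_w (1%:E + (expR 1 * (M^-1 * c))%:E * (`|X w| `^ p)%:E))%E).
  apply: ge0_le_integralT => w; first by rewrite lee_fin expR_ge0.
  rewrite -EFinM -EFinD lee_fin.
  have m0 : 0 <= Num.min `|X w| th by rewrite le_min normr_ge0.
  have mth : Num.min `|X w| th `^ p <= th `^ p.
    by apply: le_powR2r => //; [exact: ltW|rewrite ge_min lexx orbT].
  have mX' : Num.min `|X w| th `^ p <= `|X w| `^ p.
    by apply: le_powR2r => //; [exact: ltW|rewrite ge_min lexx].
  apply: le_trans (expR_le_affine _) _.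
    rewrite !mulr_ge0 ?invr_ge0 ?powR_ge0 ?(ltW M0)//= mulrC ler_pdivrMr// mul1r.
    by apply: le_trans cth; apply: ler_wpM2l.
  rewrite lerD2l -!mulrA; apply: ler_wpM2l; first exact: expR_ge0.
  by apply: ler_wpM2l; [rewrite invr_ge0 ltW|apply: ler_wpM2l].
have k0 : 0 <= expR 1 * (M^-1 * c) by rewrite !mulr_ge0 ?expR_ge0 ?invr_ge0 ?(ltW M0).
have X0 w : setT w -> (0 <= (`|X w| `^ p)%:E)%E by rewrite lee_fin powR_ge0.
have mXE : measurable_fun [set: T] (fun w => (`|X w| `^ p)%:E) by exact/measurable_EFinP.
rewrite ge0_integralD//; last 2 first.
- by move=> w _; rewrite -EFinM lee_fin mulr_ge0// powR_ge0.
- by apply: measurable_funeM.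
rewrite integral_cst//= probability_setT mule1 (ge0_integralZl_EFin _ _ X0)//.
apply: le_trans (_ : (1%:E + (expR 1 * (M^-1 * c))%:E *
    (pow_exp_cst p * gauss_exp_cst R)%:E <= _))%E.
  by apply: leeD2l; apply: lee_wpmul2l; [rewrite lee_fin|exact: gaussian_moment].
rewrite -EFinM -EFinD lee_fin; apply: le_trans (expR_ge1Dx _) _.
rewrite ler_expR le_eqVlt; apply/orP; left; apply/eqP; ring.
Qed.

Let m : R := pow_exp_cst p * gauss_exp_cst R.

Let m0 : 0 <= m. Proof. by rewrite mulr_ge0 ?powR_ge0 ?gauss_exp_cst_ge0. Qed.

Let measurable_trunc (X : {RV P >-> R}) (th : R) :
  measurable_fun [set: T] (fun w => Num.min `|X w| th `^ p).
Proof.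
apply: measurable_powR_fun; apply: measurable_minr; last exact: measurable_cst.
by apply: measurable_normr_fun; exact: measurable_funPT.
Qed.

Lemma trunc_row_mgf (J : finType) (G : J -> {RV P >-> R}) (a : J -> R) (M th : R) :
  mutually_independent P (fun j => G j : T -> R) -> (forall j, std_gaussian (G j)) ->
  0 < M -> 0 <= th -> (forall j, `|a j| `^ p * th `^ p <= M) ->
  (\int[P]_w (expR (M^-1 * \sum_j `|a j| `^ p * Num.min `|G j w| th `^ p))%:E <=
   (expR (expR 1 * m / M * \sum_j `|a j| `^ p))%:E)%E.
Proof.
move=> indG gG M0 th0 aM.
have expR_sum (F : J -> R) : expR (\sum_j F j) = \prod_j expR (F j).
  by rewrite (big_morph expR (@expRD R) (@expR0 R)).
rewrite mulr_sumr expR_sum.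
under eq_integral do rewrite mulr_sumr expR_sum.
pose F j (g : R) := expR (M^-1 * (`|a j| `^ p * Num.min `|g| th `^ p)).
have mG j : measurable_fun [set: T] (G j) by exact: measurable_funPT.
apply: (@integral_prod_le _ _ _ P J (fun j => G j : T -> R) mG indG (index_enum J) F
  (fun j => expR (expR 1 * m / M * `|a j| `^ p))).
- exact: index_enum_uniq.
- move=> j; apply: measurableT_comp; first exact: measurable_expR.
  apply: measurable_funM => //; apply: measurable_funM => //.
  apply: measurable_powR_fun; apply: measurable_minr; last exact: measurable_cst.
  exact: measurable_normr_fun.
- by move=> j x; exact: expR_ge0.
- by move=> j _; apply: trunc_moment => //; exact: powR_ge0.
Qed.

(** The row sums of truncated variables are controlled by exponential moments at the scale [M], the
    largest possible summand, and the remainders in mean by summing over all rows. The map [iota]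
    lets one statement serve rows, columns and submatrices. *)
Lemma max_norm (I J E : finType) (G : E -> {RV P >-> R}) (iota : I -> J -> E)
    (a : I -> J -> R) (r sg L : R) :
  mutually_independent P (fun e => G e : T -> R) -> (forall e, std_gaussian (G e)) ->
  (forall i, injective (iota i)) -> 0 <= r -> 0 < sg -> 1 <= L ->
  #|I|%:R <= expR L -> (forall i, \sum_j `|a i j| `^ p <= r `^ p) ->
  (forall i j, `|a i j| <= sg) ->
  (\int[P]_w (\big[Num.max/0]_i
     (\sum_j `|a i j * G (iota i j) w| `^ p) `^ p^-1)%:E <=
   (max_norm_cst * (r + L * sg))%:E)%E.
Proof.
move=> indG gG iinj r0 sg0 L1 cardI rowa enta.
have L0 : 0 < L by lra.
pose th := 4 * Num.sqrt L.
have th0 : 0 < th by rewrite mulr_gt0// sqrtr_gt0.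
pose M := sg `^ p * th `^ p.
have M0 : 0 < M by rewrite mulr_gt0 ?powR_gt0.
pose S' i w := \sum_j `|a i j| `^ p * Num.min `|G (iota i j) w| th `^ p.
pose K := pow_exp_cst p * expR (- L).
have K0 : 0 <= K by rewrite mulr_ge0 ?powR_ge0 ?expR_ge0.
pose Rm w := \sum_i \sum_j (`|a i j| `^ p * K) * expR (8^-1 * G (iota i j) w ^+ 2).
(* [L] compensates the number of rows, the second summand the logarithm of the moment generating
   function of one row. *)
pose B0 := L + expR 1 * m / M * r `^ p.
pose Q w := M * B0 + M * (\sum_i expR (M^-1 * S' i w - B0)) + Rm w.
have B00 : 0 <= B0.
  apply: addr_ge0; first exact: ltW.
  by rewrite mulr_ge0 ?powR_ge0// divr_ge0 ?(ltW M0)// mulr_ge0 ?expR_ge0 ?m0.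
have Rm0 w : 0 <= Rm w.
  by apply: sumr_ge0 => i _; apply: sumr_ge0 => j _; rewrite mulr_ge0 ?expR_ge0// mulr_ge0 ?powR_ge0.
have Q0 w : 0 <= Q w.
  apply: addr_ge0 => //; apply: addr_ge0; first by rewrite mulr_ge0 ?(ltW M0).
  rewrite mulr_ge0 ?(ltW M0)//.
  by apply: sumr_ge0 => i _; exact: expR_ge0.
have SQ i w : \sum_j `|a i j * G (iota i j) w| `^ p <= Q w.
  apply: (@le_trans _ _ (S' i w +
      \sum_j (`|a i j| `^ p * K) * expR (8^-1 * G (iota i j) w ^+ 2))).
    rewrite /S' -big_split/=; apply: ler_sum => j _.
    rewrite normrM powRM// -mulrA -mulrDr; apply: ler_wpM2l; first exact: powR_ge0.
    by apply: normr_powR_trunc => //; exact: ltW.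
  rewrite /Q; apply: lerD; last first.
    rewrite /Rm (bigD1 i)//= lerDl; apply: sumr_ge0 => i' _.
    by apply: sumr_ge0 => j _; rewrite mulr_ge0 ?expR_ge0// mulr_ge0 ?powR_ge0.
  have -> : S' i w = M * (M^-1 * S' i w) by rewrite mulrA divff ?mul1r// gt_eqF.
  rewrite -mulrDr; apply: ler_wpM2l; first exact: ltW.
  have := expR_ge1Dx (M^-1 * S' i w - B0).
  have : expR (M^-1 * S' i w - B0) <= \sum_i expR (M^-1 * S' i w - B0).
    by rewrite (bigD1 i)//= lerDl; apply: sumr_ge0 => i' _; exact: expR_ge0.
  lra.
pose D := r `^ p + (L * sg) `^ p.
have Lsg : 0 < L * sg by rewrite mulr_gt0.
have D0 : 0 < D by rewrite ltr_wpDl ?powR_ge0 ?powR_gt0.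
have pV : 0 <= p^-1 <= 1 by rewrite invr_ge0 (ltW p0) invf_le1//; have P2 := p2; lra.
have Dp : D `^ p^-1 <= r + L * sg.
  apply: le_trans (powR_subadd pV (powR_ge0 _ _) (powR_ge0 _ _)) _.
  by rewrite !powRK ?(ltW Lsg) ?gt_eqF.
(* [M * L] is [4 ^ p * sg ^ p * L ^ (p / 2 + 1)]; the exponent of [L] is at most [p] because
   [p >= 2], and [L >= 1]. *)
have Mle : M * L <= 4 `^ p * (L * sg) `^ p.
  rewrite /M /th !powRM ?sqrtr_ge0 ?(ltW sg0) ?(ltW L0)//.
  rewrite -powR12_sqrt ?(ltW L0)// -powRrM.
  have -> : sg `^ p * (4 `^ p * L `^ (2^-1 * p)) * L =
      4 `^ p * ((L `^ (2^-1 * p) * L) * sg `^ p) by ring.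
  apply: ler_wpM2l; first exact: powR_ge0.
  apply: ler_wpM2r; first exact: powR_ge0.
  rewrite -[X in _ * X <= _](powRr1 (ltW L0)) -powRD_gt0//.
  by apply: ler_powR => //; have P2 := p2; lra.
have mG e : measurable_fun [set: T] (G e) by exact: measurable_funPT.
have mS' i : measurable_fun [set: T] (S' i).
  by apply: measurable_sum => j; apply: measurable_funM.
have mexp i : measurable_fun [set: T] (fun w => expR (M^-1 * S' i w - B0)).
  apply: measurableT_comp; first exact: measurable_expR.
  by apply: measurable_funB => //; apply: measurable_funM.
have m8 e : measurable_fun [set: T] (fun w => expR (8^-1 * G e w ^+ 2)).
  apply: measurableT_comp; first exact: measurable_expR.
  by apply: measurable_funM => //; exact: measurable_funX.
have intexp i : (\int[P]_w (expR (M^-1 * S' i w - B0))%:E <= (expR (- L))%:E)%E.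
  have -> : expR (- L) = expR (- B0) * expR (expR 1 * m / M * r `^ p).
    by rewrite -expRD /B0; congr expR; ring.
  under eq_integral do rewrite addrC expRD.
  apply: integral_scale_le => [|w||].
  - apply: measurableT_comp; first exact: measurable_expR.
    by apply: measurable_funM.
  - exact: expR_ge0.
  - exact: expR_ge0.
  apply: le_trans (trunc_row_mgf (G := fun j => G (iota i j)) (a := a i) _ _ M0 (ltW th0) _) _.
  - exact: (mutually_independent_inj (G := fun e => G e : T -> R) (@iinj i)).
  - by [].
  - move=> j; apply: ler_wpM2r; first exact: powR_ge0.
    by apply: le_powR2r => //; exact: ltW.
  rewrite lee_fin ler_expR; apply: ler_wpM2l => //.
  by rewrite divr_ge0 ?(ltW M0)// mulr_ge0 ?expR_ge0 ?m0.
have msum : measurable_fun [set: T] (fun w => \sum_i expR (M^-1 * S' i w - B0)).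
  by apply: measurable_sum.
have s0 w : 0 <= \sum_i expR (M^-1 * S' i w - B0).
  by apply: sumr_ge0 => i _; exact: expR_ge0.
have intS : (\int[P]_w (\sum_i expR (M^-1 * S' i w - B0))%:E <= 1%:E)%E.
  apply: le_trans (integral_sum_le _ mexp _ intexp) _.
    by move=> i w; exact: expR_ge0.
  rewrite sumr_const lee_fin -[_ *+ _]mulr_natl expRN.
  by rewrite ler_pdivrMr ?expR_gt0// mul1r.
have mterm i j : measurable_fun [set: T]
    (fun w => (`|a i j| `^ p * K) * expR (8^-1 * G (iota i j) w ^+ 2)).
  exact: measurable_funM.
have term0 i j w : 0 <= (`|a i j| `^ p * K) * expR (8^-1 * G (iota i j) w ^+ 2).
  by rewrite mulr_ge0 ?expR_ge0// mulr_ge0 ?powR_ge0.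
have mRm : measurable_fun [set: T] Rm.
  by apply: measurable_sum => i; exact: measurable_sum.
have intR : (\int[P]_w (Rm w)%:E <= (m * r `^ p)%:E)%E.
  apply: le_trans (integral_sum_le (c := fun=> expR (- L) * (m * r `^ p)) _ _ _ _) _.
  - by move=> i; exact: measurable_sum.
  - by move=> i w; exact: sumr_ge0.
  - move=> i.
    apply: le_trans (integral_sum_le (c := fun j => `|a i j| `^ p * K * gauss_exp_cst R)
      _ (mterm i) (term0 i) _) _.
      move=> j; apply: integral_scale_le; [exact: m8|by move=> w; exact: expR_ge0| |
        exact: gaussian_exp_le].
      by rewrite mulr_ge0 ?powR_ge0.
    rewrite lee_fin -!mulr_suml.
    rewrite [leRHS](_ : _ = r `^ p * K * gauss_exp_cst R); last by rewrite /K /m; ring.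
    apply: ler_wpM2r; first exact: gauss_exp_cst_ge0.
    by apply: ler_wpM2r.
  rewrite sumr_const lee_fin -[_ *+ _]mulr_natl mulrA -[leRHS]mul1r.
  apply: ler_wpM2r; first by rewrite mulr_ge0 ?m0 ?powR_ge0.
  by rewrite expRN ler_pdivrMr ?expR_gt0// mul1r.
have mQ1 : measurable_fun [set: T]
    (fun w => M * B0 + M * (\sum_i expR (M^-1 * S' i w - B0))).
  by apply: measurable_funD => //; exact: measurable_funM.
have mQ : measurable_fun [set: T] Q by exact: measurable_funD.
have M0' := ltW M0.
have intQ : (\int[P]_w (Q w)%:E <= ((max_norm_cst - 1) * D)%:E)%E.
  apply: (@le_trans _ _ (M * B0 + M * 1 + m * r `^ p)%:E).
    apply: integral_add_le => //.
      by move=> w; apply: addr_ge0; [exact: mulr_ge0|apply: mulr_ge0].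
    apply: integral_add_le.
    - exact: measurable_cst.
    - exact: measurable_funM.
    - by move=> w; apply: mulr_ge0.
    - by move=> w; apply: mulr_ge0.
    - by rewrite integral_cst_real.
    - exact: integral_scale_le.
  rewrite lee_fin mulr1.
  have -> : M * B0 = M * L + expR 1 * m * r `^ p.
    by rewrite /B0; field; rewrite gt_eqF.
  have ML : M <= M * L by rewrite ler_peMr.
  have rp := powR_ge0 r p.
  have Lp := powR_ge0 (L * sg) p.
  have E1 := expR_ge0 (1 : R).
  have c1 : 0 <= 2 * 4 `^ p :> R by rewrite mulr_ge0 ?powR_ge0.
  have c2 : 0 <= (expR 1 + 1) * m by rewrite mulr_ge0 ?m0 ?addr_ge0.
  rewrite /max_norm_cst -/m /D [leRHS](_ : _ = 2 * 4 `^ p * r `^ p +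
    2 * (4 `^ p * (L * sg) `^ p) + (expR 1 * m * r `^ p + m * r `^ p) +
    (expR 1 + 1) * m * (L * sg) `^ p); last by ring.
  have := mulr_ge0 c1 rp; have := mulr_ge0 c2 Lp; lra.
have C1 : 0 <= max_norm_cst - 1.
  rewrite /max_norm_cst -/m.
  have : 0 <= 2 * 4 `^ p :> R by rewrite mulr_ge0 ?powR_ge0.
  have : 0 <= (expR 1 + 1) * m by rewrite mulr_ge0 ?m0 ?addr_ge0 ?expR_ge0.
  lra.
apply: (integral_le (g := fun w => D `^ p^-1 * (1 + D^-1 * Q w))) => [w|w|].
- exact: bigmax_ge_id.
- apply: bigmax_le.
    by rewrite mulr_ge0 ?powR_ge0// addr_ge0// mulr_ge0 ?invr_ge0 ?(ltW D0).
  move=> i _; apply: le_trans (_ : (Q w) `^ p^-1 <= _).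
    apply: le_powR2r; [by have /andP[] := pV| |exact: SQ].
    by apply: sumr_ge0 => j _; exact: powR_ge0.
  by rewrite (mulrC D^-1); apply: powR_le_affine.
have Di : 0 <= D^-1 by rewrite invr_ge0 ltW.
apply: (@le_trans _ _ (D `^ p^-1 * (1 + D^-1 * ((max_norm_cst - 1) * D)))%:E).
  apply: integral_scale_le; [| |exact: powR_ge0|].
  - by apply: measurable_funD => //; exact: measurable_funM.
  - by move=> w; apply: addr_ge0 => //; apply: mulr_ge0.
  apply: integral_add_le.
  - exact: measurable_cst.
  - exact: measurable_funM.
  - by [].
  - by move=> w; apply: mulr_ge0.
  - by rewrite integral_cst_real.
  - exact: integral_scale_le.
rewrite lee_fin.
have -> : 1 + D^-1 * ((max_norm_cst - 1) * D) = max_norm_cst.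
  by field; rewrite gt_eqF.
by rewrite mulrC; apply: ler_wpM2l => //; lra.
Qed.

End MaxNorm.

(** * Gaussian matrices *)


Section MeasurableNorms.
Context d (T : measurableType d) {R : realType}.

Lemma measurable_bigmax (I : finType) (D : pred I) (f : I -> T -> R) :
  (forall i, measurable_fun [set: T] (f i)) ->
  measurable_fun [set: T] (fun w => \big[Num.max/0]_(i | D i) f i w).
Proof.
move=> mf; elim: (index_enum I) => [|i s IH].
  by under eq_fun do rewrite big_nil; exact: measurable_cst.
under eq_fun do rewrite big_cons; case: (D i) => //.
exact: measurable_maxr.
Qed.

Context {I J : finType}.

Lemma measurable_row_power q (x : I -> J -> T -> R) (t : J -> R) :
  (forall i j, measurable_fun [set: T] (x i j)) ->
  measurable_fun [set: T] (fun w => row_power q (fun i j => x i j w) t).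
Proof.
move=> mx; apply: measurable_sum => i.
apply/measurable_powR_fun/measurable_normr_fun/measurable_sum => j.
exact: measurable_funM.
Qed.

Lemma measurable_dyadic_norm p q K (x : I -> J -> T -> R) :
  (forall i j, measurable_fun [set: T] (x i j)) ->
  measurable_fun [set: T] (fun w => dyadic_norm p q K (fun i j => x i j w)).
Proof.
by move=> mx; apply: measurable_bigmax => s; exact: measurable_row_power.
Qed.

End MeasurableNorms.

(** * From sign averages to Gaussian expectations *)

Section RootAverage.
Context {R : realType} {I J : finType}.
Variables (p q : R).
Hypotheses (p2 : 2 <= p) (q2 : 2 <= q).

Definition average_cst : R :=
  1 + (6 * drift_cst q + 2 * (6 + 2 * expR 1) / mgf_rate q).

Let q0 : 0 < q. Proof. by have Q2 := q2; lra. Qed.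

Let qV : 0 <= q^-1 <= 1.
Proof. by rewrite invr_ge0 (ltW q0) invf_le1//; have Q2 := q2; lra. Qed.

Lemma dyadic_norm_ge0 (K : nat) (b : I -> J -> R) : 0 <= dyadic_norm p q K b.
Proof. exact: bigmax_ge_id. Qed.

Lemma average_cst_ge1 : 1 <= average_cst.
Proof.
rewrite /average_cst; have := drift_cst_ge0 q2; have := mgf_rate_gt0 q2 => m0 d0.
have : 0 <= 2 * (6 + 2 * expR 1) / mgf_rate q.
  by rewrite divr_ge0 ?(ltW m0)//; have := expR_ge0 (1 : R); lra.
lra.
Qed.

Lemma root_dyadic_norm_average (K : nat) (b : I -> J -> R) (r c Lam : R) :
  0 < r -> 0 <= c -> 1 <= Lam ->
  (forall i, \sum_j `|b i j| `^ p <= r `^ p) ->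
  (forall j, \sum_i `|b i j| `^ q <= c `^ q) ->
  (2 * K.+1)%:R * #|J|%:R <= expR Lam ->
  \sum_eps (dyadic_norm p q K (sign_mx eps b)) `^ q^-1 <=
    #|{ffun I * J -> bool}|%:R * (average_cst * (c + Lam `^ q^-1 * r)).
Proof.
move=> r0 c0 Lam1 rowb colb hLam.
have Lam0 : 0 < Lam by lra.
have avg := dyadic_norm_average p2 q2 r0 (ltW Lam0) rowb colb (powR_ge0 c q) hLam.
set N : R := _%:R in avg *.
pose D := c `^ q + Lam * r `^ q.
have rq : 0 < r `^ q by rewrite powR_gt0.
have D0 : 0 < D by rewrite ltr_wpDl ?powR_ge0 ?mulr_gt0.
have N0 : 0 <= N by [].
have mg := mgf_rate_gt0 q2; have dc := drift_cst_ge0 q2.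
have E1 := expR_ge0 (1 : R).
have avgD : \sum_eps dyadic_norm p q K (sign_mx eps b) <= N * ((average_cst - 1) * D).
  apply: (le_trans avg); apply: ler_wpM2l => //.
  have k0 : 0 <= 2 * (6 + 2 * expR 1) / mgf_rate q.
    by rewrite divr_ge0 ?(ltW mg)//; lra.
  have -> : (average_cst - 1) * D =
     2 * (3 * (drift_cst q * c `^ q) + r `^ q / mgf_rate q * (6 * Lam + 2 * expR 1 * Lam))
     + (2 * (6 + 2 * expR 1) / mgf_rate q * c `^ q + 6 * drift_cst q * (Lam * r `^ q)).
    by rewrite /average_cst /D; field; rewrite gt_eqF.
  rewrite -[leLHS]addr0; apply: lerD.
    apply: ler_wpM2l => //; rewrite lerD2l; apply: ler_wpM2l.
      by rewrite divr_ge0 ?(ltW mg) ?(ltW rq).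
    by rewrite lerD2l ler_peMr//; lra.
  apply: addr_ge0; first by rewrite mulr_ge0 ?powR_ge0.
  by rewrite mulr_ge0 ?mulr_ge0 ?powR_ge0 ?(ltW Lam0).
have DE : D `^ q^-1 <= c + Lam `^ q^-1 * r.
  apply: le_trans (powR_subadd qV (powR_ge0 _ _) _) _.
    by rewrite mulr_ge0 ?powR_ge0 ?(ltW Lam0).
  by rewrite powRM ?powR_ge0 ?(ltW Lam0)// !powRK ?(ltW r0) ?gt_eqF.
apply: (@le_trans _ _ (\sum_(eps : {ffun I * J -> bool})
   D `^ q^-1 * (1 + D^-1 * dyadic_norm p q K (sign_mx eps b)))).
  apply: ler_sum => eps _; rewrite (mulrC D^-1).
  by apply: powR_le_affine => //; exact: dyadic_norm_ge0.
rewrite -mulr_sumr big_split/= -mulr_sumr.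
have -> : \sum_(eps : {ffun I * J -> bool}) 1 = N by rewrite sumr_const.
apply: (@le_trans _ _ (D `^ q^-1 * (N * average_cst))).
  apply: ler_wpM2l; first exact: powR_ge0.
  rewrite [leRHS](_ : _ = N + D^-1 * (N * ((average_cst - 1) * D))); last first.
    by field; rewrite gt_eqF.
  by rewrite lerD2l; apply: ler_wpM2l => //; rewrite invr_ge0 ltW.
rewrite mulrC -mulrA; apply: ler_wpM2l => //; apply: ler_wpM2l => //.
by have := average_cst_ge1; lra.
Qed.

Definition max_row_norm (s : R) (x : I -> J -> R) : R :=
  \big[Num.max/0]_i (\sum_j `|x i j| `^ s) `^ s^-1.

Lemma max_row_norm_ge0 s x : 0 <= max_row_norm s x.
Proof. exact: bigmax_ge_id. Qed.

Lemma le_max_row_norm s x i : 0 < s ->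
  \sum_j `|x i j| `^ s <= (max_row_norm s x) `^ s.
Proof.
move=> s0; rewrite -[leLHS](@powRVK _ s) ?gt_eqF//; last first.
  by apply: sumr_ge0 => j _; exact: powR_ge0.
apply: le_powR2r; [exact: ltW|exact: powR_ge0|].
exact: (le_bigmax _ (fun i => (\sum_j `|x i j| `^ s) `^ s^-1)).
Qed.

Lemma measurable_max_row_norm d (T : measurableType d) s (x : I -> J -> T -> R) :
  (forall i j, measurable_fun [set: T] (x i j)) ->
  measurable_fun [set: T] (fun w => max_row_norm s (fun i j => x i j w)).
Proof.
move=> mx; apply: measurable_bigmax => i; apply/measurable_powR_fun/measurable_sum => j.
exact/measurable_powR_fun/measurable_normr_fun.
Qed.

End RootAverage.

Section GaussianAverage.
Context {R : realType} {I J : finType} (p q : R).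
Hypotheses (p2 : 2 <= p) (q2 : 2 <= q).
Context d (T : measurableType d) (P : probability T R).

(** The Rademacher bound, applied at each [w], requires a positive row bound; [de] guarantees it
    where the random matrix vanishes. *)
Lemma gaussian_dyadic_norm_le (G : I * J -> {RV P >-> R}) (a : I -> J -> R)
    (K : nat) (de Lam : R) (x := fun w i j => a i j * G (i, j) w) :
  mutually_independent P (fun e => G e : T -> R) -> (forall e, std_gaussian (G e)) ->
  0 < de -> 1 <= Lam -> (2 * K.+1)%:R * #|J|%:R <= expR Lam ->
  (\int[P]_w ((dyadic_norm p q K (x w)) `^ q^-1)%:E <=
   \int[P]_w (average_cst q * (max_row_norm q (fun j i => x w i j) +
      Lam `^ q^-1 * (max_row_norm p (x w) + de)))%:E)%E.
Proof.
move=> indG gG de0 Lam1 hLam.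
have p0 : 0 < p by have P2 := p2; lra.
have q0 : 0 < q by have Q2 := q2; lra.
have mG e : measurable_fun [set: T] (G e : T -> R) by exact: measurable_funPT.
have mx i j : measurable_fun [set: T] (fun w => x w i j).
  by apply: measurable_funM.
have A1 := average_cst_ge1 q2.
pose h (g : @coordType R (I * J)%type) : R :=
  (dyadic_norm p q K (fun i j => a i j * g (i, j))) `^ q^-1.
apply: (@sign_average_le _ _ _ P _ (fun e => G e : T -> R) mG indG _ h).
- by move=> e A mA; exact: gaussian_sym.
- apply: measurable_powR_fun; apply: measurable_dyadic_norm => i j.
  apply: measurable_funM; first exact: measurable_cst.
  exact: (@measurable_coord R (I * J)%type (i, j)).
- by move=> g; exact: powR_ge0.
- apply: measurable_funM; first exact: measurable_cst.
  apply: measurable_funD; first exact: measurable_max_row_norm.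
  apply: measurable_funM; first exact: measurable_cst.
  by apply: measurable_funD; [exact: measurable_max_row_norm|exact: measurable_cst].
- move=> w; apply: mulr_ge0; first lra.
  by rewrite addr_ge0 ?mulr_ge0 ?addr_ge0 ?powR_ge0 ?max_row_norm_ge0 ?(ltW de0).
move=> w.
have rx := max_row_norm_ge0 p (x w).
have r0 : 0 < max_row_norm p (x w) + de by rewrite ltr_wpDl.
have := root_dyadic_norm_average (b := x w) p2 q2 r0
  (max_row_norm_ge0 q (fun j i => x w i j)) Lam1 _ _ hLam.
set B := _ * (_ * (_ + _)) => hB.
rewrite (_ : \sum_eps _ = \sum_eps dyadic_norm p q K (sign_mx eps (x w)) `^ q^-1).
  apply: hB => [i|j].
    apply: le_trans (le_max_row_norm (x w) i p0) _.
    by apply: le_powR2r => //; [exact: ltW|rewrite lerDl ltW].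
  exact: (le_max_row_norm (fun j i => x w i j) j q0).
apply: eq_bigr => eps _; congr (dyadic_norm p q K _ `^ _).
by apply/funext => i; apply/funext => j; rewrite /sign_mx /x mulrCA.
Qed.

End GaussianAverage.


(** * Splitting off a set of columns *)

Section SplitColumns.
Context {R : realType} {I J : finType} (H : pred J).
Implicit Types (x : I -> J -> R).

(** Kept columns are re-indexed by a subtype because the Rademacher bound charges for the number of
    columns. Killed columns stay in place: after transposition [J] indexes rows, whose number is
    free. *)
Definition kept_columns x (i : I) (j : {j | H j}) : R := x i (val j).

Definition killed_columns x (i : I) (j : J) : R := if H j then 0 else x i j.

Lemma sum_subtype (F : J -> R) : \sum_(j : {j | H j}) F (val j) = \sum_(j | H j) F j.
Proof.
rewrite [RHS](reindex_omap (val : {j | H j} -> J) insub) /=; last first.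
  by move=> j Hj; rewrite insubT.
by apply: eq_bigl => j; rewrite valK (valP j) eqxx.
Qed.

Lemma row_power_split q x (t : J -> R) : 1 <= q ->
  row_power q x t <= 2 `^ q * (row_power q (kept_columns x) (fun j => t (val j)) +
    row_power q (killed_columns x) t).
Proof.
move=> q1; rewrite /row_power -big_split/= mulr_sumr; apply: ler_sum => i _.
rewrite (bigID H)/=; apply: le_trans (normrD_powR _ _ q1) _.
rewrite (sum_subtype (fun j => x i j * t j)).
rewrite (_ : \sum_(j | ~~ H j) x i j * t j = \sum_j killed_columns x i j * t j)//.
rewrite big_mkcond/=; apply: eq_bigr => j _; rewrite /killed_columns.
by case: (H j) => //=; rewrite mul0r.
Qed.

Lemma level_coef_mass (p p' : R) K (lv : level K) : 2 <= p -> p^-1 + p'^-1 = 1 ->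
  `|level_coef p lv| `^ p' = level_mass lv.
Proof.
move=> p2 pp'; have pV : p^-1 <= 2^-1 by rewrite lef_pV2 ?posrE//; lra.
have p'V : 0 < p'^-1 by lra.
have p'0 : 0 < p' by rewrite -invr_gt0.
case: lv => [[l s]|] /=; last by rewrite normr0 powR0// gt_eqF.
rewrite normrM normrX normrN normr1 expr1n mul1r ger0_norm ?powR_ge0//.
have -> : 1 - p^-1 = p'^-1 by lra.
by rewrite powRVK ?gt_eqF// exprn_ge0.
Qed.

Lemma row_power_scale q x (k : R) (t : J -> R) : 0 <= k ->
  row_power q x (fun j => k * t j) = k `^ q * row_power q x t.
Proof.
move=> k0; rewrite /row_power mulr_sumr; apply: eq_bigr => i _.
rewrite -[in RHS](ger0_norm k0) -powRM// -normrM mulr_sumr.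
by congr (`|_| `^ _); apply: eq_bigr => j _; rewrite mulrCA.
Qed.

(** The factor 6 is [3 * 2]: an admissible vector divided by 3 lies in the unit ball of l_p', and
    the sum of the two parts costs 2. *)
Lemma dyadic_norm_split (p p' q : R) (K K1 K2 : nat) x :
  2 <= p -> 2 <= q -> p^-1 + p'^-1 = 1 ->
  (#|{: {j | H j}}| <= 2 ^ K1)%N -> (#|I| <= 2 ^ K2)%N ->
  (dyadic_norm p q K x) `^ q^-1 <=
  6 * ((dyadic_norm p q K1 (kept_columns x)) `^ q^-1 +
       (dyadic_norm q p K2 (fun j i => killed_columns x i j)) `^ p^-1).
Proof.
move=> p2 q2 pp' hK1 hK2.
have q0 : 0 < q by lra.
have pV : p^-1 <= 2^-1 by rewrite lef_pV2 ?posrE//; lra.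
have pV0 : 0 < p^-1 by rewrite invr_gt0; lra.
have p'V : 0 < p'^-1 by lra.
have p'0 : 0 < p' by rewrite -invr_gt0.
have p'1 : 1 <= p' by rewrite -(invrK p') invf_ge1 //; lra.
set N1 := dyadic_norm p q K1 _; set N2 := dyadic_norm q p K2 _.
have N10 : 0 <= N1 by exact: dyadic_norm_ge0.
have N20 : 0 <= N2 by exact: dyadic_norm_ge0.
suff h : dyadic_norm p q K x <= 6 `^ q * (N1 + N2 `^ (p^-1 * q)).
  have qV : 0 <= q^-1 <= 1 by rewrite invr_ge0 (ltW q0) invf_le1//; lra.
  apply: le_trans (_ : (6 `^ q * (N1 + N2 `^ (p^-1 * q))) `^ q^-1 <= _).
    by apply: le_powR2r => //; [have /andP[] := qV|exact: dyadic_norm_ge0].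
  rewrite powRM ?powR_ge0 ?addr_ge0 ?powR_ge0// powRK ?gt_eqF//.
  apply: ler_wpM2l => //; apply: le_trans (powR_subadd qV N10 (powR_ge0 _ _)) _.
  by rewrite lerD2l powRrM powRK ?powR_ge0 ?gt_eqF.
apply: bigmax_le => [|s adm].
  by rewrite mulr_ge0 ?powR_ge0// addr_ge0 ?powR_ge0.
pose t j := level_coef p (s j).
have t1 : \sum_j `|3^-1 * t j| `^ p' <= 1.
  under eq_bigr => j _ do rewrite normrM (powRM _ (normr_ge0 _) (normr_ge0 _)) (level_coef_mass (s j) p2 pp').
  rewrite -mulr_sumr ger0_norm ?invr_ge0// powR_invl//.
  rewrite mulrC ler_pdivrMr ?powR_gt0// mul1r; apply: (le_trans adm).
  by rewrite -[leLHS]powRr1//; apply: ler_powR => //; lra.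
have -> : (fun j => level_coef p (s j)) = (fun j => 3 * (3^-1 * t j)).
  by apply/funext => j; rewrite mulrA divff ?mul1r.
rewrite row_power_scale// (_ : 6 `^ q = 3 `^ q * 2 `^ q); last first.
  by rewrite -powRM//; congr (_ `^ _); lra.
rewrite -mulrA; apply: ler_wpM2l; first exact: powR_ge0.
have q1 : 1 <= q by lra.
apply: le_trans (row_power_split _ _ q1) _.
apply: ler_wpM2l; first exact: powR_ge0.
apply: lerD.
  apply: (@le_dyadic_norm _ _ _ p p' q K1) => //.
  rewrite (sum_subtype (fun j => `|3^-1 * t j| `^ p')); apply: le_trans t1.
  rewrite [leRHS](bigID H)/= lerDl; apply: sumr_ge0 => j _; exact: powR_ge0.
by apply: (@row_power_dual _ _ _ p p' q K2) => //; lra.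
Qed.

End SplitColumns.

Arguments kept_columns {R I J} H x i j.


(** The number of levels will be taken equal to the number [k] of columns. This is crude, but only
    the logarithm of the left side matters. *)
Lemma dyadic_card (R : realType) (k : nat) :
  (2 * k.+1)%:R * k%:R <= 4 * k%:R ^+ 2 :> R.
Proof.
rewrite -natrM -natrX -natrM ler_nat; case: k => [|k]; first by rewrite muln0.
have h : (2 * k.+2 <= 4 * k.+1)%N by lia.
by rewrite expnS expn1 mulnA; apply: leq_mul.
Qed.

(** * Heavy and light columns *)

Section GaussianOperator.
Context {R : realType} {I J : finType} (p p' q : R).
Hypotheses (p2 : 2 <= p) (q2 : 2 <= q) (pp' : p^-1 + p'^-1 = 1).
Context d (T : measurableType d) (P : probability T R).
Variables (G : I * J -> {RV P >-> R}) (a : I -> J -> R) (c r sg : R).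
Hypothesis indG : mutually_independent P (fun e => G e : T -> R).
Hypothesis gG : forall e, std_gaussian (G e).
Hypotheses (I2 : (2 <= #|I|)%N) (r0 : 0 < r) (sg0 : 0 < sg) (c0 : 0 <= c).
Hypothesis rowa : forall i, \sum_j `|a i j| `^ p <= r `^ p.
Hypothesis cola : forall j, \sum_i `|a i j| `^ q <= c `^ q.
Hypothesis enta : forall i j, `|a i j| <= sg.

Let m : R := #|I|%:R.
Let L : R := ln m.
Let p0 : 0 < p. Proof. by have P2 := p2; lra. Qed.
Let q0 : 0 < q. Proof. by have Q2 := q2; lra. Qed.
Let m2 : 2 <= m. Proof. by rewrite /m ler_nat. Qed.
Let m0 : 0 < m. Proof. by have M2 := m2; lra. Qed.

Let L2 : 2^-1 <= L.
Proof. exact: ln_ge_half. Qed.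

Let expRL s : expR (s * L) = m `^ s.
Proof. by rewrite /powR gt_eqF. Qed.

Let Lm : L <= m.
Proof. by have := expR_ge1Dx L; rewrite lnK ?posrE//; lra. Qed.

(* The exponent is such that a column that is not heavy has norm O(r / m). *)
Let heavy : pred J := fun j => [exists i, r `^ p <= `|a i j| `^ p * m `^ (4 * p + 1)].

Let mpS s : m * m `^ s = m `^ (s + 1).
Proof. by rewrite -[X in X * _](powRr1 (ltW m0)) -powRD_gt0// addrC. Qed.

(** By its l_p norm a row has at most [m ^ (4 * p + 1)] large entries, and there are [m] rows. *)
Let card_heavy : #|{: {j | heavy j}}|%:R <= m `^ (4 * p + 2).
Proof.
have rp : 0 < r `^ p by rewrite powR_gt0.
rewrite -(ler_pM2r rp).
have -> : #|{: {j | heavy j}}|%:R * r `^ p = \sum_(j : {j | heavy j}) r `^ p.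
  by rewrite sumr_const mulr_natl.
apply: (@le_trans _ _ (\sum_(j : {j | heavy j}) \sum_i `|a i (val j)| `^ p * m `^ (4 * p + 1))).
  apply: ler_sum => j _; have /existsP[i hi] := valP j; apply: (le_trans hi).
  rewrite (bigD1 i)//= lerDl; apply: sumr_ge0 => i' _; exact: mulr_ge0 (powR_ge0 _ _) (powR_ge0 _ _).
rewrite (sum_subtype heavy (fun j => \sum_i `|a i j| `^ p * m `^ (4 * p + 1))).
apply: (@le_trans _ _ (\sum_j \sum_i `|a i j| `^ p * m `^ (4 * p + 1))).
  rewrite [leRHS](bigID heavy)/= lerDl; apply: sumr_ge0 => j _.
  by apply: sumr_ge0 => i _; rewrite mulr_ge0 ?powR_ge0.
rewrite exchange_big/=.
apply: (@le_trans _ _ (\sum_(i : I) r `^ p * m `^ (4 * p + 1))).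
  by apply: ler_sum => i _; rewrite -mulr_suml; apply: ler_wpM2r; rewrite ?powR_ge0.
rewrite sumr_const -[_ *+ _]mulr_natl -/m mulrCA mpS mulrC.
by rewrite (_ : 4 * p + 1 + 1 = 4 * p + 2)//; lra.
Qed.

(** The exponent [2 + 2 * (4 * p + 2)] of [m] in the bound for [4 * k ^ 2], with [4 <= m ^ 2] and
    [k] the number of heavy columns. *)
Definition heavy_rate : R := 8 * p + 6.

Let hR1 : 1 <= heavy_rate * L.
Proof.
have P2 := p2; have l2 := L2; rewrite /heavy_rate.
apply: le_trans (_ : (8 * p + 6) * 2^-1 <= _); first lra.
by apply: ler_wpM2l => //; lra.
Qed.

Let mD s t : m `^ (s + t) = m `^ s * m `^ t.
Proof. exact: powRD_gt0. Qed.

Let four_le : 4 <= m `^ 2.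
Proof.
rewrite powR_mulrn ?(ltW m0)// (_ : 4 = 2 ^+ 2 :> R); last by rewrite expr2; lra.
by rewrite ler_sqr ?nnegrE ?(ltW m0).
Qed.

Let card_heavy_exp :
  (2 * #|{: {j | heavy j}}|.+1)%:R * #|{: {j | heavy j}}|%:R <= expR (heavy_rate * L) :> R.
Proof.
apply: (le_trans (dyadic_card _ _)).
rewrite expRL /heavy_rate.
have -> : 8 * p + 6 = 2 + ((4 * p + 2) + (4 * p + 2)) by ring.
rewrite (mD 2); apply: ler_pM => //.
by rewrite (mD (4 * p + 2)) expr2; apply: ler_pM.
Qed.

Let card_heavy_exp1 : #|{: {j | heavy j}}|%:R <= expR (heavy_rate * L).
Proof.
apply: (le_trans card_heavy); rewrite expRL; apply: ler_powR; first by have M2 := m2; lra.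
by have P2 := p2; rewrite /heavy_rate; lra.
Qed.

Let card_light_exp : (2 * #|I|.+1)%:R * #|I|%:R <= expR (4 * L) :> R.
Proof.
apply: (le_trans (dyadic_card _ _)); rewrite expRL.
have -> : m `^ 4 = m `^ 2 * m `^ 2 by rewrite -mD; congr (_ `^ _); lra.
apply: ler_pM => //.
by rewrite -/m powR_mulrn ?(ltW m0).
Qed.

Let card_I_exp : #|I|%:R <= expR (2 * L).
Proof.
by rewrite expRL -/m -[leLHS](powRr1 (ltW m0)); apply: ler_powR; have M2 := m2; lra.
Qed.

Let mG e : measurable_fun [set: T] (G e : T -> R).
Proof. exact: measurable_funPT. Qed.

Let x w i j := a i j * G (i, j) w.

(** The maximal column norm runs over the heavy columns only, so its logarithmic cost is
    [heavy_rate * L], whatever the size of [J]. *)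
Let heavy_norm_le (K : nat) : K = #|{: {j | heavy j}}| ->
  (\int[P]_w ((dyadic_norm p q K (kept_columns heavy (x w))) `^ q^-1)%:E <=
   (average_cst q * (max_norm_cst q * (c + heavy_rate * L * sg) +
      (heavy_rate * L) `^ q^-1 * (max_norm_cst p * (r + 2 * L * sg) + r)))%:E)%E.
Proof.
move=> KE.
have indH : mutually_independent P
    (fun e : I * {j | heavy j} => G (e.1, val e.2) : T -> R).
  apply: (mutually_independent_inj (G := fun e => G e : T -> R)) => //.
  by move=> [i j] [i' j'] /= [-> /val_inj ->].
apply: le_trans (gaussian_dyadic_norm_le (G := fun e => G (e.1, val e.2)) p2 q2 (kept_columns heavy a) indH _ r0 hR1 (K := K) _) _.
- by move=> e; exact: gG.
- by rewrite KE; exact: card_heavy_exp.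
have A1 := average_cst_ge1 q2.
have mx i (j : {j | heavy j}) : measurable_fun [set: T]
   (fun w => kept_columns heavy a i j * G (i, val j) w).
  exact: measurable_funM.
apply: integral_scale_le.
- apply: measurable_funD; first exact: measurable_max_row_norm.
  apply: measurable_funM; first exact: measurable_cst.
  by apply: measurable_funD; [exact: measurable_max_row_norm|exact: measurable_cst].
- move=> w; rewrite addr_ge0 ?mulr_ge0 ?addr_ge0 ?powR_ge0 ?max_row_norm_ge0//; exact: ltW.
- lra.
apply: integral_add_le.
- exact: measurable_max_row_norm.
- apply: measurable_funM; first exact: measurable_cst.
  by apply: measurable_funD; [exact: measurable_max_row_norm|exact: measurable_cst].
- by move=> w; exact: max_row_norm_ge0.
- by move=> w; rewrite mulr_ge0 ?addr_ge0 ?powR_ge0 ?max_row_norm_ge0//; exact: ltW.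
- apply: (max_norm q2 (iota := fun (j : {j | heavy j}) i => (i, val j))) => //.
  + by move=> j i i' [].
  + by move=> j; exact: cola.
  + by move=> j i; exact: enta.
apply: integral_scale_le.
- by apply: measurable_funD; [exact: measurable_max_row_norm|exact: measurable_cst].
- by move=> w; rewrite addr_ge0 ?max_row_norm_ge0//; exact: ltW.
- exact: powR_ge0.
apply: integral_add_le.
- exact: measurable_max_row_norm.
- exact: measurable_cst.
- by move=> w; exact: max_row_norm_ge0.
- by move=> w; exact: ltW.
- apply: (max_norm p2 (iota := fun i (j : {j | heavy j}) => (i, val j))) => //.
  + by move=> i j j' [] /val_inj.
  + exact: ltW.
  + by have l2 := L2; lra.
  + move=> i; rewrite (sum_subtype heavy (fun j => `|a i j| `^ p)).
    apply: le_trans (rowa i); rewrite [leRHS](bigID heavy)/= lerDl.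
    by apply: sumr_ge0 => j _; exact: powR_ge0.
  + by move=> i j; exact: enta.
by rewrite integral_cst_real.
Qed.

Let light_entry i j : `|killed_columns heavy a i j| `^ p <=
  r `^ p * (m^-1 * m^-1 `^ (4 * p)).
Proof.
have k0 : 0 <= r `^ p * (m^-1 * m^-1 `^ (4 * p)).
  by rewrite mulr_ge0 ?powR_ge0// mulr_ge0 ?powR_ge0// invr_ge0 ltW.
rewrite /killed_columns; case: ifPn => [_|].
  by rewrite normr0 powR0// gt_eqF.
rewrite negb_exists => /forallP/(_ i); rewrite -ltNge => h.
have mb : 0 < m `^ (4 * p + 1) by rewrite powR_gt0.
rewrite (powR_invl _ (ltW m0)) -invfM mpS ler_pdivlMr//; exact: ltW.
Qed.

Let light_cst : R := pow_exp_cst (2 * p) * gauss_exp_cst R.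

Let light_cst_ge0 : 0 <= light_cst.
Proof. by rewrite mulr_ge0 ?powR_ge0 ?gauss_exp_cst_ge0. Qed.

Let y w i j := killed_columns heavy a i j * G (i, j) w.

Let my i j : measurable_fun [set: T] (fun w => y w i j).
Proof. exact: measurable_funM. Qed.

(* The moment of order [2 p] is used only to have an exponent larger than [p]. *)
Let light_norm_le :
  (\int[P]_w (max_row_norm q (fun j i => y w i j))%:E <= (r / m * (1 + light_cst))%:E)%E.
Proof.
have p20 : 0 < 2 * p by rewrite mulr_gt0.
have Q2 := q2; have P2 := p2; have M2 := m2.
pose S w := \sum_i \sum_j `|y w i j| `^ (2 * p).
have S0 w : 0 <= S w by apply: sumr_ge0 => i _; apply: sumr_ge0 => j _; exact: powR_ge0.
have mS : measurable_fun [set: T] S.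
  apply: measurable_sum => i; apply: measurable_sum => j.
  exact/measurable_powR_fun/measurable_normr_fun.
(* The moments of order [2 * p] of the light entries sum to at most a constant times [th ^ (2 * p)]:
   of the two factors [|a| ^ p], one is at most [r ^ p * m ^ (- 1 - 4 * p)] and the other sums to
   [r ^ p] in each of [m] rows. *)
pose th := r * (m^-1 * m^-1).
have mV : 0 < m^-1 by rewrite invr_gt0.
have th0 : 0 < th by rewrite !mulr_gt0.
have pV : 0 <= (2 * p)^-1 <= 1 by rewrite invr_ge0 (ltW p20) invf_le1//; lra.
(* A column norm is at most [m] times the largest entry, which is at most [S w] to the power
   [1 / (2 * p)]. *)
have norm_le w : max_row_norm q (fun j i => y w i j) <=
    m * th * (1 + (th `^ (2 * p))^-1 * S w).
  have t1 : (S w) `^ (2 * p)^-1 <= th * (1 + (th `^ (2 * p))^-1 * S w).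
    have -> : (th `^ (2 * p))^-1 * S w = S w / th `^ (2 * p) by rewrite mulrC.
    have := powR_le_affine pV (powR_gt0 (2 * p) th0) (S0 w).
    by rewrite powRK ?(ltW th0) ?gt_eqF.
  have t0 : 0 <= 1 + (th `^ (2 * p))^-1 * S w.
    by rewrite addr_ge0// mulr_ge0 ?invr_ge0 ?powR_ge0.
  apply: bigmax_le => [|j _]; first exact: mulr_ge0 (mulr_ge0 (ltW m0) (ltW th0)) t0.
  rewrite -mulrA; apply: le_trans (_ : m * (S w) `^ (2 * p)^-1 <= _); last first.
    by apply: ler_wpM2l => //; exact: ltW.
  have mS0 : 0 <= m * (S w) `^ (2 * p)^-1 by rewrite mulr_ge0 ?powR_ge0 ?(ltW m0).
  rewrite -[leRHS](@powRK _ q) ?gt_eqF//.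
  apply: le_powR2r; first by rewrite invr_ge0 ltW.
    by apply: sumr_ge0 => i _; exact: powR_ge0.
  rewrite powRM ?powR_ge0 ?(ltW m0)//.
  apply: (@le_trans _ _ (\sum_(i : I) ((S w) `^ (2 * p)^-1) `^ q)).
    apply: ler_sum => i _; apply: le_powR2r => //; first exact: ltW.
    rewrite -[leLHS](@powRK _ (2 * p)) ?gt_eqF//.
    apply: le_powR2r; [by have /andP[] := pV|exact: powR_ge0|].
    rewrite /S (bigD1 i)//= (bigD1 j)//= -addrA lerDl addr_ge0//.
      by apply: sumr_ge0 => j' _; exact: powR_ge0.
    by apply: sumr_ge0 => i' _; apply: sumr_ge0 => j' _; exact: powR_ge0.
  rewrite sumr_const -[_ *+ _]mulr_natl -/m; apply: ler_wpM2r; first exact: powR_ge0.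
  rewrite -[leLHS](powRr1 (ltW m0)); apply: ler_powR; lra.
have intS : (\int[P]_w (S w)%:E <= (light_cst * th `^ (2 * p))%:E)%E.
  apply: le_trans (integral_sum_le (c := fun i =>
      \sum_j `|killed_columns heavy a i j| `^ (2 * p) * light_cst) _ _ _ _) _.
  - move=> i; apply: measurable_sum => j.
    exact/measurable_powR_fun/measurable_normr_fun.
  - by move=> i w; apply: sumr_ge0 => j _; exact: powR_ge0.
  - move=> i; apply: integral_sum_le.
    + by move=> j; exact/measurable_powR_fun/measurable_normr_fun.
    + by move=> j w; exact: powR_ge0.
    move=> j; under eq_integral do rewrite /y normrM (powRM _ (normr_ge0 _) (normr_ge0 _)).
    apply: integral_scale_le.
    + exact/measurable_powR_fun/measurable_normr_fun.
    + by move=> w; exact: powR_ge0.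
    + exact: powR_ge0.
    + exact: gaussian_moment.
  rewrite lee_fin.
  under eq_bigr do rewrite -mulr_suml.
  rewrite -mulr_suml mulrC; apply: ler_wpM2l; first exact: light_cst_ge0.
  have e0 : 0 <= r `^ p * (m^-1 * m^-1 `^ (4 * p)).
    by rewrite mulr_ge0 ?powR_ge0// mulr_ge0 ?powR_ge0// ltW.
  apply: (@le_trans _ _ (\sum_(i : I) r `^ p * (m^-1 * m^-1 `^ (4 * p)) * r `^ p)).
    apply: ler_sum => i _; apply: (@le_trans _ _ (\sum_j r `^ p * (m^-1 * m^-1 `^ (4 * p)) * `|a i j| `^ p)).
      apply: ler_sum => j _; rewrite (_ : 2 * p = p + p); last by ring.
      have [z|zN] := eqVneq (killed_columns heavy a i j) 0.
        have ppN : p + p != 0 by rewrite gt_eqF ?addr_gt0.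
        by rewrite z normr0 powR0//; exact: (mulr_ge0 e0 (powR_ge0 _ _)).
      rewrite powRD_gt0 ?normr_gt0//; apply: ler_pM; rewrite ?powR_ge0//.
      apply: le_powR2r => //; first exact: ltW.
      by rewrite /killed_columns; case: ifP => // _; rewrite normr0.
    by rewrite -mulr_sumr; apply: ler_wpM2l.
  rewrite sumr_const -[_ *+ _]mulr_natl -/m /th powRM ?(ltW r0)//; last first.
    by rewrite mulr_ge0 ?(ltW mV).
  have -> : r `^ (2 * p) = r `^ p * r `^ p by rewrite -powRD_gt0//; congr (_ `^ _); ring.
  have -> : (m^-1 * m^-1) `^ (2 * p) = m^-1 `^ (4 * p).
    rewrite (_ : 4 * p = 2 * p + 2 * p); last by ring.
    by rewrite powRM ?(ltW mV)// powRD_gt0.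
  rewrite le_eqVlt; apply/orP; left; apply/eqP.
  by field; rewrite gt_eqF.
have mth : 0 <= m * th := mulr_ge0 (ltW m0) (ltW th0).
have tp : 0 < th `^ (2 * p) by rewrite powR_gt0.
have tp0 : 0 <= (th `^ (2 * p))^-1 by rewrite invr_ge0 ltW.
apply: (integral_le _ norm_le) => [w|]; first exact: max_row_norm_ge0.
have -> : r / m * (1 + light_cst) =
    m * th * (1 + (th `^ (2 * p))^-1 * (light_cst * th `^ (2 * p))).
  by rewrite /th; field; rewrite !gt_eqF.
apply: integral_scale_le => //.
- by apply: measurable_funD => //; exact: measurable_funM.
- by move=> w; apply: addr_ge0 => //; apply: mulr_ge0.
apply: integral_add_le.
- exact: measurable_cst.
- exact: measurable_funM.
- by [].
- by move=> w; apply: mulr_ge0.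
- by rewrite integral_cst_real.
- exact: integral_scale_le.
Qed.

(** For the transposed matrix the exponents change places, and the light columns become the rows.
    The factor [(4 * L) ^ (1 / p) <= 4 * m] in front of them is harmless because their norm is of
    order [r / m]. *)
Let light_dyadic_le (K : nat) : K = #|I| ->
  (\int[P]_w ((dyadic_norm q p K (fun j i => y w i j)) `^ p^-1)%:E <=
   (average_cst p * (max_norm_cst p * (r + 2 * L * sg) + 4 * (2 + light_cst) * r))%:E)%E.
Proof.
move=> KE; have l2 := L2; have P2 := p2; have lm := Lm.
have indT : mutually_independent P (fun e : J * I => G (e.2, e.1) : T -> R).
  apply: (mutually_independent_inj (G := fun e => G e : T -> R)) => //.
  by move=> [i j] [i' j'] /= [-> ->].
have de0 : 0 < r / m by rewrite divr_gt0.
have Lam1 : 1 <= 4 * L by lra.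
apply: le_trans (gaussian_dyadic_norm_le (G := fun e => G (e.2, e.1))
  q2 p2 (fun j i => killed_columns heavy a i j) indT _ de0 Lam1 (K := K) _) _.
- by move=> e; exact: gG.
- by rewrite KE; exact: card_light_exp.
have A1 := average_cst_ge1 p2.
have my1 j i : measurable_fun [set: T]
   (fun w => killed_columns heavy a i j * G (i, j) w) by exact: my.
have my2 i j : measurable_fun [set: T]
   (fun w => killed_columns heavy a i j * G (i, j) w) by exact: my.
have Lp : (4 * L) `^ p^-1 <= 4 * m.
  apply: (@le_trans _ _ (4 * L)); last by lra.
  rewrite -[leRHS]powRr1; last by lra.
  by apply: ler_powR => //; rewrite invf_le1//; lra.
apply: integral_scale_le.
- apply: measurable_funD; first exact: measurable_max_row_norm.
  apply: measurable_funM; first exact: measurable_cst.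
  by apply: measurable_funD; [exact: measurable_max_row_norm|exact: measurable_cst].
- move=> w; apply: addr_ge0; first exact: max_row_norm_ge0.
  apply: mulr_ge0; first exact: powR_ge0.
  by apply: addr_ge0; [exact: max_row_norm_ge0|exact: ltW].
- lra.
apply: integral_add_le.
- exact: measurable_max_row_norm.
- apply: measurable_funM; first exact: measurable_cst.
  by apply: measurable_funD; [exact: measurable_max_row_norm|exact: measurable_cst].
- by move=> w; exact: max_row_norm_ge0.
- move=> w; apply: mulr_ge0; first exact: powR_ge0.
  by apply: addr_ge0; [exact: max_row_norm_ge0|exact: ltW].
- apply: (max_norm p2 (iota := fun i j => (i, j))) => //.
  + by move=> i j j' [].
  + exact: ltW.
  + by lra.
  + move=> i; apply: le_trans (rowa i); apply: ler_sum => j _.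
    apply: le_powR2r => //; first exact: ltW.
    by rewrite /killed_columns; case: ifP => // _; rewrite normr0.
  + move=> i j; rewrite /killed_columns; case: ifP => // _; rewrite normr0; exact: ltW.
have lc := light_cst_ge0.
apply: (@le_trans _ _ ((4 * L) `^ p^-1 * (r / m * (1 + light_cst) + r / m))%:E).
  apply: integral_scale_le.
  - by apply: measurable_funD; [exact: measurable_max_row_norm|exact: measurable_cst].
  - by move=> w; apply: addr_ge0; [exact: max_row_norm_ge0|exact: ltW].
  - exact: powR_ge0.
  apply: integral_add_le.
  - exact: measurable_max_row_norm.
  - exact: measurable_cst.
  - by move=> w; exact: max_row_norm_ge0.
  - by move=> w; exact: ltW.
  - exact: light_norm_le.
  - by rewrite integral_cst_real.
rewrite lee_fin.
have -> : 4 * (2 + light_cst) * r = 4 * m * (r / m * (1 + light_cst) + r / m).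
  by field; rewrite gt_eqF.
apply: ler_wpM2r => //.
have l1 : 0 <= 1 + light_cst by lra.
by rewrite addr_ge0 ?(ltW de0)// mulr_ge0 ?(ltW de0).
Qed.

Definition gaussian_cst : R :=
  6 * (average_cst q * max_norm_cst q +
       (average_cst q * heavy_rate * (max_norm_cst p + 1) +
        2 * average_cst p * (max_norm_cst p + 4 * (2 + light_cst))) +
       (2 * average_cst q * heavy_rate * (max_norm_cst q + max_norm_cst p) +
        4 * average_cst p * max_norm_cst p)).

Lemma gaussian_dyadic_norm (K : nat) :
  (\int[P]_w ((dyadic_norm p q K (x w)) `^ q^-1)%:E <=
   (gaussian_cst * (c + L `^ q^-1 * r + L `^ (1 + q^-1) * sg))%:E)%E.
Proof.
have P2 := p2; have Q2 := q2; have l2 := L2; have lc := light_cst_ge0.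
have := heavy_norm_le (erefl _); set Kh := #|_| => hh.
have hl := light_dyadic_le (erefl _).
have Kh2 : (Kh <= 2 ^ Kh)%N by rewrite ltnW// ltn_expl.
have I2e : (#|I| <= 2 ^ #|I|)%N by rewrite ltnW// ltn_expl.
have mx w i j : measurable_fun [set: T] (fun w => x w i j) by exact: measurable_funM.
have split_le w : (dyadic_norm p q K (x w)) `^ q^-1 <=
   6 * ((dyadic_norm p q Kh (kept_columns heavy (x w))) `^ q^-1 +
        (dyadic_norm q p #|I| (fun j i => y w i j)) `^ p^-1).
  have := dyadic_norm_split K (x w) p2 q2 pp' Kh2 I2e.
  rewrite (_ : (fun (j : J) (i : I) => killed_columns heavy (x w) i j) = fun j i => y w i j)//.
  apply/funext => j; apply/funext => i; rewrite /y /killed_columns.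
  by case: ifP => // _; rewrite mul0r.
apply: (integral_le _ split_le) => [w|]; first exact: powR_ge0.
pose f1 w := (dyadic_norm p q Kh (kept_columns heavy (x w))) `^ q^-1.
pose f2 w := (dyadic_norm q p #|I| (fun j i => y w i j)) `^ p^-1.
have mf1 : measurable_fun [set: T] f1.
  apply: measurable_powR_fun; apply: measurable_dyadic_norm => i j.
  exact: measurable_funM.
have mf2 : measurable_fun [set: T] f2.
  by apply: measurable_powR_fun; apply: measurable_dyadic_norm.
have f10 w : 0 <= f1 w by exact: powR_ge0.
have f20 w : 0 <= f2 w by exact: powR_ge0.
have f0 w : 0 <= f1 w + f2 w by rewrite addr_ge0.
apply: le_trans (integral_scale_le (measurable_funD mf1 mf2) f0 (ler0n _ 6)
  (integral_add_le mf1 mf2 f10 f20 hh hl)) _.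
rewrite lee_fin.
have qV : q^-1 <= 1 by rewrite invf_le1//; lra.
have qV0 : 0 <= q^-1 by rewrite invr_ge0 ltW.
have L0 : 0 < L by lra.
pose ell := L `^ q^-1.
(* As [L] may be less than 1, [r] and [L * sg] are dominated by [ell * r] and [L * ell * sg] only up
   to a factor 2. *)
have ell2 : 2^-1 <= ell.
  apply: (@le_trans _ _ (2^-1 `^ q^-1)); last by apply: le_powR2r.
  rewrite -[leLHS]powRr1 //; apply: ger_powR => //; lra.
have hell : (heavy_rate * L) `^ q^-1 <= heavy_rate * ell.
  have h1 : 1 <= heavy_rate by rewrite /heavy_rate; lra.
  have h0 : 0 <= heavy_rate by lra.
  rewrite powRM ?(ltW L0)//; apply: ler_wpM2r; first exact: powR_ge0.
  by rewrite -[leRHS]powRr1//; apply: ler_powR.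
have h0 : 0 <= heavy_rate by rewrite /heavy_rate; lra.
have -> : L `^ (1 + q^-1) = L * ell by rewrite powRD_gt0// powRr1// ltW.
rewrite -/ell /gaussian_cst.
have Aq : 0 <= average_cst q := le_trans ler01 (average_cst_ge1 q2).
have Ap : 0 <= average_cst p := le_trans ler01 (average_cst_ge1 p2).
have Mp := max_norm_cst_ge0 p; have Mq := max_norm_cst_ge0 q.
rewrite -(mulrA 6); apply: ler_wpM2l => //.
move: hell; move: (heavy_rate) h0 => h h0 hell.
move: (max_norm_cst p) (max_norm_cst q) (average_cst p) (average_cst q) Mp Mq Ap Aq.
move=> Mp Mq Ap Aq Mp0 Mq0 Ap0 Aq0.
pose u := c; pose v := ell * r; pose z := L * ell * sg.
have v0 : 0 <= v by rewrite mulr_ge0 ?(ltW r0)//; lra.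
have Lsg : 0 < L * sg by rewrite mulr_gt0.
have z0 : 0 <= z by rewrite /z mulrAC; apply: mulr_ge0; [exact: ltW|lra].
have rv : r <= 2 * v.
  by rewrite /v mulrA ler_peMl ?(ltW r0)//; lra.
have Lz : L * sg <= 2 * z.
  by rewrite /z mulrAC mulrCA ler_peMr ?(ltW Lsg)//; lra.
pose k1 := Aq * Mq; pose k2 := Aq * h * (Mp + 1) + 2 * Ap * (Mp + 4 * (2 + light_cst)).
pose k3 := 2 * Aq * h * (Mq + Mp) + 4 * Ap * Mp.
have k10 : 0 <= k1 by exact: mulr_ge0.
have k20 : 0 <= k2.
  apply: addr_ge0; apply: mulr_ge0; [exact: mulr_ge0|lra|exact: mulr_ge0|lra].
have k30 : 0 <= k3.
  by apply: addr_ge0; apply: mulr_ge0 => //; rewrite ?mulr_ge0// addr_ge0.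
apply: (@le_trans _ _ (k1 * u + k2 * v + k3 * z)); last first.
  rewrite [leRHS](_ : _ = (k1 + k2 + k3) * (u + v + z)); last by rewrite /k1 /k2 /k3 /u /v /z; ring.
  have := mulr_ge0 k10 v0; have := mulr_ge0 k10 z0; have := mulr_ge0 k20 z0.
  have := mulr_ge0 k20 c0; have := mulr_ge0 k30 v0; have := mulr_ge0 k30 c0.
  rewrite /u; lra.
have X0 : 0 <= Mp * (r + 2 * L * sg) + r.
  rewrite addr_ge0 ?(ltW r0)// mulr_ge0// addr_ge0 ?(ltW r0)// -mulrA; lra.
have s1 : Aq * (Mq * (h * (L * sg))) <= Aq * (Mq * (h * (2 * z))).
  by do 3 (apply: ler_wpM2l => //).
have s2 : Aq * (((h * L) `^ q^-1) * (Mp * (r + 2 * L * sg) + r)) <=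
    Aq * ((h * ell) * (Mp * (r + 2 * L * sg) + r)).
  by apply: ler_wpM2l => //; exact: ler_wpM2r.
have s3 : Ap * (Mp * r) <= Ap * (Mp * (2 * v)) by do 2 (apply: ler_wpM2l => //).
have s4 : Ap * (Mp * (L * sg)) <= Ap * (Mp * (2 * z)) by do 2 (apply: ler_wpM2l => //).
have s5 : Ap * ((2 + light_cst) * r) <= Ap * ((2 + light_cst) * (2 * v)).
  by apply: ler_wpM2l => //; apply: ler_wpM2l => //; lra.
have -> : k1 * u + k2 * v + k3 * z = Aq * (Mq * c) + Aq * (Mq * (h * (2 * z))) +
   Aq * ((h * ell) * (Mp * (r + 2 * L * sg) + r)) + (Ap * (Mp * (2 * v)) +
   2 * (Ap * (Mp * (2 * z))) + 4 * (Ap * ((2 + light_cst) * (2 * v)))).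
  by rewrite /k1 /k2 /k3 /u /v /z; ring.
rewrite [leLHS](_ : _ = Aq * (Mq * c) + Aq * (Mq * (h * (L * sg))) +
   Aq * (((h * L) `^ q^-1) * (Mp * (r + 2 * L * sg) + r)) + (Ap * (Mp * r) +
   2 * (Ap * (Mp * (L * sg))) + 4 * (Ap * ((2 + light_cst) * r)))); last by ring.
lra.
Qed.

End GaussianOperator.

(** * Log-concave vectors *)


Section Boxes.
Context {R : realType} {k : nat}.
Implicit Types lo hi : 'I_k -> R.

(** Boxes are compact, as [log_concave] demands, and a Minkowski combination of two of them is again
    a box, computed coordinatewise. *)
Definition box lo hi : set 'rV[R]_k :=
  [set x | forall i, lo i <= x ord0 i <= hi i].

Lemma box_compact lo hi : compact (box lo hi).
Proof.
have -> : box lo hi = [set v | forall i, `[lo i, hi i]%classic (v ord0 i)].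
  by apply/seteqP; split=> x /= h i; have := h i; rewrite /= in_itv.
apply: (@rV_compact R k (fun i => `[lo i, hi i]%classic)) => i.
exact: segment_compact.
Qed.

Lemma box_nonempty lo hi : (forall i, lo i <= hi i) -> box lo hi !=set0.
Proof. by move=> lh; exists (\row_i lo i) => i; rewrite mxE lexx lh. Qed.

Lemma segment_combination (lam a b c d z : R) : 0 <= lam <= 1 -> a <= b -> c <= d ->
  lam * a + (1 - lam) * c <= z <= lam * b + (1 - lam) * d ->
  exists x y, [/\ a <= x <= b, c <= y <= d & lam * x + (1 - lam) * y = z].
Proof.
move=> /andP[l0 l1] ab cd /andP[z0 z1].
set u := lam * a + (1 - lam) * c in z0.
set v := lam * b + (1 - lam) * d in z1.
have [uv|uv] := eqVneq u v.
  by exists a, c; rewrite !lexx ab cd; split=> //; rewrite -/u; lra.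
have uv' : 0 < v - u by rewrite subr_gt0 lt_neqAle uv; lra.
pose t := (z - u) / (v - u).
have t0 : 0 <= t by rewrite divr_ge0 ?(ltW uv') ?subr_ge0.
have t1 : t <= 1 by rewrite ler_pdivrMr// mul1r; lra.
have tz : t * (v - u) = z - u by rewrite mulfVK ?gt_eqF.
exists (a + t * (b - a)), (c + t * (d - c)).
have h1 : 0 <= t * (b - a) by rewrite mulr_ge0 ?subr_ge0.
have h2 : t * (b - a) <= b - a by rewrite ler_piMl ?subr_ge0.
have h3 : 0 <= t * (d - c) by rewrite mulr_ge0 ?subr_ge0.
have h4 : t * (d - c) <= d - c by rewrite ler_piMl ?subr_ge0.
split; [lra|lra|].
have -> : z = u + t * (v - u) by rewrite tz; lra.
by rewrite /u /v; ring.
Qed.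

Lemma box_combination (lam : R) lo1 hi1 lo2 hi2 : 0 <= lam <= 1 ->
  (forall i, lo1 i <= hi1 i) -> (forall i, lo2 i <= hi2 i) ->
  [set lam *: x + (1 - lam) *: y | x in box lo1 hi1 & y in box lo2 hi2] =
  box (fun i => lam * lo1 i + (1 - lam) * lo2 i)
      (fun i => lam * hi1 i + (1 - lam) * hi2 i).
Proof.
move=> l01 h1 h2; have /andP[l0 l1] := l01; have l1' : 0 <= 1 - lam by rewrite subr_ge0.
apply/seteqP; split=> [_ [x hx [y hy <-]] i|z hz].
  rewrite !mxE; have /andP[x0 x1] := hx i; have /andP[y0 y1] := hy i.
  by rewrite !lerD// ler_wpM2l.
have /boolp.choice[x hx] : forall i, exists xi, exists yi,
    [/\ lo1 i <= xi <= hi1 i, lo2 i <= yi <= hi2 i & lam * xi + (1 - lam) * yi = z ord0 i].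
  by move=> i; exact: segment_combination.
have /boolp.choice[y hxy] := hx.
exists (\row_i x i); first by move=> i; rewrite mxE; have [] := hxy i.
exists (\row_i y i); first by move=> i; rewrite mxE; have [] := hxy i.
by apply/rowP => i; rewrite !mxE; have [] := hxy i.
Qed.

End Boxes.

Section MeasureLimit.
Context d (T : measurableType d) (R : realType) (P : probability T R).

Lemma measurable_superlevel (f : T -> R) (s : R) : measurable_fun [set: T] f ->
  measurable [set w | s <= f w].
Proof.
move=> mf; have := mf measurableT _ (measurable_itv `[s, +oo[).
by rewrite setTI; congr measurable; apply/seteqP; split=> w /=; rewrite in_itv/= andbT.
Qed.

Lemma bigcup_measure_le (F : nat -> set T) (c : R) (N : nat) :
  (forall n, measurable (F n)) -> {homo F : n m / (n <= m)%N >-> (n <= m)%O} ->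
  (forall n, (N <= n)%N -> (P (F n) <= c%:E)%E) ->
  (P (\bigcup_n F n) <= c%:E)%E.
Proof.
move=> mF homF FN.
have mU : measurable (\bigcup_n F n) by exact: bigcup_measurable.
have cv := nondecreasing_cvg_mu mF mU homF (mu := P).
rewrite -(cvg_lim _ cv)//; apply: lime_le; first by apply/cvg_ex; eexists; exact: cv.
by near=> n; apply: FN; near: n; exact: nbhs_infty_ge.
Unshelve. all: by end_near. Qed.

End MeasureLimit.

(** * Exponential tails of log-concave vectors *)

Section LogConcaveTail.
Context d (T : measurableType d) (R : realType) (P : probability T R) (k : nat).
Implicit Types Z : T -> 'rV[R]_k.

(** Provides the lower tail of a coordinate from the upper one. *)
Lemma log_concaveN Z : log_concave P Z -> log_concave P (fun w => - Z w).
Proof.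
move=> lcZ K L lam cK cL K0 L0 lam01.
pose neg (A : set 'rV[R]_k) := [set - x | x in A].
have negE A : (fun w => - Z w) @^-1` A = Z @^-1` neg A.
  apply/seteqP; split=> w /=; first by move=> h; exists (- Z w) => //; rewrite opprK.
  by move=> [x Ax <-]; rewrite opprK.
have cneg A : compact A -> compact (neg A).
  move=> cA; apply: continuous_compact => //; apply: continuous_subspaceT.
  exact: oppr_continuous.
rewrite !negE; apply: le_trans (lcZ (neg K) (neg L) lam _ _ _ _ lam01) _.
- exact: cneg.
- exact: cneg.
- by have [x Kx] := K0; exists (- x), x.
- by have [x Kx] := L0; exists (- x), x.
rewrite le_eqVlt; apply/orP; left; apply/eqP; congr (P (Z @^-1` _)).
apply/seteqP; split=> z /=.
  move=> [_ [x Kx <-] [_ [y Ly <-] <-]]; exists (lam *: x + (1 - lam) *: y).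
    by exists x => //; exists y.
  by rewrite !scalerN opprD.
move=> [_ [x Kx [y Ly <-]] <-].
by exists (- x); [exists x|exists (- y); [exists y|rewrite !scalerN opprD]].
Qed.

Variables (Z : T -> 'rV[R]_k) (l : 'I_k).
Hypothesis mZ : forall i, measurable_fun [set: T] (fun w => Z w ord0 i).
Hypothesis lcZ : log_concave P Z.
Hypothesis varZ : (\int[P]_w ((Z w ord0 l) ^+ 2)%:E <= 1%:E)%E.

Let mbox lo hi : measurable (Z @^-1` box lo hi).
Proof.
have -> : Z @^-1` box lo hi =
    \bigcap_(i in [set: 'I_k]) ((fun w => Z w ord0 i) @^-1` `[lo i, hi i]%classic).
  apply/seteqP; split=> w /= h i; first by move=> _; rewrite /= in_itv; exact: h.
  by have := h i I; rewrite /= in_itv.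
apply: fin_bigcap_measurable; first exact: finite_finset.
by move=> i _; rewrite -[X in measurable X]setTI; exact: mZ.
Qed.

Let mabs (s : R) : measurable [set w | s <= `|Z w ord0 l|].
Proof. exact/measurable_superlevel/measurable_normr_fun. Qed.

Let chebyshev2 : (P [set w | (2 <= `|Z w ord0 l|)%R] <= (4^-1)%:E)%E.
Proof.
rewrite -[X in P X]setIT -integral_indic//.
apply: (integral_le (g := fun w => 4^-1 * (Z w ord0 l) ^+ 2)) => [w|w|].
- by rewrite indicE.
- rewrite indicE; case: (boolP (w \in _)) => [|_].
    rewrite inE /= -real_normK ?num_real// => h.
    have : 2 ^+ 2 <= `|Z w ord0 l| ^+ 2 by rewrite ler_sqr ?nnegrE//; lra.
    rewrite mulr1n; lra.
  by rewrite mulr_ge0 ?sqr_ge0.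
rewrite -[X in (_ <= X%:E)%E]mulr1; apply: integral_scale_le => //.
  exact: measurable_funX.
by move=> w; exact: sqr_ge0.
Qed.

(* Borell's lemma for the slab [|z_l| <= 2], whose probability is at least 3/4:
   with [lam = 4 / (s + 2)], mixing a point with [z_l >= s] and a point of the slab
   gives [z_l >= 2]. *)
Lemma log_concave_tail (s : R) : 2 <= s ->
  (P [set w | (s <= Z w ord0 l)%R] <= (expR (- (s / 8)))%:E)%E.
Proof.
(* The half-space and the slab are not compact, so both are exhausted by boxes of half-width [r n];
   starting from [s] keeps all these boxes nonempty. *)
move=> s2; pose r (n : nat) : R := s + n%:R.
have r0 n : 2 <= r n by apply: (le_trans s2); rewrite lerDl.
have rle n n' : (n <= n')%N -> r n <= r n' by move=> nn; rewrite lerD2l ler_nat.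
pose Klo n i : R := if i == l then s else - r n.
pose Khi n (i : 'I_k) : R := r n.
pose Llo n i : R := if i == l then - 2 else - r n.
pose Lhi n i : R := if i == l then 2 else r n.
pose FK n := Z @^-1` box (Klo n) (Khi n).
pose FL n := Z @^-1` box (Llo n) (Lhi n).
have exr w : exists n, forall i, `|Z w ord0 i| <= r n.
  exists (Num.truncn (\sum_i `|Z w ord0 i|)).+1 => i.
  apply: (@le_trans _ _ (\sum_i `|Z w ord0 i|)).
    by rewrite (bigD1 i)//= lerDl sumr_ge0.
  apply: (@le_trans _ _ (Num.truncn (\sum_i `|Z w ord0 i|)).+1%:R); last first.
    by rewrite /r lerDr; lra.
  exact: ltW (truncnS_gt _).
have homK : {homo FK : n n' / (n <= n')%N >-> (n <= n')%O}.
  move=> n n' nn; apply/subsetPset => w h i; have := h i; have := rle _ _ nn.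
  rewrite /Klo /Khi; case: eqP => _ h1 /andP[h2 h3]; apply/andP; split; lra.
have homL : {homo FL : n n' / (n <= n')%N >-> (n <= n')%O}.
  move=> n n' nn; apply/subsetPset => w h i; have := h i; have := rle _ _ nn.
  rewrite /Llo /Lhi; case: eqP => _ h1 /andP[h2 h3]; apply/andP; split; lra.
have UK : [set w | s <= Z w ord0 l] = \bigcup_n FK n.
  apply/seteqP; split=> w /=; last first.
    by move=> [n _ h]; have := h l; rewrite /Klo eqxx => /andP[].
  move=> sZ; have [n hn] := exr w; exists n => // i.
  have := hn i; rewrite ler_norml => /andP[h1 h2].
  by rewrite /Klo /Khi h2 andbT; case: eqP => [->|].
have UL : [set w | `|Z w ord0 l| < 2] `<=` \bigcup_n FL n.
  move=> w /= Z2; have [n hn] := exr w; exists n => // i.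
  have := hn i; rewrite ler_norml => /andP[h1 h2].
  rewrite /Llo /Lhi; case: eqP => [->|_]; last by rewrite h1.
  by have := ltW Z2; rewrite ler_norml.
have mFK n : measurable (FK n) by exact: mbox.
have mFL n : measurable (FL n) by exact: mbox.
(* The slab has probability at least 3/4 by Chebyshev, so some box inside it has more than 1/2. *)
have [N hN] : exists N, ((2^-1)%:E < P (FL N))%E.
  apply: contrapT => /forallNP hN.
  have hU : (P (\bigcup_n FL n) <= (2^-1)%:E)%E.
    apply: (bigcup_measure_le (N := 0%N) mFL homL) => n _.
    by rewrite leNgt; apply/negP; exact: hN.
  have mU : measurable (\bigcup_n FL n) by exact: bigcup_measurable.
  have : (1 <= (2^-1)%:E + (4^-1)%:E :> \bar R)%E.
    rewrite -(probability_setT P).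
    have -> : [set: T] = (\bigcup_n FL n) `|` [set w | 2 <= `|Z w ord0 l|].
      apply/seteqP; split=> // w _; have [|h] := leP 2 `|Z w ord0 l|; first by right.
      by left; exact: UL.
    apply: le_trans (measureU2 P mU (mabs 2)) _.
    exact: leeD.
  by rewrite -EFinD lee_fin; lra.
rewrite UK; apply: (bigcup_measure_le (N := N) mFK homK) => n Nn.
pose lam : R := 4 / (s + 2).
have s20 : 0 < s + 2 by lra.
have lam0 : 0 < lam by rewrite divr_gt0.
have lam1 : lam <= 1 by rewrite ler_pdivrMr//; lra.
have lam01 : 0 <= lam <= 1 by rewrite (ltW lam0).
have KK i : Klo n i <= Khi n i.
  by have := r0 n; rewrite /Klo /Khi; case: eqP => _; rewrite ?lerDl//; lra.
have LL i : Llo n i <= Lhi n i.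
  by have := r0 n; rewrite /Llo /Lhi; case: eqP => _; lra.
have := lcZ (box_compact (lo := Klo n) (hi := Khi n)) (box_compact (lo := Llo n) (hi := Lhi n))
  (box_nonempty KK) (box_nonempty LL) lam01.
rewrite box_combination// => hlc.
have {}hlc : (P (FK n) `^ lam * P (FL n) `^ (1 - lam) <= (4^-1)%:E)%E.
  apply: (le_trans hlc); apply: le_trans chebyshev2.
  apply: le_measure; rewrite ?inE; [exact: mbox|exact: mabs|].
  move=> w /= /(_ l); rewrite /Klo /Llo eqxx => /andP[h _].
  apply: le_trans (ler_norm _); apply: le_trans h.
  have : lam * (s + 2) = 4 by rewrite mulfVK ?gt_eqF.
  lra.
have fK : P (FK n) \is a fin_num by exact: fin_num_measure.
have fL : P (FL n) \is a fin_num by exact: fin_num_measure.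
pose a := fine (P (FK n)); pose b := fine (P (FL n)).
have aE : P (FK n) = a%:E by rewrite fineK.
have bE : P (FL n) = b%:E by rewrite fineK.
have a0 : 0 <= a by rewrite fine_ge0.
have b2 : 2^-1 <= b.
  rewrite -lee_fin -bE; apply: (le_trans (ltW hN)).
  by apply: le_measure; rewrite ?inE//; apply/subsetPset; exact: homL.
move: hlc; rewrite aE bE !poweR_EFin -EFinM !lee_fin => hlc.
have b1 : 2^-1 <= b `^ (1 - lam).
  apply: (@le_trans _ _ (2^-1 `^ (1 - lam))); last by apply: le_powR2r => //; lra.
  by rewrite -[leLHS]powRr1//; apply: ger_powR; lra.
(* Since [1/2 <= expR (- 1/2)], raising to the power [1 / lam = (s + 2) / 4] gives
   [expR (- (s + 2) / 8)]. *)
have al : a `^ lam <= 2^-1.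
  have := ler_wpM2l (powR_ge0 a lam) b1; lra.
have -> : a = (a `^ lam) `^ lam^-1 by rewrite powRK// gt_eqF.
apply: (@le_trans _ _ ((expR (- 2^-1)) `^ lam^-1)).
  apply: le_powR2r; [by rewrite invr_ge0 ltW|exact: powR_ge0|].
  by have := expR_ge1Dx (- 2^-1 : R); lra.
rewrite -expRM ler_expR /lam invf_div; lra.
Qed.

End LogConcaveTail.

Section LogConcaveMoment.
Context d (T : measurableType d) (R : realType) (P : probability T R) (k : nat).

(** The value of [exp_moment_le] for [a = 2], [rho = expR (- 1/8)] and [c = 1/16]. The 2 counts both
    tails and also makes the tail bound trivial for the integers 0 and 1. *)
Definition log_concave_exp_cst : R :=
  2 * expR 16^-1 / (1 - expR 16^-1 * expR (- 8^-1)).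

Lemma log_concave_exp_cst_ge0 : 0 <= log_concave_exp_cst.
Proof.
rewrite /log_concave_exp_cst divr_ge0 ?mulr_ge0 ?expR_ge0// subr_ge0 -expRD.
by rewrite -[leRHS]expR0 ler_expR; lra.
Qed.

Lemma isotropic_sq (Z : T -> 'rV[R]_k) (l : 'I_k) : isotropic P Z ->
  (\int[P]_w ((Z w ord0 l) ^+ 2)%:E = 1%:E)%E.
Proof.
move=> [meanZ covZ]; have := covZ l l; rewrite mxE eqxx covariance.unlock meanZ expectation.unlock.
move=> <-; apply: eq_integral => w _ /=.
rewrite -[in LHS](subr0 (Z w ord0 l)) expr2.
by [].
Qed.

Lemma log_concave_exp_moment (Z : T -> 'rV[R]_k) (l : 'I_k) :
  (forall i, measurable_fun [set: T] (fun w => Z w ord0 i)) ->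
  log_concave P Z -> isotropic P Z ->
  (\int[P]_w (expR (16^-1 * `|Z w ord0 l|))%:E <= log_concave_exp_cst%:E)%E.
Proof.
move=> mZ lcZ isoZ.
have varZ := isotropic_sq l isoZ.
have mNZ i : measurable_fun [set: T] (fun w => (- Z w) ord0 i).
  under eq_fun do rewrite mxE.
  by apply: (measurableT_comp (@oppr_measurable R setT)); exact: mZ.
have varNZ : (\int[P]_w (((- Z w) ord0 l) ^+ 2)%:E <= 1%:E)%E.
  by under eq_integral do rewrite mxE sqrrN; rewrite varZ.
apply: exp_moment_le => //.
- exact: measurable_normr_fun.
- by rewrite -expRD -[ltRHS]expR0 ltr_expR; lra.
move=> n; rewrite -expRM_natl.
have [n2|n2] := ltnP n 2.
  apply: (@le_trans _ _ 1%:E).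
    exact/probability_le1/measurable_superlevel/measurable_normr_fun.
  rewrite lee_fin; have : n%:R <= 1 :> R by rewrite (ler_nat _ _ 1) -ltnS.
  have := expR_ge1Dx (n%:R * - 8^-1 : R); lra.
have n2' : 2 <= n%:R :> R by rewrite ler_nat.
apply: (@le_trans _ _ (P ([set w | n%:R <= Z w ord0 l] `|` [set w | n%:R <= (- Z w) ord0 l]))%R).
  apply: le_measure; rewrite ?inE.
  - exact/measurable_superlevel/measurable_normr_fun.
  - by apply: measurableU; exact: measurable_superlevel.
  - by move=> w /=; rewrite mxE ler_normr => /orP.
apply: le_trans (measureU2 P (measurable_superlevel n%:R (mZ l)) (measurable_superlevel n%:R (mNZ l))) _.
have -> : 2 * expR (n%:R * - 8^-1) = expR (- (n%:R / 8)) + expR (- (n%:R / 8)) :> R.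
  by rewrite mulrN; ring.
rewrite EFinD; apply: leeD.
- by apply: log_concave_tail => //; rewrite varZ.
- by apply: log_concave_tail => //; exact: log_concaveN.
Qed.

End LogConcaveMoment.


(** * Row norms with log-concave weights *)

Section WeightedRows.
Context {R : realType} {I J : finType} (s gam C0 : R).
Hypotheses (s2 : 2 <= s) (gam0 : 0 < gam) (C00 : 0 <= C0).
Context d (T : measurableType d) (P : probability T R).
Variables (Z : I -> J -> T -> R) (B : I -> J -> R) (rho : R).
Hypothesis mZ : forall i j, measurable_fun [set: T] (Z i j).
Hypothesis expZ : forall i j, (\int[P]_w (expR (16^-1 * `|Z i j w|))%:E <= C0%:E)%E.
Hypotheses (I2 : (2 <= #|I|)%N).
Hypothesis rowB : forall i, \sum_j `|B i j| `^ s <= rho `^ s.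

Let a : R := gam * s.
Let kap : R := (a / 32^-1) `^ a.

Definition weighted_cst : R := 32 `^ gam * (2 + kap * C0).

(** If all [|Z|] in a row are at most [th = 32 * L], its norm is at most [th ^ gam * rho]. Beyond
    [th], [expR (z / 32) <= expR (- L) * expR (z / 16)], and [expR (- L) = 1 / m] pays for summing
    the excess over all rows. *)
Let weighted_row_norm_pos : 0 < rho ->
  (\int[P]_w (max_row_norm s (fun i j => `|Z i j w| `^ gam * B i j))%:E <=
   (weighted_cst * (ln #|I|%:R `^ gam * rho))%:E)%E.
Proof.
move=> rho0; have card2 : 2 <= #|I|%:R :> R by rewrite ler_nat.
have L2 := ln_ge_half card2; set L := ln _ in L2 *.
have S2 := s2; have s0 : 0 < s by lra.
have a0 : 0 < a by rewrite mulr_gt0.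
pose m : R := #|I|%:R.
have m0 : 0 < m by rewrite ltr0n; case: #|I| I2.
have eL : expR (- L) = m^-1 by rewrite expRN lnK ?posrE.
pose th := 32 * L; have th1 : 1 <= th by rewrite /th; lra.
have th0 : 0 < th by lra.
have kap0 : 0 <= kap by exact: powR_ge0.
pose xi w := \sum_i \sum_j (`|B i j| `^ s * (kap * m^-1)) * expR (16^-1 * `|Z i j w|).
have km0 : 0 <= kap * m^-1 by rewrite mulr_ge0 ?invr_ge0 ?(ltW m0).
have xi0 w : 0 <= xi w.
  apply: sumr_ge0 => i _; apply: sumr_ge0 => j _.
  by rewrite mulr_ge0 ?expR_ge0// mulr_ge0 ?powR_ge0.
pose D := rho `^ s * th `^ a.
have rp : 0 < rho `^ s by rewrite powR_gt0.
have ta : 0 < th `^ a by rewrite powR_gt0.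
have D0 : 0 < D by rewrite mulr_gt0.
have point z : 0 <= z -> z `^ a <= th `^ a + kap * m^-1 * expR (16^-1 * z).
  move=> z0; have [zt|tz] := leP z th.
    rewrite -[leLHS]addr0; apply: lerD; first by apply: le_powR2r => //; exact: ltW.
    by rewrite mulr_ge0 ?expR_ge0.
  have c0 : (0 : R) < 32^-1 by rewrite invr_gt0.
  apply: le_trans (powR_le_expR a0 c0 z0) _.
  rewrite -/kap; apply: (@le_trans _ _ (kap * m^-1 * expR (16^-1 * z))); last first.
    by rewrite lerDr powR_ge0.
  rewrite -eL -mulrA -expRD; apply: ler_wpM2l => //; rewrite ler_expR.
  by move: tz; rewrite /th; lra.
have rowle w i : \sum_j `| `|Z i j w| `^ gam * B i j | `^ s <= D + xi w.
  apply: (@le_trans _ _ (\sum_j `|B i j| `^ s * th `^ a +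
      \sum_j (`|B i j| `^ s * (kap * m^-1)) * expR (16^-1 * `|Z i j w|))).
    rewrite -big_split/=; apply: ler_sum => j _.
    rewrite normrM powRM// (ger0_norm (powR_ge0 _ gam)) -powRrM -/a mulrC -mulrA -mulrDr.
    by apply: ler_wpM2l; [exact: powR_ge0|exact: point].
  apply: lerD.
    by rewrite -mulr_suml; apply: ler_wpM2r; [exact: ltW|].
  rewrite /xi (bigD1 i)//= lerDl; apply: sumr_ge0 => i' _; apply: sumr_ge0 => j _.
  by rewrite mulr_ge0 ?expR_ge0// mulr_ge0 ?powR_ge0.
have sV : 0 <= s^-1 <= 1 by rewrite invr_ge0 (ltW s0) invf_le1//; lra.
have DE : D `^ s^-1 = rho * th `^ gam.
  rewrite powRM ?powR_ge0// powRK ?(ltW rho0) ?gt_eqF//; congr (_ * _).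
  by rewrite /a powRrM powRK ?powR_ge0 ?gt_eqF.
have mexp i j : measurable_fun [set: T] (fun w => expR (16^-1 * `|Z i j w|)).
  apply: measurableT_comp; first exact: measurable_expR.
  by apply: measurable_funM => //; exact: measurable_normr_fun.
have mxij i j : measurable_fun [set: T]
    (fun w => (`|B i j| `^ s * (kap * m^-1)) * expR (16^-1 * `|Z i j w|)).
  exact: measurable_funM.
have mxi : measurable_fun [set: T] xi.
  by apply: measurable_sum => i; exact: measurable_sum.
have xij0 i j w : 0 <= (`|B i j| `^ s * (kap * m^-1)) * expR (16^-1 * `|Z i j w|).
  by rewrite mulr_ge0 ?expR_ge0// mulr_ge0 ?powR_ge0.
have intxi : (\int[P]_w (xi w)%:E <= (kap * C0 * rho `^ s)%:E)%E.
  apply: le_trans (integral_sum_le (c := fun=> kap * m^-1 * C0 * rho `^ s) _ _ _ _) _.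
  - by move=> i; exact: measurable_sum.
  - by move=> i w; exact: sumr_ge0.
  - move=> i; apply: le_trans (integral_sum_le
      (c := fun j => `|B i j| `^ s * (kap * m^-1) * C0) _ (mxij i) (xij0 i) _) _.
      move=> j; apply: integral_scale_le => //.
      exact: mulr_ge0 (powR_ge0 _ _) km0.
    rewrite lee_fin -!mulr_suml -mulrA mulrC; apply: ler_wpM2l => //.
    exact: mulr_ge0.
  rewrite sumr_const lee_fin -[_ *+ _]mulr_natl -/m le_eqVlt; apply/orP; left; apply/eqP.
  by field; rewrite gt_eqF.
have Dv : 0 <= D^-1 by rewrite invr_ge0 ltW.
apply: (integral_le (g := fun w => D `^ s^-1 * (2 + D^-1 * xi w))) => [w|w|].
- exact: max_row_norm_ge0.
- apply: bigmax_le => [|i _].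
    by rewrite mulr_ge0 ?powR_ge0// addr_ge0// mulr_ge0.
  apply: le_trans (_ : (D + xi w) `^ s^-1 <= _).
    apply: le_powR2r => //; first by have /andP[] := sV.
    by apply: sumr_ge0 => j _; exact: powR_ge0.
  have Dx : 0 <= D + xi w by rewrite addr_ge0// ltW.
  have := powR_le_affine sV D0 Dx.
  by rewrite (_ : 1 + _ / D = 2 + D^-1 * xi w)//; field; rewrite gt_eqF.
apply: (@le_trans _ _ (D `^ s^-1 * (2 + D^-1 * (kap * C0 * rho `^ s)))%:E).
  apply: integral_scale_le; [| |exact: powR_ge0|].
  - by apply: measurable_funD => //; exact: measurable_funM.
  - by move=> w; apply: addr_ge0 => //; apply: mulr_ge0.
  apply: integral_add_le.
  - exact: measurable_cst.
  - exact: measurable_funM.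
  - by [].
  - by move=> w; apply: mulr_ge0.
  - by rewrite integral_cst_real.
  - exact: integral_scale_le.
rewrite lee_fin DE.
have -> : D^-1 * (kap * C0 * rho `^ s) = kap * C0 / th `^ a.
  by rewrite /D; field; rewrite !gt_eqF.
have L0 : 0 <= L by lra.
rewrite /weighted_cst /th powRM// -/th.
apply: (@le_trans _ _ (rho * (32 `^ gam * L `^ gam) * (2 + kap * C0))); last first.
  by rewrite le_eqVlt; apply/orP; left; apply/eqP; ring.
apply: ler_wpM2l; first by rewrite !mulr_ge0 ?powR_ge0// ltW.
rewrite lerD2l ler_pdivrMr// ler_peMr ?mulr_ge0//.
by rewrite -[leLHS](powRr0 th); apply: ler_powR => //; exact: ltW.
Qed.

Lemma weighted_row_norm : 0 <= rho ->
  (\int[P]_w (max_row_norm s (fun i j => `|Z i j w| `^ gam * B i j))%:E <=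
   (weighted_cst * (ln #|I|%:R `^ gam * rho))%:E)%E.
Proof.
rewrite le_eqVlt => /predU1P[/esym rz|]; last exact: weighted_row_norm_pos.
have S2 := s2; have s0 : 0 < s by lra.
have B0 i j : B i j = 0.
  have h0 : \sum_j `|B i j| `^ s = 0.
    apply/eqP; rewrite eq_le sumr_ge0 ?andbT => [|j' _]; last exact: powR_ge0.
    by have := rowB i; rewrite rz powR0// gt_eqF.
  move/eqP: h0; rewrite psumr_eq0; last by move=> j' _; exact: powR_ge0.
  by move=> /allP/(_ j (mem_index_enum _))/=/eqP/powR_eq0_eq0/eqP; rewrite normr_eq0 => /eqP.
rewrite (eq_integral (cst 0%E)) ?integral0 ?rz ?mulr0// => w _.
congr (_%:E); apply/eqP; rewrite eq_le max_row_norm_ge0 andbT.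
apply: bigmax_le => // i _; rewrite big1 => [|j _]; last first.
  by rewrite B0 mulr0 normr0 powR0// gt_eqF.
by rewrite powR0// invr_eq0 gt_eqF.
Qed.

Lemma weighted_cst_ge0 : 0 <= weighted_cst.
Proof. by rewrite mulr_ge0 ?powR_ge0// addr_ge0// mulr_ge0 ?powR_ge0. Qed.

End WeightedRows.

(** * Conditioning on the log-concave matrix *)


Section BorelMatrices.
Context {R : realType} {m n : nat}.

Definition entries (M : 'M[R]_(m, n)) : @coordType R ('I_m * 'I_n)%type :=
  fun e => M e.1 e.2.

Lemma measurable_entry (i : 'I_m) (j : 'I_n) :
  measurable_fun [set: g_sigma_algebraType (@open 'M[R]_(m, n))]
    (fun M : g_sigma_algebraType (@open 'M[R]_(m, n)) => (M : 'M[R]_(m, n)) i j).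
Proof.
apply: (measurability _ (RGenInftyO.measurableE R)) => //.
move=> _ [_ [a ->] <-]; rewrite setTI; apply: sub_sigma_algebra.
apply: open_comp; last exact: interval_open.
by move=> M _; exact: coord_continuous.
Qed.

(** Entries are continuous, so the coordinate sigma-algebra is contained in the Borel one, in which
    [independent_rv] is stated. *)
Lemma entries_borel (A : set (@coordType R ('I_m * 'I_n)%type)) : measurable A ->
  <<s open >> (entries @^-1` A).
Proof.
move=> mA.
have mE : measurable_fun [set: g_sigma_algebraType (@open 'M[R]_(m, n))]
   (entries : g_sigma_algebraType (@open 'M[R]_(m, n)) -> _).
  by apply: measurable_coordP => e; exact: measurable_entry.
by have := mE measurableT _ mA; rewrite setTI.
Qed.

Context d (T : measurableType d) (P : probability T R).
Variables G Z : 'I_m -> 'I_n -> {RV P >-> R}.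

Lemma independent_entries : independent_rv P (random_mx G) (random_mx Z) ->
  forall A B : set (@coordType R ('I_m * 'I_n)%type), measurable A -> measurable B ->
  (P ((fun w e => G e.1 e.2 w) @^-1` A `&` (fun w e => Z e.1 e.2 w) @^-1` B) =
   P ((fun w e => G e.1 e.2 w) @^-1` A) * P ((fun w e => Z e.1 e.2 w) @^-1` B))%E.
Proof.
move=> ind A B mA mB.
have E (Y : 'I_m -> 'I_n -> {RV P >-> R}) :
    (fun w e => Y e.1 e.2 w) = (fun w => entries (random_mx Y w)).
  by apply/funext => w; apply/funext => e; rewrite /entries mxE.
rewrite !E; exact: (ind _ _ (entries_borel mA) (entries_borel mB)).
Qed.

End BorelMatrices.

Section OperatorNorm.
Context {R : realType} {m n : nat}.

(** The same bound that estimates the [sup] shows that its set is bounded; [t = 0] shows that it is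
    nonempty and gives the lower bound 0. *)
Lemma lr_opnorm_le_dyadic (p p' q : R) (K : nat) (A : 'M[R]_(m, n)) :
  0 < p' -> p^-1 + p'^-1 = 1 -> 1 <= q -> (n <= 2 ^ K)%N ->
  0 <= lr_opnorm p' q A <= (dyadic_norm p q K (fun i j => A i j)) `^ q^-1.
Proof.
move=> p'0 pp' q1 nK; have q0 : 0 < q by lra.
set N := _ `^ _.
set S := [set lr_norm q (A *m t) | t in [set t : 'cV[R]_n | lr_norm p' t <= 1]].
have SN : ubound S N.
  move=> _ [t /= t1 <-]; rewrite /lr_norm /N; apply: le_powR2r.
  - by rewrite invr_ge0 ltW.
  - by apply: sumr_ge0 => i _; exact: powR_ge0.
  have t1' : \sum_j `|t j ord0| `^ p' <= 1.
    have s0 : 0 <= \sum_j `|t j ord0| `^ p' by apply: sumr_ge0 => j _; exact: powR_ge0.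
    have -> : 1 = 1 `^ p' :> R by rewrite powR1.
    rewrite -[leLHS](@powRVK _ p') ?gt_eqF//.
    by apply: le_powR2r => //; [exact: ltW|exact: powR_ge0].
  have JK : (#|'I_n| <= 2 ^ K)%N by rewrite card_ord.
  have := le_dyadic_norm (fun i j => A i j) p'0 pp' q1 JK t1'.
  by rewrite /row_power; apply: le_trans; apply: ler_sum => i _; rewrite mxE.
have S0 : S 0.
  exists 0; rewrite /lr_norm /=.
    rewrite big1 ?powR0 ?invr_eq0 ?gt_eqF// => i _.
    by rewrite mxE normr0 powR0 ?gt_eqF.
  rewrite mulmx0 big1 ?powR0 ?invr_eq0 ?gt_eqF// => i _.
  by rewrite mxE normr0 powR0 ?gt_eqF.
apply/andP; split; first by apply: ub_le_sup => //; exists N.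
by apply: ge_sup => //; exists 0.
Qed.

End OperatorNorm.

(** * Freezing the log-concave matrix *)

Section Conditioning.
Context {R : realType} {m n : nat} (p p' q gam : R).
Hypotheses (p2 : 2 <= p) (q2 : 2 <= q) (pp' : p^-1 + p'^-1 = 1).
Context d (T : measurableType d) (P : probability T R).
Variables (B : 'M[R]_(m, n)) (G Z : 'I_m -> 'I_n -> {RV P >-> R}).
Hypotheses (m2 : (2 <= m)%N) (gG : forall i j, std_gaussian (G i j)).
Hypothesis indG : mutually_independent P
  (fun ij : 'I_m * 'I_n => G ij.1 ij.2 : T -> R).
Hypothesis indGZ : independent_rv P (random_mx G) (random_mx Z).

Let a w i j : R := `|Z i j w| `^ gam * B i j.
Let L : R := ln m%:R.
Let W := @coordType R ('I_m * 'I_n)%type.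
Let g w : W := fun e => G e.1 e.2 w.
Let z w : W := fun e => Z e.1 e.2 w.

Definition max_entry (x : 'I_m -> 'I_n -> R) : R :=
  \big[Num.max/0]_i \big[Num.max/0]_j `|x i j|.

Lemma max_entry_ge0 x : 0 <= max_entry x.
Proof. exact: bigmax_ge_id. Qed.

Lemma le_max_entry x i j : `|x i j| <= max_entry x.
Proof.
apply: le_trans (le_bigmax _ (fun i => \big[Num.max/0]_j `|x i j|) i).
exact: (le_bigmax _ (fun j => `|x i j|)).
Qed.

Let mW e : measurable_fun [set: W] (fun x : W => x e).
Proof. exact: measurable_coord. Qed.

Let mY (Y : 'I_m -> 'I_n -> {RV P >-> R}) : measurable_fun [set: T] (fun w => (fun e => Y e.1 e.2 w) : W).
Proof. by apply: measurable_coordP => e; exact: measurable_funPT. Qed.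

Let x_of (u : W * W) i j : R := `|u.2 (i, j)| `^ gam * B i j * u.1 (i, j).

Let mx_of i j : measurable_fun [set: W * W] (fun u => x_of u i j).
Proof.
apply: measurable_funM.
  apply: measurable_funM; last exact: measurable_cst.
  apply/measurable_powR_fun/measurable_normr_fun.
  by apply: (@measurableT_comp _ _ _ _ _ _ (fun x : W => x (i, j)) setT snd).
by apply: (@measurableT_comp _ _ _ _ _ _ (fun x : W => x (i, j)) setT fst).
Qed.

(** With [Z] frozen at a second sample [w'], the inner integral concerns a Gaussian matrix with
    deterministic coefficients [a w']. *)
Let conditioning (h : ('I_m -> 'I_n -> R) -> R) : (forall x, 0 <= h x) ->
  measurable_fun [set: W * W] (fun u => h (x_of u)) ->
  (\int[P]_w (h (fun i j => a w i j * G i j w))%:E =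
   \int[P]_w' \int[P]_w (h (fun i j => a w' i j * G i j w))%:E)%E.
Proof.
move=> h0 mh.
apply: (integral_independent_pair (U := g) (V := z) (mY G) (mY Z)
  (independent_entries indGZ) (h := fun u => (h (x_of u))%:E)).
- exact/measurable_EFinP.
- by move=> u; rewrite lee_fin.
Qed.

Let indep_G : mutually_independent P (fun e : 'I_m * 'I_n => G e.1 e.2 : T -> R) := indG.

Let rows w : R := max_row_norm p (a w).
Let cols w : R := max_row_norm q (fun j i => a w i j).
Let ents w : R := max_entry (a w).
Let ell : R := L `^ q^-1.
Let ell1 : R := L `^ (1 + q^-1).

Let dyadic_norm_ents0 (K : nat) (x : 'I_m -> 'I_n -> R) : (forall i j, x i j = 0) ->
  dyadic_norm p q K x `^ q^-1 = 0.
Proof.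
move=> x0; have Q2 := q2; have q0 : 0 < q by lra.
suff -> : dyadic_norm p q K x = 0 by rewrite powR0// invr_eq0 gt_eqF.
apply/eqP; rewrite eq_le bigmax_ge_id andbT; apply: bigmax_le => // s _.
rewrite /row_power big1// => i _; rewrite big1 ?normr0 ?powR0 ?gt_eqF//.
by move=> j _; rewrite x0 mul0r.
Qed.

Let gc : R := gaussian_cst p q.

Lemma gaussian_cst_ge0 : 0 <= gaussian_cst p q.
Proof.
have lc : 0 <= pow_exp_cst (2 * p) * gauss_exp_cst R.
  exact: mulr_ge0 (powR_ge0 _ _) gauss_exp_cst_ge0.
have Aq := le_trans ler01 (average_cst_ge1 q2).
have Ap := le_trans ler01 (average_cst_ge1 p2).
have P2 := p2; have h0 : 0 <= heavy_rate p by rewrite /heavy_rate; lra.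
have lc2 : 0 <= 4 * (2 + pow_exp_cst (2 * p) * gauss_exp_cst R) by lra.
have Mp := max_norm_cst_ge0 p; have Mq := max_norm_cst_ge0 q.
have n0 k : 0 <= k%:R :> R by [].
rewrite /gaussian_cst; apply: mulr_ge0; first exact: n0.
apply: addr_ge0; first apply: addr_ge0; first exact: mulr_ge0.
  apply: addr_ge0; first by apply: mulr_ge0; [exact: mulr_ge0|exact: addr_ge0].
  by apply: mulr_ge0; [exact: mulr_ge0|exact: addr_ge0].
apply: addr_ge0; apply: mulr_ge0 => //.
- by apply: mulr_ge0 => //; exact: mulr_ge0.
- exact: addr_ge0.
- exact: mulr_ge0.
Qed.

Lemma conditional_dyadic_norm (K : nat) :
  (\int[P]_w (dyadic_norm p q K (fun i j => a w i j * G i j w) `^ q^-1)%:E <=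
   \int[P]_w (gc * (cols w + ell * rows w + ell1 * ents w))%:E)%E.
Proof.
have P2 := p2; have Q2 := q2; have p0 : 0 < p by lra.
have q0 : 0 < q by lra.
have gc0 : 0 <= gc by exact: gaussian_cst_ge0.
rewrite (conditioning (h := fun x => dyadic_norm p q K x `^ q^-1)); first last.
- by apply: measurable_powR_fun; exact: measurable_dyadic_norm.
- by move=> x; exact: powR_ge0.
apply: ge0_le_integralT => w'; first by apply: integral_ge0 => w _; rewrite lee_fin powR_ge0.
(* The Gaussian bound needs positive [r] and [sg]. Either all coefficients vanish and so does the
   left side, or both maxima are positive. *)
have [e0|eN] := eqVneq (ents w') 0.
  have az i j : a w' i j = 0.
    have := le_max_entry (a w') i j; rewrite -/(ents w') e0 normr_le0 => /eqP //.
  rewrite (eq_integral (cst 0%E)); last first.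
    by move=> w _; rewrite dyadic_norm_ents0// => i j; rewrite az mul0r.
  rewrite integral0 lee_fin; apply: mulr_ge0 => //.
  by rewrite !addr_ge0 ?mulr_ge0 ?powR_ge0 ?max_row_norm_ge0 ?max_entry_ge0.
have e0 : 0 < ents w' by rewrite lt_neqAle eq_sym eN max_entry_ge0.
have r0 : 0 < rows w'.
  rewrite lt_neqAle eq_sym max_row_norm_ge0 andbT; apply: contraNneq eN => rz.
  rewrite eq_le max_entry_ge0 andbT; apply: bigmax_le => // i _; apply: bigmax_le => // j _.
  have := le_max_row_norm (a w') i p0; rewrite -/(rows w') rz powR0 ?gt_eqF// => h.
  have h0 : \sum_j0 `|a w' i j0| `^ p = 0.
    by apply/eqP; rewrite eq_le h sumr_ge0// => j' _; exact: powR_ge0.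
  move/eqP: h0; rewrite psumr_eq0; last by move=> j' _; exact: powR_ge0.
  by move=> /allP/(_ j (mem_index_enum _))/=/eqP/powR_eq0_eq0 ->.
have := gaussian_dyadic_norm (G := fun e => G e.1 e.2) (a := a w') p2 q2 pp' indep_G
  (fun e => gG e.1 e.2) _ r0 e0 (max_row_norm_ge0 q (fun j i => a w' i j)) _ _ _ K.
rewrite !card_ord; apply => //.
- by move=> i; exact: le_max_row_norm.
- by move=> j; exact: (le_max_row_norm (fun j i => a w' i j) j q0).
- by move=> i j; exact: le_max_entry.
Qed.

(** Given [Z], the maximum of [|a * G|] is at least its value at an entry where [|a|] is largest,
    whose mean is at least [gauss_abs_cst] times [|a|]. This brings back the maximum of [|X|] that
    appears in the theorem. *)
Lemma conditional_entries :
  (((gauss_abs_cst : R)%:E) * \int[P]_w (ents w)%:E <=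
   \int[P]_w (max_entry (fun i j => a w i j * G i j w))%:E)%E.
Proof.
have ma i j : measurable_fun [set: T] (fun w => a w i j).
  apply: measurable_funM => //.
  by apply/measurable_powR_fun/measurable_normr_fun; exact: measurable_funPT.
have ments : measurable_fun [set: T] ents.
  apply: measurable_bigmax => i; apply: measurable_bigmax => j.
  exact: measurable_normr_fun.
have k0 : 0 <= gauss_abs_cst :> R by exact/ltW/gauss_abs_cst_gt0.
rewrite -ge0_integralZl_EFin//; first last.
- exact/measurable_EFinP.
- by move=> w _; rewrite lee_fin max_entry_ge0.
rewrite (conditioning (h := max_entry)); first last.
- apply: measurable_bigmax => i; apply: measurable_bigmax => j.
  exact: measurable_normr_fun.
- exact: max_entry_ge0.
apply: ge0_le_integralT => w'; first by rewrite -EFinM lee_fin mulr_ge0 ?max_entry_ge0.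
have [e0|[i [j eE]]] : ents w' = 0 \/ exists i j, ents w' = `|a w' i j|.
  rewrite /ents /max_entry.
  apply: (big_ind (fun y => y = 0 \/ exists i j, y = `|a w' i j|)) => [|x y|i _].
  - by left.
  - by move=> hx hy; rewrite /Order.max; case: ifP.
  apply: (big_ind (fun y => y = 0 \/ exists i j, y = `|a w' i j|)) => [|x y|j _].
  - by left.
  - by move=> hx hy; rewrite /Order.max; case: ifP.
  by right; exists i, j.
  by rewrite e0 mule0; apply: integral_ge0 => w _; rewrite lee_fin max_entry_ge0.
apply: (@le_trans _ _ (\int[P]_w (`|a w' i j| * `|G i j w|)%:E)%E); last first.
  apply: ge0_le_integralT => w; first by rewrite lee_fin mulr_ge0.
  rewrite lee_fin -normrM; exact: (le_max_entry (fun i j => a w' i j * G i j w)).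
under eq_integral do rewrite EFinM.
have G0 w : setT w -> (0 <= `|G i j w|%:E)%E by rewrite lee_fin.
have mG : measurable_fun [set: T] (fun w => `|G i j w|%:E).
  by apply/measurable_EFinP; apply: measurable_normr_fun; exact: measurable_funPT.
rewrite (ge0_integralZl_EFin _ _ G0)// eE muleC.
apply: lee_wpmul2l; first by rewrite lee_fin.
exact: gaussian_abs_ge.
Qed.

End Conditioning.


(** * Assembling the constants *)

Section Assembly.
Local Open Scope ereal_scope.
Context {R : realType}.

(** [z] is an extended real because the expected maximum of [|X|] is not known to be finite at this
    point. *)
Lemma integral_combination_le d (T : measurableType d) (P : probability T R)
    (f g h : T -> R) (k b e x y : R) (z : \bar R) :
  measurable_fun [set: T] f -> measurable_fun [set: T] g -> measurable_fun [set: T] h ->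
  (forall w, 0 <= f w)%R -> (forall w, 0 <= g w)%R -> (forall w, 0 <= h w)%R ->
  (0 <= k)%R -> (0 <= b)%R -> (0 <= e)%R ->
  \int[P]_w (f w)%:E <= x%:E -> \int[P]_w (g w)%:E <= y%:E ->
  \int[P]_w (h w)%:E <= z ->
  \int[P]_w (k * (f w + b * g w + e * h w))%:E <= k%:E * ((x + b * y)%:E + e%:E * z).
Proof.
move=> mf mg mh f0 g0 h0 k0 b0 e0 fx gy hz.
have mbg : measurable_fun [set: T] (fun w => b * g w)%R by exact: measurable_funM.
have mA : measurable_fun [set: T] (fun w => f w + b * g w)%R by exact: measurable_funD.
have A0 w : (0 <= f w + b * g w)%R by rewrite addr_ge0// mulr_ge0.
have tot0 w : setT w -> 0 <= (f w + b * g w + e * h w)%:E.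
  by rewrite lee_fin addr_ge0// mulr_ge0.
have mtot : measurable_fun [set: T] (fun w => (f w + b * g w + e * h w)%:E).
  by apply/measurable_EFinP; apply: measurable_funD => //; exact: measurable_funM.
under eq_integral do rewrite EFinM.
rewrite (ge0_integralZl_EFin _ _ tot0)//.
apply: lee_wpmul2l; first by rewrite lee_fin.
under eq_integral do rewrite EFinD EFinM.
have A0' w : setT w -> 0 <= (f w + b * g w)%:E by rewrite lee_fin.
have mA' : measurable_fun [set: T] (fun w => (f w + b * g w)%:E) by exact/measurable_EFinP.
have h0' w : setT w -> 0 <= (h w)%:E by rewrite lee_fin.
have mh' : measurable_fun [set: T] (fun w => (h w)%:E) by exact/measurable_EFinP.
have eh0 w : setT w -> 0 <= e%:E * (h w)%:E by rewrite -EFinM lee_fin mulr_ge0.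
have meh : measurable_fun [set: T] (fun w => e%:E * (h w)%:E) by exact: measurable_funeM.
rewrite (ge0_integralD _ _ A0' mA' eh0 meh)// (ge0_integralZl_EFin _ _ h0')//.
apply: leeD; last by apply: lee_wpmul2l; rewrite ?lee_fin.
apply: integral_add_le => // [w|]; first exact: mulr_ge0.
exact: integral_scale_le.
Qed.

Lemma merge_constants (gc cp cq ka u v : R) (z : \bar R) :
  (0 <= gc)%R -> (0 <= cp)%R -> (0 <= cq)%R -> (0 <= ka)%R ->
  (0 <= u)%R -> (0 <= v)%R -> 0 <= z ->
  gc%:E * ((cq * v + cp * u)%:E + ka%:E * z) <=
  (gc * (cp + cq + ka))%:E * (u%:E + v%:E + z).
Proof.
move=> gc0 cp0 cq0 ka0 u0 v0 z0.
rewrite EFinM -muleA; apply: lee_wpmul2l; first by rewrite lee_fin.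
rewrite -EFinD ge0_muleDr ?lee_fin ?addr_ge0//; apply: leeD.
  rewrite -EFinM lee_fin mulrDr addrC.
  by apply: lerD; apply: ler_wpM2r => //; lra.
by apply: lee_wpmul2r => //; rewrite lee_fin; lra.
Qed.

End Assembly.

Section MatrixNorms.
Context {R : realType} {m n : nat} (s : R) (B : 'M[R]_(m, n)).

Lemma max_lr_norm_row :
  \big[Num.max/0]_(i < m) lr_norm s (row i B)^T = max_row_norm s (fun i j => B i j).
Proof.
apply: eq_bigr => i _; rewrite /lr_norm; congr (_ `^ _).
by apply: eq_bigr => j _; rewrite !mxE.
Qed.

Lemma max_lr_norm_col :
  \big[Num.max/0]_(j < n) lr_norm s (col j B) = max_row_norm s (fun j i => B i j).
Proof.
apply: eq_bigr => j _; rewrite /lr_norm; congr (_ `^ _).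
by apply: eq_bigr => i _; rewrite !mxE.
Qed.

End MatrixNorms.

Theorem corollary4p2 (R : realType) (gamma p q p' : R)
    (hgamma : 0 <= gamma)
    (hp : (maxe 2%:E (gamma%:E)^-1 <= p%:E)%E)
    (hq : (maxe 2%:E (gamma%:E)^-1 <= q%:E)%E)
    (hp' : p^-1 + p'^-1 = 1) :
  exists C : R,
    forall (m n : nat) (B : 'M[R]_(m, n))
      (d : measure_display) (T : measurableType d) (P : probability T R)
      (G Z : 'I_m -> 'I_n -> {RV P >-> R}),
    (2 <= m)%N -> (2 <= n)%N ->
    (forall i j, std_gaussian (G i j)) ->
    mutually_independent P (fun ij : 'I_m * 'I_n => G ij.1 ij.2 : T -> R) ->
    independent_rv P (random_mx G) (random_mx Z) ->
    log_concave P (fun w => mxvec (random_mx Z w)) ->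
    isotropic P (fun w => mxvec (random_mx Z w)) ->
    let X : T -> 'M[R]_(m, n) :=
      fun w => \matrix_(i, j) (`|Z i j w| `^ gamma * B i j * G i j w) in
    ('E_P[fun w => lr_opnorm p' q (X w)] <=
     C%:E *
     ((ln m%:R `^ (q^-1 + gamma) *
         \big[Num.max/0]_(i < m) lr_norm p (row i B)^T)%:E +
      (ln n%:R `^ gamma * \big[Num.max/0]_(j < n) lr_norm q (col j B))%:E +
      (ln m%:R `^ (1 + q^-1))%:E *
         'E_P[fun w => (\big[Num.max/0]_(i < m) \big[Num.max/0]_(j < n)
                `|X w i j|)%R]))%E.
Proof.
have p2 : 2 <= p by rewrite -lee_fin; apply: le_trans hp; rewrite le_max lexx.
have q2 : 2 <= q by rewrite -lee_fin; apply: le_trans hq; rewrite le_max lexx.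
(* For [gamma = 0] the extended inverse is [+oo], which cannot lie below the real [p]. *)
have gam0 : 0 < gamma.
  rewrite lt_neqAle hgamma andbT eq_sym; apply/eqP => g0.
  have : (+oo <= p%:E)%E by apply: le_trans hp; rewrite g0 inve0 le_max lexx orbT.
  by rewrite leNgt ltry.
have p0 : 0 < p by lra.
have q0 : 0 < q by lra.
have q1 : 1 <= q by lra.
have p'0 : 0 < p'.
  have pV : p^-1 <= 2^-1 by rewrite lef_pV2 ?posrE.
  by rewrite -invr_gt0; lra.
pose C0 : R := log_concave_exp_cst R.
have C00 : 0 <= C0 by exact: log_concave_exp_cst_ge0.
pose cp := weighted_cst p gamma C0; pose cq := weighted_cst q gamma C0.
have cp0 : 0 <= cp by exact: weighted_cst_ge0.
have cq0 : 0 <= cq by exact: weighted_cst_ge0.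
pose ka : R := gauss_abs_cst^-1.
have ka0 : 0 <= ka by rewrite invr_ge0; exact/ltW/gauss_abs_cst_gt0.
pose gc := gaussian_cst p q.
have gc0 : 0 <= gc by exact: gaussian_cst_ge0.
exists (gc * (cp + cq + ka)) => m n B d T P G Z m2 n2 gG indG indGZ lcZ isoZ.
set X := (fun w : T => \matrix_(i, j) _); cbv zeta.
pose a w i j : R := `|Z i j w| `^ gamma * B i j.
pose L : R := ln m%:R.
have mZ l : measurable_fun [set: T] (fun w => mxvec (random_mx Z w) ord0 l).
  case/mxvec_indexP: l => i j; under eq_fun do rewrite mxvecE mxE.
  exact: measurable_funPT.
have expZ i j : (\int[P]_w (expR (16^-1 * `|Z i j w|))%:E <= C0%:E)%E.
  have := log_concave_exp_moment (mxvec_index i j) mZ lcZ isoZ.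
  by under eq_integral do rewrite mxvecE mxE.
have mZij i j : measurable_fun [set: T] (Z i j : T -> R) by exact: measurable_funPT.
pose rows w : R := max_row_norm p (a w).
pose cols w : R := max_row_norm q (fun j i => a w i j).
pose ents w : R := max_entry (a w).
rewrite max_lr_norm_row max_lr_norm_col.
set rho := max_row_norm p _; set kap := max_row_norm q _.
have XE w i j : X w i j = a w i j * G i j w by rewrite mxE.
have ma i j : measurable_fun [set: T] (fun w => a w i j).
  by apply: measurable_funM => //; exact/measurable_powR_fun/measurable_normr_fun.
have mrows : measurable_fun [set: T] rows by exact: measurable_max_row_norm.
have mcols : measurable_fun [set: T] cols by exact: measurable_max_row_norm.
have ments : measurable_fun [set: T] ents.
  apply: measurable_bigmax => i; apply: measurable_bigmax => j.
  exact: measurable_normr_fun.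
have L0 : 0 < L by rewrite ln_gt0// ltr1n.
(* The number of levels is set to [n]; the Gaussian bound does not depend on it. *)
have nK : (n <= 2 ^ n)%N by rewrite ltnW// ltn_expl.
pose u := L `^ (q^-1 + gamma) * rho; pose v := ln n%:R `^ gamma * kap.
have u0 : 0 <= u by rewrite mulr_ge0 ?powR_ge0 ?max_row_norm_ge0.
have v0 : 0 <= v by rewrite mulr_ge0 ?powR_ge0 ?max_row_norm_ge0.
(* The exponent [1/q + gamma] arises here: [L ^ (1/q)] comes from the Gaussian bound, [L ^ gamma]
   from the row weights. *)
have uE : L `^ q^-1 * (cp * (L `^ gamma * rho)) = cp * u.
  by rewrite /u powRD_gt0//; ring.
rewrite !expectation.unlock.
pose EX : \bar R := (\int[P]_w (max_entry (fun i j => a w i j * G i j w))%:E)%E.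
have -> : (\int[P]_w ((\big[Num.max/0]_(i < m) \big[Num.max/0]_(j < n) `|X w i j|)%R)%:E = EX)%E.
  apply: eq_integral => w _; congr (_%:E).
  by apply: eq_bigr => i _; apply: eq_bigr => j _; rewrite XE.
have EX0 : (0 <= EX)%E by apply: integral_ge0 => w _; rewrite lee_fin max_entry_ge0.
have z0 : (0 <= (L `^ (1 + q^-1))%:E * EX)%E by rewrite mule_ge0// lee_fin powR_ge0.
apply: (@le_trans _ _ (\int[P]_w (gc * (cols w + L `^ q^-1 * rows w + L `^ (1 + q^-1) * ents w))%:E)%E).
  apply: le_trans (conditional_dyadic_norm gamma p2 q2 hp' B m2 gG indG indGZ n).
  apply: ge0_le_integralT => w; rewrite lee_fin.
    by have /andP[] := lr_opnorm_le_dyadic (X w) p'0 hp' q1 nK.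
  have /andP[_] := lr_opnorm_le_dyadic (X w) p'0 hp' q1 nK.
  rewrite (_ : (fun i j => X w i j) = fun i j => a w i j * G i j w); first exact.
  by apply/funext => i; apply/funext => j; exact: XE.
apply: le_trans (merge_constants gc0 cp0 cq0 ka0 u0 v0 z0).
rewrite muleCA -uE.
apply: (integral_combination_le mcols mrows ments (fun w => max_row_norm_ge0 _ _)
  (fun w => max_row_norm_ge0 _ _) (fun w => max_entry_ge0 _) gc0 (powR_ge0 _ _) (powR_ge0 _ _)).
(* Applied to the transposed matrix: a maximum over [n] columns, hence the factor [ln n ^ gamma]. *)
- have cn : (1 < #|'I_n|)%N by rewrite card_ord.
  have := weighted_row_norm q2 gam0 C00 (fun j i => mZij i j) (fun j i => expZ i j) cn
    (fun j => le_max_row_norm (fun j i => B i j) j q0) (max_row_norm_ge0 _ _).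
  by rewrite card_ord.
- have cm : (1 < #|'I_m|)%N by rewrite card_ord.
  have := weighted_row_norm p2 gam0 C00 mZij expZ cm
    (fun i => le_max_row_norm (fun i j => B i j) i p0) (max_row_norm_ge0 _ _).
  by rewrite card_ord.
- rewrite lee_pdivlMl; last exact: gauss_abs_cst_gt0.
  exact: (conditional_entries gamma B gG indGZ).
Qed.
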